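(* Let $k\ge 1$, $l\ge 2$ and let $\mathbf b=(b_0,\dots,b_{l-2})$ be integers with $0\le b_0\le b_1\le\dots\le b_{l-2}\le k$. Then, as formal power series in $q,z$, $$\chi^{(\infty)}_{k,l;\mathbf b}(q,z)=\sum_{M} M v_\infty ,$$ where the sum is over all equivalence classes of good monomials $M$ in $A,B$. Moreover each term $Mv_\infty$ in the sum has the form $$\frac{(-1)^\alpha q^\beta z^\gamma}{(q)_{t_2}\cdots(q)_{t_l}\,(q^{t_2+\cdots+t_l}z)_\infty}$$ with some non-negative integers $\alpha,\beta,\gamma,t_2,\dots,t_l$.
   Context: Characters: a $(k,l)$-configuration is a sequence $(x_0,x_1,\dots)$ of non-negative integers with finitely many non-zero entries such that $x_j+\dots+x_{j+l-1}\le k$ for all $j\ge 0$. Its length is the smallest non-negative integer $N$ with $x_i=0$ for all $i\ge N$. $\mathcal C^{(N)}_{k,l;\mathbf b}$ is the set of $(k,l)$-configurations of length at most $N$ with $x_0+\dots+x_i\le b_i$ for $0\le i\le l-2$, and $\chi^{(N)}_{k,l;\mathbf b}(q,z)=\sum_{x\in\mathcal C^{(N)}_{k,l;\mathbf b}}q^{\sum_j jx_j}z^{\sum_j x_j}$, $\chi^{(\infty)}_{k,l;\mathbf b}=\lim_{N\to\infty}\chi^{(N)}_{k,l;\mathbf b}$ (as formal power series). Notation: $(u)_n=\prod_{i=0}^{n-1}(1-q^iu)$, $(u)_\infty=\prod_{i\ge0}(1-q^iu)$; in particular $(q)_n=\prod_{i=1}^n(1-q^i)$. Space and operators: for monomials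 $P_1,\dots,P_l$ in $q,z$ put $[P_1,\dots,P_l]=P_1^{b_0}P_2^{b_1-b_0}\cdots P_{l-1}^{b_{l-2}-b_{l-3}}P_l^{k-b_{l-2}}$, regarded as a function of $q,z,\mathbf b,k$. $V_l$ is the complex vector space spanned by the functions $f(q,z)[P_1,\dots,P_l]$ where $f\in\mathbb C[[q,z]]$ does not depend on $\mathbf b,k$ and $[P_1,\dots,P_l]$ is of the form $q^{mk}z^{nk}[q^{c_{l-j}}z,\dots,q^{c_{l-1}}z,1,q^{c_1},\dots,q^{c_{l-1-j}}]$ for some $0\le j\le l-1$, $m,n\ge0$, $0\le c_1\le\dots\le c_{l-1}$ integers. Let $(Sg)(q,z)=g(q,qz)$. The linear operators $A,B$ on $V_l$ are $$A(f[P_1,\dots,P_l])=S\Big(\frac{f}{1-q^{-1}zP_l/P_1}[P_1,P_1,P_2,\dots,P_{l-1}]\Big),$$ $$B(f[P_1,\dots,P_l])=S\Big(\frac{f}{1-qz^{-1}P_1/P_l}[q^{-1}zP_l,P_1,P_2,\dots,P_{l-1}]\Big),$$ where $S(q^{-1}zP_l/P_1)$ has the form $zq^n$ ($n\ge0$) or $q^{m}$ ($m<0$) and the factors $S(1-q^{-1}zP_l/P_1)^{-1}$, $S(1-qz^{-1}P_1/P_l)^{-1}$ are expanded as power series in $q,z$. Put $v_\infty=\frac{1}{(z)_\infty}[1,\dots,1]\in V_l$; it satisfies $Av_\infty=v_\infty$. Monomials: a monomial is a finite word $M=C_1\cdots C_m$ with $C_i\in\{A,B\}$, acting as the composition of operators.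 $M\sim M'$ iff $MA^r=M'A^{r'}$ as words for some $r,r'\ge0$. $M$ is good if for all $i$, $C_i=A$ implies $C_{i+l-1}=A$ (whenever $i+l-1\le m$); this depends only on the equivalence class, and $Mv_\infty$ depends only on the equivalence class. *)

(* Defs.v *)
From HB Require Import structures.
From mathcomp Require Import all_boot all_order all_algebra generic_quotient.
From mathcomp Require Import all_classical zify.

Set Implicit Arguments.
Unset Strict Implicit.
Unset Printing Implicit Defensive.

Import GRing.Theory.
Local Open Scope classical_set_scope.
Local Open Scope ring_scope.

Record fps (R : Type) := Fps { coefs :> nat -> R }.

Lemma fpsP (R : Type) (f g : fps R) : f =1 g -> f = g.
Proof. by case: f g => [f] [g] /= /funext ->. Qed.

HB.instance Definition _ (R : Type) := gen_eqMixin (fps R).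
HB.instance Definition _ (R : Type) := gen_choiceMixin (fps R).

Section FpsZmod.
Variable R : zmodType.
Implicit Types f g h : fps R.

Definition fps_add f g := Fps (fun n => f n + g n).
Definition fps_zero : fps R := Fps (fun=> 0).
Definition fps_opp f := Fps (fun n => - f n).

Lemma fps_addA : associative fps_add.
Proof. by move=> f g h; apply: fpsP => n; rewrite /= addrA. Qed.
Lemma fps_addC : commutative fps_add.
Proof. by move=> f g; apply: fpsP => n; rewrite /= addrC. Qed.
Lemma fps_add0 : left_id fps_zero fps_add.
Proof. by move=> f; apply: fpsP => n; rewrite /= add0r. Qed.
Lemma fps_addN : left_inverse fps_zero fps_opp fps_add.
Proof. by move=> f; apply: fpsP => n; rewrite /= addNr. Qed.

HB.instance Definition _ :=
  GRing.isZmodule.Build (fps R) fps_addA fps_addC fps_add0 fps_addN.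

Lemma coefsD f g n : (f + g) n = f n + g n. Proof. by []. Qed.
Lemma coefsN f n : (- f) n = - f n. Proof. by []. Qed.
Lemma coefs0 n : (0 : fps R) n = 0. Proof. by []. Qed.
Lemma coefsB f g n : (f - g) n = f n - g n. Proof. by []. Qed.
Lemma coefs_sum I (r : seq I) (P : pred I) (F : I -> fps R) n :
  (\sum_(i <- r | P i) F i) n = \sum_(i <- r | P i) F i n.
Proof.
by elim/big_rec2: _ => [//|i x y _ <-]; rewrite coefsD.
Qed.
End FpsZmod.

Section FpsRing.
Variable R : comNzRingType.
Implicit Types f g h : fps R.

Definition fpsC (c : R) : fps R := Fps (fun n => if n == 0 then c else 0).
Definition fpsX : fps R := Fps (fun n => (n == 1)%:R).
Definition fps_mul f g := Fps (fun n => \sum_(i < n.+1) f i * g (n - i)%N).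

Let trunc n f : {poly R} := \poly_(i < n.+1) f i.

Let coef_trunc n f i : (i <= n)%N -> (trunc n f)`_i = f i.
Proof. by move=> le_in; rewrite coef_poly ltnS le_in. Qed.

Let coefs_mul_trunc n f g i : (i <= n)%N ->
  fps_mul f g i = (trunc n f * trunc n g)`_i.
Proof.
move=> le_in; rewrite coefM; apply: eq_bigr => j _.
rewrite !coef_trunc //; first exact: leq_trans (leq_subr _ _) le_in.
by apply: leq_trans le_in; rewrite -ltnS.
Qed.

Let fps_mulC : commutative fps_mul.
Proof. by move=> f g; apply: fpsP => n; rewrite !(@coefs_mul_trunc n) 1?mulrC. Qed.

Let fps_mulA : associative fps_mul.
Proof.
move=> f g h; apply: fpsP => n.
have E f' g' h' : fps_mul f' (fps_mul g' h') n
    = (trunc n f' * (trunc n g' * trunc n h'))`_n.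
  rewrite coefM; apply: eq_bigr => j _.
  rewrite (@coefs_mul_trunc n) ?leq_subr // coef_trunc //.
  by rewrite -ltnS.
by rewrite E fps_mulC E mulrA (mulrC (trunc n h)).
Qed.

Let fps_mul1 : left_id (fpsC 1) fps_mul.
Proof.
move=> f; apply: fpsP => n /=.
by rewrite big_ord_recl /= mul1r subn0 big1 ?addr0 // => i _; rewrite mul0r.
Qed.

Let fps_mulD : left_distributive fps_mul (@fps_add R).
Proof.
move=> f g h; apply: fpsP => n /=; rewrite -big_split /=.
by apply: eq_bigr => i _; rewrite mulrDl.
Qed.

Let fps_1neq0 : fpsC 1 != 0.
Proof.
by apply/eqP => /(congr1 (fun f => coefs f 0))/eqP; rewrite /= oner_eq0.
Qed.

HB.instance Definition _ := GRing.Zmodule_isComNzRing.Build (fps R)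
  fps_mulA fps_mulC fps_mul1 fps_mulD fps_1neq0.

Lemma coefsM f g n : (f * g) n = \sum_(i < n.+1) f i * g (n - i)%N.
Proof. by []. Qed.
Lemma coefs1 n : (1 : fps R) n = (n == 0)%:R.
Proof. by case: n. Qed.

Lemma coefsCM c f n : (fpsC c * f) n = c * f n.
Proof.
rewrite coefsM big_ord_recl /= subn0 big1 ?addr0 // => i _.
by rewrite mul0r.
Qed.

Lemma coefsXM f n : (fpsX * f) n = if n is n'.+1 then f n' else 0.
Proof.
rewrite coefsM; case: n => [|n]; first by rewrite big_ord1 mul0r.
rewrite 2!big_ord_recl big1 => [|i _]; last by rewrite mul0r.
by rewrite mul0r mul1r addr0 add0r /= subSS subn0.
Qed.

Lemma coefsXnM m f n : (fpsX ^+ m * f) n = if (n < m)%N then 0 else f (n - m)%N.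
Proof.
elim: m n => [|m IH] n; first by rewrite mul1r subn0.
rewrite exprS -mulrA coefsXM; case: n => [//|n].
by rewrite IH ltnS subSS.
Qed.

Lemma coefsXn m n : (fpsX ^+ m) n = (n == m)%:R.
Proof.
rewrite -[_ ^+ _]mulr1 coefsXnM coefs1 subn_eq0.
by case: ltngtP.
Qed.

(* [^-1] is the inverse in the ring [fps R] whenever there is one. *)
Definition fps_unit : {pred fps R} := fun f => `[< exists g, g * f = 1 >].
Definition fps_inv f :=
  if fps_unit f then xget f [set g | g * f = 1] else f.

Let fps_mulVx : {in fps_unit, left_inverse 1 fps_inv *%R}.
Proof.
move=> f uf; rewrite /fps_inv ifT //; move/asboolP: uf => exg.
by case: xgetP => [g _ //|nog]; case: exg => g /nog.
Qed.
Let fps_unitPl f g : g * f = 1 -> fps_unit f.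
Proof. by move=> gf; apply/asboolP; exists g. Qed.
Let fps_inv_out : {in [predC fps_unit], fps_inv =1 id}.
Proof. by move=> f; rewrite inE => nuf; rewrite /fps_inv ifF //; apply/negbTE. Qed.

HB.instance Definition _ := GRing.ComNzRing_hasMulInverse.Build (fps R)
  fps_mulVx fps_unitPl fps_inv_out.
End FpsRing.

Lemma fps_integral (R : idomainType) :
  GRing.integral_domain_axiom (fps R).
Proof.
move=> f g fg0; apply/norP => -[nf ng].
have ex h : h != 0 :> fps R -> exists n, h n != 0.
  move=> nh; apply: contrapT => no; case/eqP: nh; apply: fpsP => n.
  by apply/eqP; apply: contra_notT no => hn; exists n.
case: (ex_minnP (ex _ nf)) => m fm minm.
case: (ex_minnP (ex _ ng)) => n gn minn.
have mmn : (m < (m + n).+1)%N by rewrite ltnS leq_addr.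
have : (f * g) (m + n)%N = 0 by rewrite fg0.
rewrite coefsM (bigD1 (Ordinal mmn)) //= addKn big1 ?addr0.
  by apply/eqP; rewrite mulf_neq0.
move=> i; rewrite -val_eqE /= neq_ltn => /orP[lim|lmi].
  suff /eqP-> : f i == 0 by rewrite mul0r.
  by apply: contraTT lim => /minm; rewrite -leqNgt.
suff /eqP-> : g (m + n - i)%N == 0 by rewrite mulr0.
have li : (i <= m + n)%N by rewrite -ltnS.
apply: contraTT lmi => /minn; rewrite -leqNgt => le_n.
by rewrite -(leq_add2r n) -leq_subRL.
Qed.

HB.instance Definition _ (R : idomainType) :=
  GRing.ComUnitRing_isIntegral.Build (fps R) (@fps_integral R).

(* [F[[q,z]] = F[[q]][[z]]]; the coefficient of [q^i z^j] is [coefqz f i j]. *)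
Notation psqz F := (fps (fps F)).

Section TwoVariables.
Variable F : fieldType.

Definition coefqz (f : psqz F) (i j : nat) : F := f j i.
Definition psC (c : F) : psqz F := fpsC (fpsC c).
Definition psq : psqz F := fpsC (@fpsX F).
Definition psz : psqz F := @fpsX (fps F).

(* coefficientwise limit, coefficients being eventually constant *)
Definition ps_lim (u : nat -> psqz F) : psqz F :=
  Fps (fun j => Fps (fun i =>
    xget 0 [set c | exists N0, forall N, (N0 <= N)%N -> coefqz (u N) i j = c])).

(* The family G indexed by D is summable coefficient by coefficient, with
   sum s. *)
Definition ps_sum (T : choiceType) (D : set T) (G : T -> psqz F) (s : psqz F) :=
  forall i j, finite_set (D `&` [set x | coefqz (G x) i j != 0]) /\
    coefqz s i j = \sum_(x \in D) coefqz (G x) i j.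

Definition qpoch (u : psqz F) (n : nat) : psqz F :=
  \prod_(i < n) (1 - psq ^+ i * u).
Definition qpoch_inf (u : psqz F) : psqz F := ps_lim (qpoch u).

(* f(q, q z) *)
Definition subst_qz (f : psqz F) : psqz F :=
  Fps (fun j => fpsX F ^+ j * f j).

End TwoVariables.

Arguments psq {F}.
Arguments psz {F}.

Definition is_config (k l : nat) (x : nat -> nat) : Prop :=
  (exists N, forall i, (N <= i)%N -> x i = 0%N) /\
  forall j, (\sum_(j <= i < j + l) x i <= k)%N.

Definition is_length (x : nat -> nat) (N : nat) : Prop :=
  (forall i, (N <= i)%N -> x i = 0%N) /\
  forall N', (forall i, (N' <= i)%N -> x i = 0%N) -> (N <= N')%N.

Definition configs (k l : nat) (b : l.-1.-tuple nat) (N : nat) :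
    set (nat -> nat) :=
  [set x | [/\ is_config k l x,
    exists2 L, is_length x L & (L <= N)%N &
    forall i : 'I_l.-1, (\sum_(0 <= j < i.+1) x j <= tnth b i)%N]].

Section Characters.
Variable F : fieldType.

Definition chi (k l : nat) (b : l.-1.-tuple nat) (N : nat) : psqz F :=
  \sum_(x \in configs k b N)
    (psq : psqz F) ^+ (\sum_(j < N) j * x j)%N * psz ^+ (\sum_(j < N) x j)%N.

Definition chi_inf (k l : nat) (b : l.-1.-tuple nat) : psqz F :=
  ps_lim (chi k b).

End Characters.

(* The monomial q^m z^n is represented by its exponents (m, n), so that the
   group of Laurent monomials is written additively. *)
Notation laurent := (int * int)%type.

Definition qn_mon (m : int) : laurent := (m, 0).
Definition zn_mon (n : int) : laurent := (0, n).

Definition subst_mon (x : laurent) : laurent := (x.1 + x.2, x.2).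

(* P_1, ..., P_l, numbered from 1 *)
Definition P_ (P : seq laurent) (i : nat) : laurent := nth 0 P i.-1.

Record params (l : nat) := Params {
  par_b : l.-1.-tuple nat;
  par_k : nat;
  par_k_gt0 : (0 < par_k)%N;
  par_sorted : sorted leq (rcons par_b par_k) }.

Section Space.
Variables (F : fieldType) (l : nat).

(* The monomials occurring in V_l have non-negative exponents; the value 0
   chosen for the others is never used. *)
Definition mon (x : laurent) : psqz F :=
  if (0 <= x.1) && (0 <= x.2) then psq ^+ `|x.1|%N * psz ^+ `|x.2|%N else 0.

(* expansion of 1 / (1 - x): for x with non-positive exponents it is
   - x^-1 / (1 - x^-1) *)
Definition inv_one_minus (x : laurent) : psqz F :=
  if (0 <= x.1) && (0 <= x.2) then (1 - mon x)^-1
  else - mon (- x) / (1 - mon (- x)).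

Definition vfun := params l -> psqz F.

(* b_i - b_(i-1) for 0 <= i < l, where b_(-1) = 0 and b_(l-1) = k *)
Definition expo (p : params l) (i : nat) : nat :=
  let s := 0%N :: rcons (par_b p) (par_k p) in nth 0%N s i.+1 - nth 0%N s i.

Definition bracket (P : seq laurent) : vfun :=
  fun p => \prod_(i < l) mon (P_ P i.+1) ^+ expo p i.

Definition term (f : psqz F) (P : seq laurent) : vfun :=
  fun p => f * bracket P p.

(* The prefactor q^(mk) z^(nk) multiplies every entry by q^m z^n, the
   exponents b_0, b_1 - b_0, ..., k - b_(l-2) having sum k. *)
Definition admissible (P : seq laurent) : Prop :=
  exists j m n : nat, exists c : l.-1.-tuple nat,
    [/\ (j <= l.-1)%N, sorted leq c &
      P = [seq (m%:Z, n%:Z) + x | x <-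
        [seq (a%:Z, 1) | a <- drop (l.-1 - j) c] ++
        0 :: [seq (a%:Z, 0) | a : nat <- take (l.-1 - j) c]]].

Definition vlin (n : nat) (c : 'I_n -> F) (g : 'I_n -> vfun) : vfun :=
  fun p => \sum_(i < n) psC (c i) * g i p.

Definition in_V (g : vfun) : Prop :=
  exists n (c : 'I_n -> F) (f : 'I_n -> psqz F) (P : 'I_n -> seq laurent),
    (forall i, admissible (P i)) /\ g = vlin c (fun i => term (f i) (P i)).

Definition linear_on_V (A : vfun -> vfun) : Prop :=
  (forall g, in_V g -> in_V (A g)) /\
  forall n (c : 'I_n -> F) (g : 'I_n -> vfun), (forall i, in_V (g i)) ->
    A (vlin c g) = vlin c (fun i => A (g i)).

(* S is a ring morphism, applied here to each factor separately: the factor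
   S(1 / (1 - x)) is the expansion of 1 / (1 - S x). *)
Definition is_opA (A : vfun -> vfun) : Prop :=
  linear_on_V A /\ forall f P, admissible P ->
    A (term f P) =
    term (subst_qz f *
            inv_one_minus (subst_mon (qn_mon (-1) + zn_mon 1 + P_ P l - P_ P 1)))
         [seq subst_mon x | x <- P_ P 1 :: take l.-1 P].

Definition is_opB (B : vfun -> vfun) : Prop :=
  linear_on_V B /\ forall f P, admissible P ->
    B (term f P) =
    term (subst_qz f *
            inv_one_minus (subst_mon (qn_mon 1 + zn_mon (-1) + P_ P 1 - P_ P l)))
         [seq subst_mon x | x <- (qn_mon (-1) + zn_mon 1 + P_ P l) :: take l.-1 P].

Definition v_inf : vfun := term (qpoch_inf psz)^-1 (nseq l 0).

End Space.

Inductive letter := LA | LB.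
Definition bool_of_letter (c : letter) := if c is LA then true else false.
Definition letter_of_bool (x : bool) := if x then LA else LB.
Lemma bool_of_letterK : cancel bool_of_letter letter_of_bool.
Proof. by case. Qed.
HB.instance Definition _ := Countable.copy letter (can_type bool_of_letterK).

Notation word := (seq letter).

Definition act (T : Type) (A B : T -> T) (M : word) (v : T) : T :=
  foldr (fun c w => if c is LA then A w else B w) v M.

(* the letter C_i of the word M is nth LB M (i - 1) *)
Definition good (l : nat) (M : word) : Prop :=
  forall i, (i + l.-1 < size M)%N -> nth LB M i = LA -> nth LB M (i + l.-1) = LA.

Definition word_eqv (M M' : word) : Prop :=
  exists r r', M ++ nseq r LA = M' ++ nseq r' LA.

Definition word_eqvb : rel word := fun M M' => `[< word_eqv M M' >].

Lemma word_eqv_equiv : equiv_class_of word_eqvb.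
Proof.
split=> [M|M M'|M' M M''].
- by apply/asboolP; exists 0%N, 0%N.
- by apply/asboolP/asboolP => -[r [r' e]]; exists r', r.
- move=> /asboolP[r [r' e]] /asboolP[s [s' e']].
  apply/asboolP; exists (r + s)%N, (s' + r')%N.
  rewrite !nseqD !catA e -e' -!catA -!nseqD addnC //.
Qed.

Canonical word_equiv := EquivRelPack word_eqv_equiv.

Definition word_class := {eq_quot word_equiv}%qT.

Section FpsUnit.
Variable R : comUnitRingType.

Lemma fps_unitE (f : fps R) : (f \is a GRing.unit) = (f 0%N \is a GRing.unit).
Proof.
apply/idP/idP => [uf|u0].
  apply/unitrPr; exists (f^-1 0%N).
  by have := congr1 (fun g => coefs g 0) (mulrV uf); rewrite /= big_ord1.
have low (h : fps R) : h 0%N = 0 -> forall m i, (i < m)%N -> (h ^+ m) i = 0.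
  move=> h0; elim=> [//|m IH] i; rewrite ltnS => le_im.
  rewrite exprS coefsM big1 // => -[[|j] /= lj] _; first by rewrite h0 mul0r.
  rewrite IH ?mulr0 //.
  by apply: leq_trans le_im; rewrite ltn_subrL /=; case: i lj.
pose u : fps R := 1 - fpsC (f 0%N)^-1 * f.
have u00 : u 0%N = 0 by rewrite coefsB coefsCM mulVr // subrr.
pose g : fps R := Fps (fun n => (\sum_(m < n.+1) u ^+ m) n).
have gE N n : (n < N)%N -> g n = (\sum_(m < N) u ^+ m) n.
  move=> lt_nN; rewrite /g /= !coefs_sum.
  rewrite [RHS](bigID (fun m : 'I_N => (m < n.+1)%N)) /= [X in _ + X]big1 ?addr0.
    by rewrite (big_ord_widen_cond N predT (fun m => (u ^+ m) n)).
  by move=> m; rewrite -leqNgt => /low; apply.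
have gu1 : (1 - u) * g = 1.
  apply: fpsP => n; have /(congr1 (fun h => coefs h n)) := subrX1 u n.+1.
  have -> : ((1 - u) * g) n = ((1 - u) * \sum_(m < n.+1) u ^+ m) n.
    rewrite !coefsM; apply: eq_bigr => i _; rewrite -gE //.
    by rewrite ltnS leq_subr.
  rewrite -[1 - u]opprB mulNr => E; rewrite coefsN -E coefsB low //.
  by rewrite sub0r opprK.
apply/unitrPr; exists (fpsC (f 0%N)^-1 * g).
rewrite mulrA [f * _]mulrC.
by have <- : 1 - u = fpsC (f 0%N)^-1 * f by rewrite /u subKr.
Qed.
End FpsUnit.

Section TwoVariablesFacts.
Variable F : fieldType.
Implicit Types f g h u : psqz F.

Lemma psqzP f g : (forall i j, coefqz f i j = coefqz g i j) -> f = g.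
Proof. by move=> fg; apply: fpsP => j; apply: fpsP => i; apply: fg. Qed.

Lemma coefqz_qnM m f i j :
  coefqz (psq ^+ m * f) i j = if (i < m)%N then 0 else coefqz f (i - m)%N j.
Proof.
elim: m i => [|m IH] i; first by rewrite mul1r subn0.
rewrite exprS -mulrA /coefqz coefsCM coefsXM; case: i => [//|i].
exact: IH.
Qed.

Lemma coefqz_znM m f i j :
  coefqz (psz ^+ m * f) i j = if (j < m)%N then 0 else coefqz f i (j - m)%N.
Proof. by rewrite /coefqz coefsXnM; case: ifP. Qed.

Lemma coefqz1 i j : coefqz (1 : psqz F) i j = ((i == 0) && (j == 0))%:R.
Proof. by rewrite /coefqz coefs1; case: j => [|j]; case: i. Qed.

Lemma coefqz_qn_zn m n i j :
  coefqz (psq ^+ m * psz ^+ n : psqz F) i j = ((i == m) && (j == n))%:R.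
Proof.
rewrite coefqz_qnM -[psz ^+ n]mulr1 coefqz_znM coefqz1 !subn_eq0.
by case: (ltngtP i m) => //; case: (ltngtP j n).
Qed.

Lemma ps_limE (u : nat -> psqz F) f :
    (forall i j, exists N0, forall N, (N0 <= N)%N ->
       coefqz (u N) i j = coefqz f i j) ->
  ps_lim u = f.
Proof.
move=> uf; apply: psqzP => i j; rewrite {1}/coefqz /=.
have [N0 uN] := uf i j; apply: xget_unique; first by exists N0.
move=> c [N1 uN1]; rewrite -(uN (maxn N0 N1)) ?leq_maxl //.
by rewrite uN1 // leq_maxr.
Qed.

Definition eq_mod_q n f g := forall i j, (i < n)%N -> coefqz f i j = coefqz g i j.

Lemma eq_mod_qP f g : (forall n, eq_mod_q n f g) -> f = g.
Proof. by move=> fg; apply: psqzP => i j; apply: (fg i.+1). Qed.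

Lemma eq_mod_qM n f f' g g' : eq_mod_q n f f' -> eq_mod_q n g g' ->
  eq_mod_q n (f * g) (f' * g').
Proof.
move=> ff gg i j lt_in; rewrite /coefqz !coefsM !coefs_sum.
apply: eq_bigr => a _; rewrite !coefsM; apply: eq_bigr => c _.
congr (_ * _); first by apply: ff; apply: leq_trans lt_in; rewrite ltnS -ltnS.
by apply: gg; apply: leq_ltn_trans lt_in; apply: leq_subr.
Qed.

Lemma qpoch_stable u n N : (n <= N)%N -> eq_mod_q n (qpoch u N) (qpoch u n).
Proof.
elim: N => [|N IH]; first by rewrite leqn0 => /eqP->.
rewrite leq_eqVlt => /orP[/eqP-> //|]; rewrite ltnS => le_nN i j lt_in.
rewrite /qpoch big_ord_recr /= -/(qpoch u N) -(IH le_nN) //.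
rewrite -[in RHS](mulr1 (qpoch u N)); apply: (@eq_mod_qM n) => // i' j' lt.
have := coefqz_qnM N u i' j'; rewrite (leq_trans lt le_nN) /coefqz => E.
by rewrite !coefsB E subr0.
Qed.

Lemma qpoch_infE u n : eq_mod_q n (qpoch_inf u) (qpoch u n).
Proof.
pose f : psqz F := Fps (fun j => Fps (fun i => coefqz (qpoch u i.+1) i j)).
have fE : qpoch_inf u = f.
  apply: ps_limE => i j; exists i.+1 => N le_iN.
  by rewrite (qpoch_stable _ le_iN).
by move=> i j lt_in; rewrite fE {1}/coefqz /= -(qpoch_stable _ lt_in).
Qed.

Lemma coefqz_subst f i j :
  coefqz (subst_qz f) i j = if (i < j)%N then 0 else coefqz f (i - j)%N j.
Proof. exact: coefsXnM. Qed.

Lemma subst_qzM f g : subst_qz (f * g) = subst_qz f * subst_qz g.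
Proof.
apply: fpsP => j; rewrite coefsM.
transitivity (fpsX F ^+ j * (f * g) j) => //.
rewrite coefsM mulr_sumr; apply: eq_bigr => i _ /=.
by rewrite mulrACA -exprD subnKC // -ltnS.
Qed.

Lemma subst_qzD f g : subst_qz (f + g) = subst_qz f + subst_qz g.
Proof. by apply: fpsP => j; rewrite /= mulrDr. Qed.

Lemma subst_qz0 : subst_qz (0 : psqz F) = 0.
Proof. by apply: fpsP => j; rewrite /= mulr0. Qed.

Lemma subst_qzB f g : subst_qz (f - g) = subst_qz f - subst_qz g.
Proof. by apply: fpsP => j; rewrite /= mulrBr. Qed.

Lemma subst_qzC (c : fps F) : subst_qz (fpsC c : psqz F) = fpsC c.
Proof. by apply: fpsP => -[|j] /=; rewrite ?mul1r ?mulr0. Qed.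

Lemma subst_qz_z : subst_qz (psz : psqz F) = psq * psz.
Proof.
apply: fpsP => j; rewrite coefsCM /=.
by case: (eqVneq j 1%N) => [->|_]; rewrite ?mulr0 ?expr1.
Qed.

Lemma subst_qzX f n : subst_qz (f ^+ n) = subst_qz f ^+ n.
Proof. by elim: n => [|n IH]; rewrite ?subst_qzC // !exprS subst_qzM IH. Qed.

Lemma eq_mod_q_subst n f g : eq_mod_q n f g -> eq_mod_q n (subst_qz f) (subst_qz g).
Proof.
move=> fg i j lt_in; rewrite !coefqz_subst; case: ifP => // _.
by apply: fg; apply: leq_ltn_trans lt_in; apply: leq_subr.
Qed.

Lemma subst_qpoch_z n : qpoch (psz : psqz F) n.+1 = (1 - psz) * subst_qz (qpoch psz n).
Proof.
rewrite /qpoch big_ord_recl expr0 mul1r; congr (_ * _).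
elim: n => [|n IH]; first by rewrite !big_ord0 subst_qzC.
rewrite !big_ord_recr /= subst_qzM IH; congr (_ * _).
by rewrite subst_qzB subst_qzC subst_qzM subst_qzX subst_qzC subst_qz_z mulrA -exprSr.
Qed.

Lemma subst_qpoch_inf_z :
  qpoch_inf (psz : psqz F) = (1 - psz) * subst_qz (qpoch_inf psz).
Proof.
apply: eq_mod_qP => n i j lt_in.
rewrite (@qpoch_infE _ n.+1) // 1?ltnW // subst_qpoch_z.
apply: (@eq_mod_qM n) => //; apply: eq_mod_q_subst => i' j' lt.
by rewrite (@qpoch_infE _ n).
Qed.

Lemma qpoch_inf_z_unit : qpoch_inf (psz : psqz F) \is a GRing.unit.
Proof.
rewrite !fps_unitE; have := @qpoch_infE psz 1 0 0 (ltnSn 0).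
rewrite /coefqz => ->; rewrite /qpoch big_ord1 expr0 mul1r.
by rewrite !coefsB !coefs1 subr0 unitr1.
Qed.

End TwoVariablesFacts.

Lemma dedekind_aux (R : comNzRingType) (a b c x : R) :
  a * (b - c) * x = a * (x * b) - c * (a * x).
Proof.
rewrite mulrBr mulrBl; congr (_ - _); first by rewrite [x * b]mulrC mulrA.
by rewrite [a * c]mulrC mulrA.
Qed.

Section LinearIndependence.
Variables (F : fieldType) (l : nat).
Hypothesis l_gt0 : (0 < l)%N.

Definition nneg_mon (x : laurent) := (0 <= x.1) && (0 <= x.2).

Lemma mon_inj (x y : laurent) : nneg_mon x -> nneg_mon y ->
  mon F x = mon F y -> x = y.
Proof.
rewrite /mon /nneg_mon => nx ny; rewrite nx ny; move: nx ny.
case: x => -[a|//] -[b|//]; case: y => -[c|//] -[d|//] _ _ /= E.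
have := congr1 (fun f => coefqz f a b) E; rewrite !coefqz_qn_zn !eqxx /=.
case: eqP => [->|_]; last by move/eqP; rewrite oner_eq0.
by case: eqP => [->|_] //; move/eqP; rewrite oner_eq0.
Qed.

Lemma mon_neq0 (x : laurent) : nneg_mon x -> mon F x != 0.
Proof.
rewrite /mon /nneg_mon => nx; rewrite nx.
apply/eqP => /(congr1 (fun f => coefqz f `|x.1| `|x.2|)).
by rewrite coefqz_qn_zn !eqxx => /eqP; rewrite oner_eq0.
Qed.

Lemma admissible_size P : admissible l P -> size P = l.
Proof.
case=> j [m [n [c [lej _ ->]]]].
rewrite size_map size_cat /= !size_map size_drop size_tuple addnS.
rewrite size_take size_tuple; case: ltnP => [_|le].
  by rewrite subKn // subnKC // prednK.
have /eqP-> : j == 0%N.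
  by case: j lej le => // j; case: (l.-1) => // n' _; rewrite leqNgt ltn_subrL.
by rewrite subn0 subnn add0n prednK.
Qed.

Lemma admissible_nneg P i : admissible l P -> nneg_mon (P_ P i).
Proof.
case=> j [m [n [c [lej _ ->]]]].
set L := (X in [seq _ | x <- X]).
have nL x : x \in L -> nneg_mon ((m%:Z, n%:Z) + x).
  by rewrite mem_cat inE => /or3P[/mapP[a _ ->]|/eqP->|/mapP[a _ ->]].
rewrite /P_; case: (ltnP i.-1 (size L)) => lti.
  by rewrite (nth_map 0) //; apply/nL/mem_nth.
by rewrite nth_default // size_map.
Qed.

Definition chr (P : seq laurent) (d : nat -> nat) : psqz F :=
  \prod_(i < l) mon F (P_ P i.+1) ^+ d i.

Lemma chrD P d e : chr P (fun i => d i + e i)%N = chr P d * chr P e.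
Proof. by rewrite -big_split; apply: eq_bigr => i _; rewrite exprD. Qed.

Lemma chr_delta P (i : 'I_l) : chr P (fun j => (j == i :> nat) : nat) = mon F (P_ P i.+1).
Proof.
rewrite /chr (bigD1 i) //= eqxx expr1 big1 ?mulr1 // => j ne.
by rewrite (negbTE ne : (val j == val i) = false).
Qed.

Lemma chr_indep (ps : seq (seq laurent)) (f : seq laurent -> psqz F) :
    uniq ps -> (forall P, P \in ps -> admissible l P) ->
    (forall d : nat -> nat, (0 < \sum_(i < l) d i)%N -> \sum_(P <- ps) f P * chr P d = 0) ->
  forall P, P \in ps -> f P = 0.
Proof.
elim: ps f => [//|Q ps IH] f /= /andP[Qps ups] adm H.
have admQ : admissible l Q by apply: adm; rewrite inE eqxx.
have admps P : P \in ps -> admissible l P by move=> h; apply: adm; rewrite inE h orbT.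
have fps0 P : P \in ps -> f P = 0.
  move=> Pps; have admP := admps _ Pps.
  have [i neP] : exists i : 'I_l, P_ P i.+1 != P_ Q i.+1.
    apply: contrapT => no; case/negP: Qps; suff -> : Q = P by [].
    apply: (@eq_from_nth _ 0); first by rewrite !admissible_size.
    move=> i; rewrite admissible_size // => lti; apply/eqP.
    rewrite eq_sym; apply: contra_notT no => ne.
    by exists (Ordinal lti).
  pose e := fun j : nat => (j == i :> nat) : nat.
  have := IH (fun R => f R * (chr R e - chr Q e)) ups admps _ P Pps.
  have ne0 : chr P e - chr Q e != 0.
    rewrite subr_eq0 !chr_delta; apply: contra_neq neP.
    by apply: mon_inj; apply: admissible_nneg.
  move=> /(_ _)/eqP; rewrite mulf_eq0 (negbTE ne0) orbF => h.
  apply/eqP/h => d d0.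
  have := H _ d0; rewrite big_cons => H1.
  have : (0 < \sum_(i < l) (d i + e i))%N by rewrite big_split /= addn_gt0 d0.
  move=> /(H (fun i => d i + e i)%N); rewrite big_cons chrD => H2.
  transitivity (\sum_(R <- ps) f R * (chr R (fun i => d i + e i)%N)
      - chr Q e * \sum_(R <- ps) f R * chr R d).
    rewrite mulr_sumr -sumrB; apply: eq_bigr => R _; rewrite chrD.
    exact: dedekind_aux.
  have -> : \sum_(R <- ps) f R * chr R d = - (f Q * chr Q d).
    by apply/eqP; rewrite -addr_eq0 addrC H1.
  have -> : \sum_(R <- ps) f R * chr R (fun i => d i + e i)%N
      = - (f Q * (chr Q d * chr Q e)).
    by apply/eqP; rewrite -addr_eq0 addrC H2.
  by rewrite mulrN opprK mulrA [X in _ + X]mulrC addNr.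
move=> P; rewrite inE => /orP[/eqP->|/fps0//].
pose e := fun j : nat => (j == Ordinal l_gt0 :> nat) : nat.
have : (0 < \sum_(i < l) e i)%N by rewrite (bigD1 (Ordinal l_gt0)) //= /e eqxx.
move=> /(H e); rewrite big_cons big_seq_cond big1 ?addr0; last first.
  by move=> R /andP[/fps0-> _]; rewrite mul0r.
move/eqP; rewrite mulf_eq0 chr_delta (negbTE (mon_neq0 _)) ?orbF; first by move/eqP.
exact: admissible_nneg.
Qed.

Lemma expo_params (d : nat -> nat) : (0 < \sum_(i < l) d i)%N ->
  exists p : params l, forall i, (i < l)%N -> expo p i = d i.
Proof.
case: l l_gt0 => // n _ d0.
pose b : n.-tuple nat := [tuple \sum_(j < i.+1) d j | i < n].
pose s := 0%N :: rcons b (\sum_(i < n.+1) d i).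
have sE i : (i <= n.+1)%N -> nth 0%N s i = \sum_(j < i) d j.
  case: i => [|i] lei; first by rewrite big_ord0.
  rewrite -[nth _ _ _]/(nth 0%N (rcons b _) i) nth_rcons size_tuple.
  move: lei; rewrite ltnS leq_eqVlt.
  case/orP=> [/eqP->|lti]; first by rewrite ltnn eqxx.
  by rewrite lti -[i]/(val (Ordinal lti)) -tnth_nth tnth_mktuple.
have srt : sorted leq (rcons b (\sum_(i < n.+1) d i)).
  apply/(sortedP 0%N) => i; rewrite size_rcons size_tuple => lti.
  change (nth 0%N s i.+1 <= nth 0%N s i.+2)%N.
  by rewrite !sE ?(ltnW lti) // [X in (_ <= X)%N]big_ord_recr leq_addr.
exists (@Params n.+1 b _ d0 srt) => i lti.
rewrite -[expo _ _]/(nth 0%N s i.+1 - nth 0%N s i)%N !sE // 1?ltnW //.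
by rewrite big_ord_recr /= addKn.
Qed.

End LinearIndependence.

Section OperatorExists.
Variables (F : fieldType) (l : nat).
Hypothesis l_gt0 : (0 < l)%N.
Variables (w : seq laurent -> psqz F) (sigma : seq laurent -> seq laurent).
Hypothesis sigma_adm : forall P, admissible l P -> admissible l (sigma P).

Notation term_t := (psqz F * seq laurent)%type.

Definition vsum (s : seq term_t) : vfun F l :=
  fun p => \sum_(x <- s) term x.1 x.2 p.

Definition all_adm (s : seq term_t) := forall x, x \in s -> admissible l x.2.

Definition scale_terms (c : F) (s : seq term_t) : seq term_t :=
  [seq (psC c * x.1, x.2) | x <- s].

Lemma vsum_scale c s p : vsum (scale_terms c s) p = psC c * vsum s p.
Proof.
by rewrite /vsum big_map mulr_sumr; apply: eq_bigr => x _; rewrite /term mulrA.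
Qed.

Lemma scale_adm c s : all_adm s -> all_adm (scale_terms c s).
Proof. by move=> adm _ /mapP[x xs ->]; apply: (adm x). Qed.

Lemma vsum_flatten ss p : vsum (flatten ss) p = \sum_(s <- ss) vsum s p.
Proof. by rewrite /vsum big_flatten. Qed.

Lemma flatten_adm ss : (forall s, s \in ss -> all_adm s) -> all_adm (flatten ss).
Proof. by move=> H x /flattenP[s /H H1 /H1]. Qed.

Lemma in_VP (g : vfun F l) : in_V g <-> exists s, all_adm s /\ g = vsum s.
Proof.
split=> [[n [c [f [P [adm ->]]]]]|[s [adm ->]]].
  exists [seq (psC (c i) * f i, P i) | i <- enum 'I_n]; split.
    by move=> _ /mapP[i _ ->]; apply: adm.
  apply: funext => p; rewrite /vsum big_map big_enum /=.
  by apply: eq_bigr => i _; rewrite /term mulrA.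
exists (size s), (fun=> 1), (fun i => (tnth (in_tuple s) i).1),
  (fun i => (tnth (in_tuple s) i).2); split.
  by move=> i; apply: adm; apply: mem_tnth.
apply: funext => p; rewrite /vsum big_tnth; apply: eq_bigr => i _.
by rewrite (_ : psC 1 = 1) // mul1r.
Qed.

Lemma group_terms (s : seq term_t) (V : nmodType) (G : term_t -> V) :
  \sum_(x <- s) G x =
  \sum_(P <- undup [seq x.2 | x <- s]) \sum_(x <- s | x.2 == P) G x.
Proof.
rewrite (exchange_big_dep predT) //= big_seq [RHS]big_seq.
apply: eq_bigr => x xs; rewrite -big_filter.
have -> : [seq P <- undup [seq y.2 | y <- s] | x.2 == P] = [:: x.2];
  last by rewrite big_seq1.
rewrite -[RHS](@filter_pred1_uniq _ (undup [seq x.2 | x <- s])) ?undup_uniq //.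
  by apply: eq_filter => y; rewrite /= eq_sym.
by rewrite mem_undup map_f.
Qed.

Lemma vsum_eq0 s : all_adm s -> (forall p, vsum s p = 0) ->
  forall P, P \in undup [seq x.2 | x <- s] -> \sum_(x <- s | x.2 == P) x.1 = 0.
Proof.
move=> adm s0; apply: (@chr_indep F l l_gt0); first exact: undup_uniq.
  by move=> P; rewrite mem_undup => /mapP[x xs ->]; apply: (adm x).
move=> d /(expo_params l_gt0)[p pE].
transitivity (vsum s p) => //; rewrite /vsum group_terms.
apply: eq_bigr => P _; rewrite mulr_suml; apply: eq_bigr => x /eqP->.
by rewrite /term; congr (_ * _); apply: eq_bigr => i _; rewrite pE.
Qed.

Definition op_term (x : term_t) : term_t := (subst_qz x.1 * w x.2, sigma x.2).

Lemma op_term_eq0 s : all_adm s -> (forall p, vsum s p = 0) ->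
  forall p, vsum (map op_term s) p = 0.
Proof.
move=> adm s0 p; rewrite /vsum big_map group_terms big_seq big1 // => P Ps.
have E : \sum_(x <- s | x.2 == P) subst_qz x.1 = 0.
  transitivity (subst_qz (\sum_(x <- s | x.2 == P) x.1)).
    2: by rewrite (vsum_eq0 adm s0 Ps) subst_qz0.
  elim: (s) => [|x s' IH]; first by rewrite !big_nil subst_qz0.
  by rewrite !big_cons; case: ifP => // _; rewrite subst_qzD IH.
transitivity ((\sum_(x <- s | x.2 == P) subst_qz x.1) * (w P * bracket F (sigma P) p)).
  rewrite mulr_suml; apply: eq_bigr => x /eqP <-.
  by rewrite /term /op_term /= mulrA.
by rewrite E mul0r.
Qed.

Lemma op_term_adm s : all_adm s -> all_adm (map op_term s).
Proof. by move=> adm _ /mapP[x xs ->]; apply/sigma_adm/(adm x). Qed.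

Lemma op_scale c s p :
  vsum (map op_term (scale_terms c s)) p = psC c * vsum (map op_term s) p.
Proof.
rewrite /vsum !big_map mulr_sumr; apply: eq_bigr => x _.
by rewrite /term /= subst_qzM subst_qzC !mulrA.
Qed.

Lemma op_term_eq s s' : all_adm s -> all_adm s' -> vsum s = vsum s' ->
  vsum (map op_term s) = vsum (map op_term s').
Proof.
move=> adm adm' ss; apply: funext => p; apply/eqP; rewrite -subr_eq0; apply/eqP.
have N1 : psC (-1 : F) = -1.
  by apply: psqzP => i j; rewrite /coefqz coefsN coefs1; case: j; case: i => //= *; rewrite oppr0.
have vcat u v q : vsum (u ++ v) q = vsum u q + vsum v q by rewrite /vsum big_cat.
have -> : vsum (map op_term s) p - vsum (map op_term s') p =
    vsum (map op_term (s ++ scale_terms (-1) s')) p.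
  by rewrite map_cat vcat op_scale N1 mulN1r.
apply: op_term_eq0.
  by move=> x; rewrite mem_cat => /orP[/adm//|]; apply: scale_adm.
by move=> q; rewrite vcat vsum_scale N1 mulN1r ss subrr.
Qed.

Lemma operator_exists : exists A : vfun F l -> vfun F l, linear_on_V A /\
  forall f P, admissible l P -> A (term f P) = term (subst_qz f * w P) (sigma P).
Proof.
pose A (g : vfun F l) : vfun F l :=
  if pselect (exists s, all_adm s /\ g = vsum s) is left e
  then vsum (map op_term (projT1 (cid e))) else g.
have AE s : all_adm s -> A (vsum s) = vsum (map op_term s).
  move=> adm; rewrite /A; case: pselect => [e|[]]; last by exists s.
  by case: (cid e) => s' [adm' E] /=; apply: op_term_eq.
exists A; split; first split.
- move=> _ /in_VP[s [adm ->]]; rewrite AE //; apply/in_VP.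
  by exists (map op_term s); split=> //; apply: op_term_adm.
- move=> n c g gV.
  have /choice[S HS] : forall i, exists s, all_adm s /\ g i = vsum s.
    by move=> i; apply/in_VP.
  have adm i : all_adm (S i) by have [] := HS i.
  pose ss := [seq scale_terms (c i) (S i) | i <- enum 'I_n].
  have ssE : vlin c g = vsum (flatten ss).
    apply: funext => p; rewrite vsum_flatten big_map big_enum /=.
    by apply: eq_bigr => i _; rewrite vsum_scale; have [_ <-] := HS i.
  rewrite ssE AE; last first.
    by apply: flatten_adm => _ /mapP[i _ ->]; apply: scale_adm.
  apply: funext => p; rewrite map_flatten vsum_flatten 2!big_map big_enum /=.
  by apply: eq_bigr => i _; rewrite op_scale; have [_ ->] := HS i; rewrite AE.
- move=> f P adm.
  have tE : term f P = vsum [:: (f, P)].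
    by apply: funext => p; rewrite /vsum big_seq1.
  rewrite tE AE; last by move=> x; rewrite inE => /eqP->.
  by apply: funext => p; rewrite /vsum big_seq1.
Qed.

End OperatorExists.

Section OperatorsAB.
Variables (F : fieldType) (l : nat).
Hypothesis l_gt0 : (0 < l)%N.

Definition adm_shape (m n : nat) (c1 c2 : seq nat) : seq laurent :=
  [seq (m%:Z + a%:Z, n%:Z + 1) | a : nat <- c2] ++
  (m%:Z, n%:Z) :: [seq (m%:Z + a%:Z, n%:Z) | a : nat <- c1].

Lemma admissibleP P : admissible l P <-> exists m n c1 c2,
  [/\ (size c1 + size c2)%N = l.-1, sorted leq (c1 ++ c2) & P = adm_shape m n c1 c2].
Proof.
have shape m n c1 c2 : [seq (m%:Z, n%:Z) + x | x : laurent <-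
    [seq (a%:Z, 1) | a <- c2] ++ 0 :: [seq (a%:Z, 0) | a : nat <- c1]] =
    adm_shape m n c1 c2.
  rewrite map_cat /= -!map_comp /adm_shape; congr (_ ++ _ :: _).
    by rewrite addr0.
  by apply: eq_map => a /=; congr (_, _); rewrite addr0.
split=> [[j [m [n [c [lej srt ->]]]]]|[m [n [c1 [c2 [sz srt ->]]]]]].
  exists m, n, (take (l.-1 - j) c), (drop (l.-1 - j) c); split => //.
  - by rewrite -size_cat cat_take_drop size_tuple.
  - by rewrite cat_take_drop.
have szc : size (c1 ++ c2) == l.-1 by rewrite size_cat sz.
exists (size c2), m, n, (Tuple szc); split => //; first by rewrite -sz leq_addl.
have -> : (l.-1 - size c2)%N = size c1 by rewrite -sz addnK.
by rewrite /= drop_size_cat // take_size_cat.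
Qed.

Lemma take_shape (P Q : seq laurent) x :
  P = rcons Q x -> size P = l -> take l.-1 P = Q /\ P_ P l = x.
Proof.
move=> -> sz; move: sz; rewrite size_rcons => sz.
have E : l.-1 = size Q by rewrite -sz.
by rewrite /P_ E -cats1 take_size_cat // nth_cat ltnn subnn.
Qed.

Lemma shape_rcons m n c1 x c2 : adm_shape m n (rcons c1 x) c2 =
  rcons (adm_shape m n c1 c2) (m%:Z + x%:Z, n%:Z).
Proof. by rewrite /adm_shape map_rcons -rcons_cons rcons_cat. Qed.

Lemma shape_nil m n c2 : adm_shape m n [::] c2 =
  rcons [seq (m%:Z + a%:Z, n%:Z + 1) | a : nat <- c2] (m%:Z, n%:Z).
Proof. by rewrite /adm_shape cats1. Qed.

Lemma subst_shape m n c1 c2 : [seq subst_mon x | x <- adm_shape m n c1 c2] =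
  adm_shape (m + n) n c1 (map S c2).
Proof.
rewrite /adm_shape map_cat /= -!map_comp; congr (_ ++ _ :: _).
- apply: eq_map => a; rewrite /subst_mon /= PoszD intS; congr (_, _).
  by rewrite addrACA [1 + _]addrC addrA.
- by apply: eq_map => a; rewrite /subst_mon /= PoszD addrAC.
Qed.

Lemma sorted_adm c1 c2 c2' : sorted leq (c1 ++ c2) -> sorted leq c2' ->
  (forall y, y \in c2' -> exists2 x, x \in c2 & (x <= y)%N) ->
  sorted leq (c1 ++ c2').
Proof.
rewrite !(sorted_pairwise leq_trans) !pairwise_cat.
case/and3P => /allrelP c12 -> _ -> H; rewrite !andbT.
apply/allrelP => x y xc1 /H[z zc2]; apply: leq_trans; exact: c12.
Qed.

Lemma sorted_rcons_cat c1 (x : nat) c2 : sorted leq (rcons c1 x ++ c2) ->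
  sorted leq (c1 ++ c2).
Proof.
apply: subseq_sorted; first exact: leq_trans.
by rewrite cat_rcons; apply: cat_subseq => //; apply: subseq_cons.
Qed.

Lemma sorted_S c : sorted leq c -> sorted leq (map S c).
Proof. by rewrite sorted_map. Qed.

Lemma opA_admissible P : admissible l P ->
  admissible l [seq subst_mon x | x <- P_ P 1 :: take l.-1 P].
Proof.
move=> adm; have szP := admissible_size l_gt0 adm.
move/admissibleP: adm => [m [n [c1 [c2 [sz srt E]]]]]; apply/admissibleP.
case: c2 => [|y c2] in sz srt E.
  rewrite addn0 cats0 in sz srt.
  have hd : P_ P 1 = (m%:Z, n%:Z) by rewrite E.
  rewrite hd; case: (lastP c1) E sz srt => [|c1' x] E sz srt.
    rewrite -sz take0; exists (m + n)%N, n, [::], [::]; split => //.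
  rewrite shape_rcons in E; have [-> _] := take_shape E szP.
  exists (m + n)%N, n, (0%N :: c1'), [::]; split.
  - by rewrite addn0 -sz size_rcons.
  - rewrite cats0 /=; have := subseq_sorted leq_trans (subseq_rcons c1' x) srt.
    by case: (c1') => //= a s ->.
  - by rewrite map_cons subst_shape /adm_shape /= addr0 /subst_mon /= PoszD.
have hd : P_ P 1 = (m%:Z + y%:Z, n%:Z + 1) by rewrite E.
rewrite hd; case: (lastP c1) E sz srt => [|c1' x] E sz srt.
  rewrite shape_nil in E; have [-> _] := take_shape E szP.
  exists (m + n + y.+1)%N, n.+1, (0%N :: [seq a - y | a <- c2])%N, [::]; split.
  - by rewrite /= size_map addn0 -sz add0n.
  - rewrite cats0; move: srt => /= srt.
    have srt' : sorted leq [seq (a - y)%N | a <- y :: c2].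
      by apply: (@homo_sorted _ _ (fun a => a - y)%N leq leq _ (y :: c2) srt) => a b; apply: leq_sub2r.
    by move: srt' => /=; rewrite subnn.
  - have le : forall a, a \in c2 -> (y <= a)%N.
      by move: srt => /=; rewrite (path_sortedE leq_trans) => /andP[/allP].
    have xE a : (y <= a)%N -> subst_mon (m%:Z + a%:Z, n%:Z + 1) =
        ((m + n + y.+1)%N%:Z + (a - y)%N%:Z, n.+1%:Z).
      move=> ya; rewrite /subst_mon /= -!PoszD addn1; congr (Posz _, _).
      by lia.
    rewrite /adm_shape /= xE // subnn addr0; congr [:: _, _ & _].
    rewrite -!map_comp; apply/eq_in_map => a /le ya.
    by rewrite /= xE.
have szc : (size c1' + (size c2).+2)%N = l.-1.
  by rewrite -sz size_rcons /= !addnS addSn.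
rewrite shape_rcons in E; have [-> _] := take_shape E szP.
exists (m + n)%N, n, c1', (y.+1 :: y.+1 :: map S c2); split.
- by rewrite /= size_map.
- apply: (@sorted_adm _ (y :: c2)); first exact: sorted_rcons_cat srt.
    have : sorted leq (y :: c2).
      by apply: subseq_sorted srt; [exact: leq_trans | exact: suffix_subseq].
    by move/sorted_S => /= ->; rewrite leqnn.
  move=> z; rewrite !inE => /or3P[/eqP->|/eqP->|/mapP[a ac2 ->]].
  + by exists y; rewrite ?inE ?eqxx.
  + by exists y; rewrite ?inE ?eqxx.
  + by exists a; rewrite ?inE ?ac2 ?orbT.
- rewrite map_cons subst_shape /adm_shape /=; congr (_ :: _).
  rewrite /subst_mon /= PoszD intS; congr (_, _).
  by rewrite addrACA [1 + _]addrC addrA.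
Qed.

Lemma opB_admissible P : admissible l P ->
  admissible l [seq subst_mon x |
    x <- (qn_mon (-1) + zn_mon 1 + P_ P l) :: take l.-1 P].
Proof.
move=> adm; have szP := admissible_size l_gt0 adm.
move/admissibleP: adm => [m [n [c1 [c2 [sz srt E]]]]]; apply/admissibleP.
case: (lastP c1) E sz srt => [|c1' x] E sz srt.
  rewrite shape_nil in E; have [-> ->] := take_shape E szP.
  exists (m + n)%N, n.+1, (map S c2), [::]; split.
  - by rewrite size_map addn0 -sz.
  - by rewrite cats0; apply: sorted_S.
  - rewrite /adm_shape /= -!map_comp; congr (_ :: _).
      by rewrite /subst_mon /qn_mon /zn_mon /=; congr (_, _); lia.
    by apply: eq_map => a; rewrite /subst_mon /=; congr (_, _); lia.
rewrite shape_rcons in E; have [-> ->] := take_shape E szP.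
exists (m + n)%N, n, c1', (x :: map S c2); split.
- by rewrite -sz size_rcons /= size_map addnS addSn.
- have srt' : sorted leq (x :: map S c2).
    have : sorted leq (x :: c2).
      by apply: subseq_sorted srt; [exact: leq_trans |
        rewrite cat_rcons; exact: suffix_subseq].
    case: (c2) => [//|y c2''] /= /andP[xy srt'].
    by have /= -> := @sorted_S (y :: c2'') srt'; rewrite leqW.
  apply: (@sorted_adm _ (x :: c2)) srt' _; first by rewrite -cat_rcons.
  move=> z; rewrite !inE => /orP[/eqP->|/mapP[a ac2 ->]].
  + by exists x; rewrite ?inE ?eqxx.
  + by exists a; rewrite ?inE ?ac2 ?orbT.
- rewrite map_cons subst_shape /adm_shape /=; congr (_ :: _).
  by rewrite /subst_mon /qn_mon /zn_mon /=; congr (_, _); lia.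
Qed.

Lemma opA_exists : exists A : vfun F l -> vfun F l, is_opA A.
Proof.
exact: (operator_exists l_gt0
  (fun P => inv_one_minus F (subst_mon (qn_mon (-1) + zn_mon 1 + P_ P l - P_ P 1)))
  opA_admissible).
Qed.

Lemma opB_exists : exists B : vfun F l -> vfun F l, is_opB B.
Proof.
exact: (operator_exists l_gt0
  (fun P => inv_one_minus F (subst_mon (qn_mon 1 + zn_mon (-1) + P_ P 1 - P_ P l)))
  opB_admissible).
Qed.

Lemma admissible0 : admissible l (nseq l 0).
Proof.
apply/admissibleP; exists 0%N, 0%N, (nseq l.-1 0%N), [::]; split.
- by rewrite size_nseq addn0.
- rewrite cats0; apply/(sortedP 0%N) => i _; rewrite !nth_nseq.
  by do 2![case: ifP].
- by rewrite /adm_shape /= map_nseq -{1}(prednK l_gt0).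
Qed.

Lemma opA_v_inf (A : vfun F l -> vfun F l) : is_opA A -> A (@v_inf F l) = @v_inf F l.
Proof.
case=> _ AE; rewrite /v_inf AE; last exact: admissible0.
have P0 i : P_ (nseq l (0 : laurent)) i = 0 by rewrite /P_ nth_nseq if_same.
have -> : [seq subst_mon x | x <- P_ (nseq l (0 : laurent)) 1 :: take l.-1 (nseq l 0)]
    = nseq l 0.
  rewrite P0 take_nseq ?leq_pred //= map_nseq.
  by rewrite -[in RHS](prednK l_gt0).
congr term; rewrite !P0 subr0 addr0.
have -> : inv_one_minus F (subst_mon (qn_mon (-1) + zn_mon 1)) = (1 - psz)^-1.
  by rewrite /inv_one_minus /mon /= mul1r expr1.
have U := qpoch_inf_z_unit F; have E := subst_qpoch_inf_z F.
have [U1 U2] : 1 - psz \is a @GRing.unit (psqz F) /\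
    subst_qz (qpoch_inf psz) \is a @GRing.unit (psqz F).
  by apply/andP; rewrite -unitrM -E.
have -> : subst_qz (qpoch_inf psz)^-1 = (subst_qz (qpoch_inf (psz : psqz F)))^-1.
  apply: (mulrI U2); rewrite -subst_qzM mulrV // mulrV //.
  exact: subst_qzC.
by rewrite [in RHS]E invrM.
Qed.

Lemma good_eqv (M M' : word) : word_eqv M M' -> good l M -> good l M'.
Proof.
case=> r [r' E] gM.
have nthE (N : word) s i : nth LB (N ++ nseq s LA) i =
    if (i < size N)%N then nth LB N i else if (i < size N + s)%N then LA else LB.
  by rewrite nth_cat nth_nseq; case: ltnP => // le; rewrite -(ltn_add2l (size N)) subnKC.
have gM2 : good l (M ++ nseq r LA).
  move=> i; rewrite size_cat size_nseq => lti; rewrite !nthE lti.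
  case: (ltnP (i + l.-1) (size M)) => // lt.
  by rewrite (leq_ltn_trans (leq_addr _ _) lt); apply: gM.
move=> i lti hA; have := gM2 i; rewrite E size_cat nthE.
rewrite (leq_ltn_trans (leq_addr _ _) lti) nthE lti; apply=> //.
exact: leq_trans lti (leq_addr _ _).
Qed.

Lemma act_eqv (A B : vfun F l -> vfun F l) (M M' : word) :
  is_opA A -> word_eqv M M' -> act A B M (@v_inf F l) = act A B M' (@v_inf F l).
Proof.
move=> hA [r [r' E]].
have H (N : word) s : act A B (N ++ nseq s LA) (@v_inf F l) = act A B N (@v_inf F l).
  rewrite /act foldr_cat; congr (foldr _ _ N).
  by elim: s => //= s ->; apply: opA_v_inf.
by rewrite -(H M r) E H.
Qed.

End OperatorsAB.

(* Main.v *)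
Require Import Defs.
From mathcomp Require Import all_boot all_order all_algebra generic_quotient.
From mathcomp Require Import all_classical reals.
From mathcomp Require Import complex.
From mathcomp Require Import zify ring.

Set Implicit Arguments.
Unset Strict Implicit.
Unset Printing Implicit Defensive.

Import Order.TTheory GRing.Theory Num.Theory.

Local Open Scope classical_set_scope.
Local Open Scope ring_scope.

(** Put [l = n + 1].  Removing the entry [x_0 = i] from a configuration leaves a
configuration for the bounds [b_1 - i, ..., b_(l-2) - i, k - i], so the
character solves [H(p) = Phi H (p)], where [Phi H (p)] is the sum over
[i <= b_0] of [z^i S (H (p_i))] ([chi_rec]).  On a term [f[P_1, ..., P_l]] the
sum over [i] is geometric, and its two boundary terms are exactly [A] and [B]:
[Phi = A + B] on such terms ([Phi_term]).  The recursion expresses the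
coefficient of [q^i z^j], for [j > 0], through coefficients of total degree
[i < i + j]; hence the part without [z] determines the solution
([Phi_unique]).  It remains to see that the sum [G] of [M v_oo] over good [M]
solves the recursion too.

If [M] is good, so is [B M], while [A M] is good if and only if the [n]-th
letter of [M], continued by letters A, is A.  So [(A + B) G - G] is the sum of
[A M v_oo] over the good [M] for which [A M] is not good, and this sum has to
vanish.  It does because its terms cancel in pairs ([bad_sum0], [act_swap]).

To find the pairs, describe [M v_oo = f[P_1, ..., P_l]] by its gaps
[g_i = P_(i+1) / P_i] for [i < l] and [g_l = P_1 / (z P_l)].  All but one of
them are powers [q^t] with [t >= 0]; the last one, the infinite gap, is
[q^(-c) z^(-1)], where [c] is the sum of the exponents [t].  Up to a signed
monomial, [f] is the inverse of the product of the [(q)_t] and of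
[(q^c z)_oo].  In terms of the entries [h_i = q^i g_i], the operator [B] moves
the last entry to the front, divided by [q^n], and then applies [S] and a
shift of positions ([turn]); the operator [A], where it is good, does the same
after exchanging the last two entries.  Hence the exponents of the finite
entries stay distinct modulo [n].  Conversely every list with this property comes from a unique good
word ([gaps_inj], [regular_reached]): its first gap reveals the last step, and
undoing steps always ends at the list of [v_oo].

The property is invariant under exchanging the last two entries, so a word [M]
with [A M] not good has a partner [M'] whose list is that of [M] with these
entries exchanged.  Both [A M v_oo] and [A M' v_oo] have the same denominator,
which is symmetric in the two entries.  They have the same [P_i], since [P_1]
is given by a symmetric quadratic function of the entries ([good_point]), and
then also the same numerator, which is the product of the [P_i] divided by
[q^(c(c-1)/2) z^c] ([good_numer]).  Finally the sign of [M] is the parity of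
the number of inversions of the finite entries modulo [n], plus the exponent
of [z] in [P_1] ([good_flips]); comparing the two gives opposite signs
([partner_numer]). *)

(** * Exponents, gaps and regular lists *)

Lemma laurent_ext (x y : laurent) : x.1 = y.1 -> x.2 = y.2 -> x = y.
Proof. by case: x y => [a b] [c d] /= -> ->. Qed.

Lemma addL1 (x y : laurent) : (x + y).1 = x.1 + y.1. Proof. by []. Qed.
Lemma addL2 (x y : laurent) : (x + y).2 = x.2 + y.2. Proof. by []. Qed.
Lemma oppL1 (x : laurent) : (- x).1 = - x.1. Proof. by []. Qed.
Lemma oppL2 (x : laurent) : (- x).2 = - x.2. Proof. by []. Qed.
Lemma qnL1 m : (qn_mon m).1 = m. Proof. by []. Qed.
Lemma qnL2 m : (qn_mon m).2 = 0. Proof. by []. Qed.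
Lemma znL1 m : (zn_mon m).1 = 0. Proof. by []. Qed.
Lemma znL2 m : (zn_mon m).2 = m. Proof. by []. Qed.
Lemma zeroL1 : (0 : laurent).1 = 0. Proof. by []. Qed.
Lemma zeroL2 : (0 : laurent).2 = 0. Proof. by []. Qed.
Lemma substL1 x : (subst_mon x).1 = x.1 + x.2. Proof. by []. Qed.
Lemma substL2 x : (subst_mon x).2 = x.2. Proof. by []. Qed.

(** The effect of [S] on an entry [h_i = q^i g_i] whose position [i] increases
by one: finite entries are multiplied by [q], the infinite one is fixed. *)
Definition incr (a : laurent) : laurent := subst_mon a + qn_mon 1.
Definition decr (a : laurent) : laurent := (a.1 - 1 - a.2, a.2).

Lemma incrL1 a : (incr a).1 = a.1 + a.2 + 1. Proof. by []. Qed.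
Lemma incrL2 a : (incr a).2 = a.2. Proof. by rewrite /incr addL2 /= addr0. Qed.

Definition laurentE := (addL1, addL2, oppL1, oppL2, qnL1, qnL2, znL1, znL2, incrL1,
  incrL2, substL1, substL2, zeroL1, zeroL2).

Ltac laurent_lia := apply: laurent_ext; rewrite ?laurentE /=; lia.

Lemma subst_monD x y : subst_mon (x + y) = subst_mon x + subst_mon y.
Proof. by laurent_lia. Qed.
Lemma subst_mon0 : subst_mon 0 = 0. Proof. by []. Qed.
Lemma subst_mon_sum (s : seq laurent) :
  \sum_(y <- s) subst_mon y = subst_mon (\sum_(y <- s) y).
Proof. by elim: s => [|y s IH]; rewrite ?big_nil ?big_cons // IH subst_monD. Qed.
Lemma incrK : cancel incr decr. Proof. by move=> a; laurent_lia. Qed.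
Lemma decrK : cancel decr incr. Proof. by move=> a; laurent_lia. Qed.

(** Lists are stored from the last position to the first, so that the position
of an entry is one more than the length of what follows it. *)
Definition gap (b : laurent) (w : seq laurent) : laurent :=
  b - qn_mon (size w).+1.

Fixpoint gap_total (r : seq laurent) : laurent :=
  if r is b :: w then gap_total w + gap b w else 0.

(** The points [P_i], last one first, for [P_1 = x] and the entries [r]. *)
Fixpoint points_from (x : laurent) (r : seq laurent) : seq laurent :=
  if r is b :: w then (x + gap_total w) :: points_from x w else [::].

(** The infinite gap is the only one in which [z] occurs. *)
Definition is_fin (a : laurent) : bool := a.2 == 0.

Definition entry_ok (k : nat) (a : laurent) : bool :=
  (a.2 == -1) || (is_fin a && (k%:Z <= a.1)).

Fixpoint entries_ok (r : seq laurent) : bool :=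
  if r is b :: w then entry_ok (size w).+1 b && entries_ok w else true.

Definition fin_entries (r : seq laurent) : seq int := [seq a.1 | a <- r & is_fin a].

Fixpoint fin_gap_total (r : seq laurent) : int :=
  if r is b :: w then fin_gap_total w + (if is_fin b then b.1 - (size w).+1%:Z else 0)
  else 0.

Section Rotation.
Variable n : nat.
Notation nZ := (n%:Z).

(** The step from [M] to [B M]; the head of the list is the last position. *)
Definition turn (r : seq laurent) : seq laurent :=
  if r is b :: w then rcons (map incr w) (incr (b - qn_mon nZ)) else [::].

Definition swap_last (r : seq laurent) : seq laurent :=
  if r is b :: a :: w then a :: b :: w else r.

Definition residues (r : seq laurent) : seq int := [seq (v %% nZ)%Z | v <- fin_entries r].

(** The lists of entries that come from good words; the second and the third
condition leave room for exactly one infinite gap, as the total is [z^(-1)]. *)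
Definition regular (r : seq laurent) : bool :=
  [&& size r == n.+1, entries_ok r, gap_total r == zn_mon (-1) & uniq (residues r)].

Lemma size_turn r : size (turn r) = size r.
Proof. by case: r => //= b w; rewrite size_rcons size_map. Qed.

Lemma is_fin_incr a : is_fin (incr a) = is_fin a.
Proof. by rewrite /is_fin incrL2. Qed.
Lemma is_fin_subst a : is_fin (subst_mon a) = is_fin a. Proof. by []. Qed.
Lemma is_fin_sub a m : is_fin (a - qn_mon m) = is_fin a.
Proof. by rewrite /is_fin ?laurentE; congr (_ == _); lia. Qed.

Lemma gap_total_turn w c :
  gap_total (rcons (map incr w) (incr c)) = subst_mon (gap_total w + c).
Proof.
elim: w => [|b w IH]; first by laurent_lia.
rewrite /= IH /gap size_rcons size_map; laurent_lia.
Qed.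

Lemma points_from_turn x y w c : y + subst_mon c = subst_mon x ->
  points_from y (rcons (map incr w) (incr c)) = rcons [seq subst_mon z | z <- points_from x w] y.
Proof.
move=> E; elim: w => [|b w IH]; first by rewrite /= addr0.
rewrite /= IH gap_total_turn !subst_monD -E; congr (_ :: _); laurent_lia.
Qed.

Lemma size_points_from x r : size (points_from x r) = size r.
Proof. by elim: r => //= b w ->. Qed.

Lemma last_points_from x y r : r != [::] -> last y (points_from x r) = x.
Proof.
elim: r y => [//|b [|a w] IH] y _ /=; first by rewrite addr0.
by move: (IH (x + (gap_total (a :: w))) isT) => /= ->.
Qed.

Lemma entry_ok_incr k a : entry_ok k a -> entry_ok k.+1 (incr a).
Proof. rewrite /entry_ok /is_fin ?laurentE; lia. Qed.

Lemma entries_ok_turn w c : entries_ok w -> entry_ok 1 (incr c) ->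
  entries_ok (rcons (map incr w) (incr c)).
Proof.
move=> + okc; elim: w => [_ /=|b w IH /= /andP[okb_b /IH ->]]; first by rewrite okc.
by rewrite size_rcons size_map entry_ok_incr.
Qed.

Lemma fin_gap_total_turn w c : fin_gap_total (rcons (map incr w) (incr c)) =
  fin_gap_total w + (if is_fin c then c.1 else 0).
Proof.
elim: w => [|b w IH] /=.
  by rewrite is_fin_incr; case: ifP; rewrite /is_fin ?laurentE => /eqP; lia.
by rewrite IH size_rcons size_map is_fin_incr; case: (ifP (is_fin b)); case: (is_fin c);
  rewrite /is_fin ?laurentE => /eqP; lia.
Qed.

(** Only infinite gaps contain [z], with exponent [-1]; so a total without [z]
is a sum of finite gaps. *)
Lemma entries_ok_total w : entries_ok w ->
  (gap_total w).2 <= 0 /\ ((gap_total w).2 = 0 -> 0 <= (gap_total w).1).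
Proof.
elim: w => [//|b w IH] /= /andP[okb_b /IH[]]; move: okb_b.
rewrite /entry_ok /is_fin /gap ?laurentE; lia.
Qed.

Lemma entries_ok_fin_total w : entries_ok w -> (gap_total w).2 = 0 ->
  (gap_total w).1 = fin_gap_total w.
Proof.
elim: w => [//|b w IH] /= /andP[okb_b okw]; have [le0 _] := entries_ok_total okw.
move: okb_b IH le0 => /=; rewrite /entry_ok /is_fin /gap ?laurentE => okb_b IH le0 E.
have /IH : (gap_total w).2 = 0 by lia.
by move=> /(_ okw) ->; case: ifP => [|] ; lia.
Qed.

Lemma fin_entries_cons b w : fin_entries (b :: w) =
  if is_fin b then b.1 :: fin_entries w else fin_entries w.
Proof. by rewrite /fin_entries /=; case: ifP. Qed.

Lemma size_fin_entries w : entries_ok w ->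
  (size (fin_entries w))%:Z = (size w)%:Z + (gap_total w).2.
Proof.
elim: w => [//|b w IH] /= /andP[okb_b /IH E]; rewrite fin_entries_cons.
move: okb_b; rewrite /entry_ok; case: ifP => fb /=; move: fb; rewrite /is_fin /gap ?laurentE; lia.
Qed.

Lemma fin_entries_incr w : fin_entries (map incr w) = [seq v + 1 | v <- fin_entries w].
Proof.
elim: w => [//|b w IH]; rewrite map_cons !fin_entries_cons is_fin_incr IH.
by case: ifP => //; rewrite /is_fin /= => /eqP->; rewrite addr0.
Qed.

Lemma fin_entries_rcons w c : fin_entries (rcons w c) =
  if is_fin c then rcons (fin_entries w) c.1 else fin_entries w.
Proof. by rewrite /fin_entries filter_rcons; case: ifP; rewrite ?map_rcons. Qed.

Lemma uniq_mod_shift (s : seq int) c :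
  uniq [seq (v %% nZ)%Z | v <- [seq v + c | v <- s]] = uniq [seq (v %% nZ)%Z | v <- s].
Proof.
have E t d : uniq [seq (v %% nZ)%Z | v <- t] -> uniq [seq (v %% nZ)%Z | v <- [seq v + d | v <- t]].
  have -> : [seq (v %% nZ)%Z | v <- [seq v + d | v <- t]] =
     [seq ((u + d) %% nZ)%Z | u <- [seq (v %% nZ)%Z | v <- t]].
    by rewrite -!map_comp; apply: eq_map => v /=; rewrite modzDml.
  set t' := map _ t => ut; rewrite map_inj_in_uniq // => x y.
  move=> /mapP[u _ ->] /mapP[v _ ->] H.
  have := congr1 (fun z => (z - d) %% nZ)%Z H.
  by rewrite !modzDml !addrK.
apply/idP/idP => [/(E _ (- c))|/E//].
rewrite -[X in [seq _ | v <- X]]map_comp.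
rewrite [X in [seq _ | v <- X]](eq_map (_ : _ =1 id)) ?map_id // => v /=.
by rewrite addrK.
Qed.

Lemma residues_turn r : uniq (residues (turn r)) = uniq (residues r).
Proof.
case: r => [//|b w]; rewrite /residues /= fin_entries_rcons fin_entries_cons.
rewrite is_fin_incr is_fin_sub fin_entries_incr.
case: ifP => fb; last by rewrite uniq_mod_shift.
have -> : (incr (b - qn_mon nZ)).1 = (b.1 - nZ) + 1.
  by move: fb; rewrite /is_fin ?laurentE => /eqP ->; lia.
rewrite -map_rcons uniq_mod_shift map_rcons rcons_uniq /=.
by rewrite -(modzDr _ nZ) subrK.
Qed.

Lemma regular_turn b w : regular (b :: w) -> regular (turn (b :: w)).
Proof.
case/and4P => sz okr tr ur; apply/and4P; split.
- by rewrite size_turn.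
- case/andP: okr => okbb okw; apply: entries_ok_turn => //.
  by case/eqP: sz okbb => ->; rewrite /entry_ok /is_fin ?laurentE; lia.
- move/eqP: tr => /= tr; rewrite gap_total_turn; apply/eqP.
  move: sz tr => /= /eqP[sz]; rewrite /gap sz => tr.
  have -> : gap_total w + (b - qn_mon nZ) = zn_mon (-1) + qn_mon 1 by rewrite -tr; laurent_lia.
  by laurent_lia.
- by rewrite residues_turn.
Qed.

Lemma gap_total_swap r : gap_total (swap_last r) = gap_total r.
Proof. case: r => [|b [|a w]] //=; rewrite /gap /=; laurent_lia. Qed.

Lemma fin_entries_swap r : perm_eq (fin_entries (swap_last r)) (fin_entries r).
Proof.
case: r => [|b [|a w]] //; apply/perm_map/perm_filter/permP => P /=.
by rewrite addnCA.
Qed.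

Lemma size_swap_last r : size (swap_last r) = size r.
Proof. by case: r => [|b [|a w]]. Qed.

(** Exchanging the last two entries keeps the residues and the total. The entry
[a] moves from position [n] to [n + 1], where its gap stays nonnegative unless
[a] is [q^n], which means that its gap was trivial. *)
Lemma regular_swap b a w : regular (b :: a :: w) -> a != qn_mon nZ ->
  regular (a :: b :: w).
Proof.
case/and4P => sz okr tr ur na; apply/and4P; split => //.
- move: okr => /= /and3P[okbb okba ->]; rewrite andbT.
  case/eqP: sz => sz; rewrite sz; move: okbb okba; rewrite /entry_ok /= sz => okbb okba.
  have : a.1 != nZ \/ a.2 != 0.
    case: (eqVneq a.1 nZ) => [a1|]; [right|by left].
    by apply: contra na => /eqP a2; apply/eqP/laurent_ext.
  move: okbb okba; rewrite /is_fin; lia.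
- by rewrite -(eqP tr) -(gap_total_swap (b :: a :: w)).
- by rewrite /residues (perm_uniq (perm_map _ (fin_entries_swap (b :: a :: w)))).
Qed.

Lemma regular_turnA b w : regular (b :: qn_mon nZ :: w) ->
  regular (turn (qn_mon nZ :: b :: w)).
Proof.
case/and4P => sz okr tr ur; case/eqP: (sz) => sz'; apply/and4P; split.
- by rewrite size_turn.
- move: okr => /= /and3P[okbb okba okw]; rewrite subrr; apply: (@entries_ok_turn (b :: w)) => //=.
  by rewrite okw andbT; move: okbb; rewrite /= sz' /entry_ok /is_fin ?laurentE; lia.
- rewrite /turn (@gap_total_turn (b :: w)) subrr addr0; apply/eqP.
  have := gap_total_swap (b :: qn_mon nZ :: w); rewrite (eqP tr) /= /gap /= => E.
  move: sz' E => /= [->] E; rewrite -[X in subst_mon X](addrK (qn_mon nZ - qn_mon n.+1)).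
  by rewrite {}E; laurent_lia.
- by rewrite residues_turn /residues (perm_uniq (perm_map _ (fin_entries_swap (b :: _ :: w)))).
Qed.

End Rotation.

(** * Good words and regular gap lists *)

Section Words.
Variable n : nat.
Hypothesis n_gt0 : (0 < n)%N.
Notation nZ := (n%:Z).

Fixpoint base_entries (m : nat) : seq laurent :=
  if m is m'.+1 then (qn_mon m%:Z) :: base_entries m' else [::].

Definition start : seq laurent := (n.+1%:Z, -1) :: base_entries n.

Lemma base_incr m : rcons (map incr (base_entries m)) (qn_mon 1) = base_entries m.+1.
Proof.
elim: m => [//|m IH]; rewrite [base_entries m.+1]/= map_cons rcons_cons IH.
by congr (_ :: _); laurent_lia.
Qed.

Lemma size_base m : size (base_entries m) = m.
Proof. by elim: m => //= m ->. Qed.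

Lemma gap_total_base m : gap_total (base_entries m) = 0.
Proof. by elim: m => //= m ->; rewrite /gap size_base subrr addr0. Qed.

Lemma fin_entries_base m : fin_entries (base_entries m) = [seq j.+1%:Z | j <- rev (iota 0 m)].
Proof.
by elim: m => [//|m IH]; rewrite fin_entries_cons IH -[in RHS](addn1 m) iotaD rev_cat.
Qed.

Lemma regular_start : regular n start.
Proof.
apply/and4P; split.
- by rewrite /= size_base.
- by rewrite /start /=; elim: (n) => //= m ->; rewrite size_base /entry_ok /is_fin /= lexx.
- by rewrite /= gap_total_base /gap size_base; apply/eqP; laurent_lia.
- rewrite /residues fin_entries_cons fin_entries_base -map_comp map_rev rev_uniq.
  rewrite map_inj_in_uniq ?iota_uniq // => i j.
  rewrite !mem_iota /= !add0n => lin ljn.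
  have E k : k.+1%:Z - 1 = k%:Z :> int by lia.
  move=> /(congr1 (fun u => (u - 1) %% nZ)%Z); rewrite !modzDml !E !modz_small //.
  by case.
Qed.

Lemma turn_start : turn n (swap_last start) = start.
Proof.
rewrite /start; case: n n_gt0 => // m _.
transitivity (rcons (incr (m.+2%:Z, -1) :: map incr (base_entries m))
    (incr (qn_mon m.+1 - qn_mon m.+1))) => //.
rewrite subrr -(base_incr m) rcons_cons; congr (_ :: rcons _ _); laurent_lia.
Qed.

(** The entries [h_i] of [M v_oo], for good [M]. *)
Fixpoint gaps (M : word) : seq laurent :=
  match M with
  | [::] => start
  | LA :: M' => turn n (swap_last (gaps M'))
  | LB :: M' => turn n (gaps M')
  end.

(** Goodness of [A M], given that of [M], only concerns the [n]-th letter of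
[M]; it shows in the gap at position [n] ([gap_letter]). *)
Definition allows_A (M : word) : bool := nth 0 (gaps M) 1 == qn_mon nZ.

Lemma allows_AE M : allows_A M = (nth 0 (gaps M) 1 == qn_mon nZ).
Proof. by []. Qed.

Fixpoint goodb (M : word) : bool :=
  match M with
  | [::] => true
  | LA :: M' => goodb M' && allows_A M'
  | LB :: M' => goodb M'
  end.

Lemma size_gaps M : size (gaps M) = n.+1.
Proof.
elim: M => [|[] M IH] /=; rewrite ?size_turn ?size_swap_last //.
by rewrite size_base.
Qed.

Lemma gapsE M : exists b a w, gaps M = b :: a :: w.
Proof.
have := size_gaps M; move: n_gt0; case: (gaps M) => [|b [|a w]] //=.
  by move=> + [E]; rewrite -E.
by exists b, a, w.
Qed.

Lemma gapsA M : goodb (LA :: M) -> exists b w,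
  gaps M = b :: qn_mon nZ :: w /\
  gaps (LA :: M) = rcons (map incr (b :: w)) (qn_mon 1).
Proof.
have [b [a [w E]]] := gapsE M; rewrite /= /allows_A E /= => /andP[_ /eqP ->].
by exists b, w; split => //; rewrite subrr.
Qed.

Lemma gapsB M : exists b w,
  gaps M = b :: w /\ gaps (LB :: M) = rcons (map incr w) (incr (b - qn_mon nZ)).
Proof.
by have [b [a [w E]]] := gapsE M; exists b, (a :: w); rewrite /= E.
Qed.

Lemma good_regular M : goodb M -> regular n (gaps M).
Proof.
elim: M => [_|[] M IH]; first exact: regular_start.
- move=> gM; have [b [w [E EA]]] := gapsA gM.
  move: gM => /= /andP[/IH + _]; rewrite E; exact: regular_turnA.
- move=> /= /IH; have [b [w [-> _]]] := gapsB M. exact: regular_turn.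
Qed.

Lemma entries_ok_decr w x : entries_ok (rcons w x) -> entries_ok (map decr w).
Proof.
elim: w => [//|b w IH] /= /andP[okbb /IH ->]; rewrite andbT size_map.
by move: okbb; rewrite size_rcons /entry_ok /is_fin /=; lia.
Qed.

Lemma map_decrK w : map incr (map decr w) = w.
Proof. by rewrite -map_comp (eq_map decrK) map_id. Qed.

Lemma prevB w x : regular n (rcons w x) -> x != qn_mon 1 ->
  regular n ((decr x + qn_mon nZ) :: map decr w) /\
  turn n ((decr x + qn_mon nZ) :: map decr w) = rcons w x.
Proof.
set r := _ :: _ => reg nx.
have turnE : turn n r = rcons w x.
  by rewrite /= map_decrK addrK decrK.
split=> //; case/and4P: reg; rewrite size_rcons -{2 3}turnE residues_turn => sz okr tr ur.
apply/and4P; split => //; first by rewrite /= size_map.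
- rewrite /= (entries_ok_decr okr) andbT size_map.
  have : entry_ok 1 x by elim: (w) okr => [|b w' IH] /= /andP[].
  have : x.1 != 1 \/ x.2 != 0.
    case: (eqVneq x.1 1) => [x1|]; [right|by left].
    by apply: contra nx => /eqP x2; apply/eqP/laurent_ext.
  by case/eqP: sz => ->; rewrite /entry_ok /is_fin ?laurentE /=; lia.
- move/eqP: tr; rewrite /= gap_total_turn => /(congr1 (fun y => subst_mon y)) tr.
  move: (congr1 fst tr) (congr1 snd tr); rewrite /gap size_map ?laurentE /= => t1 t2.
  by case/eqP: sz => ->; apply/eqP; laurent_lia.
Qed.

(** As the first entry is [q], the last entry [b] is infinite or not congruent
to [1] modulo [n]. So it differs from [q^(n + 1)], and its gap remains
nonnegative when the step is undone. *)
Lemma prevA b w : regular n (rcons (b :: w) (qn_mon 1)) ->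
  regular n (decr b :: qn_mon nZ :: map decr w) /\
  turn n (swap_last (decr b :: qn_mon nZ :: map decr w)) = rcons (b :: w) (qn_mon 1).
Proof.
set r := decr b :: _ => reg.
have turnE : turn n (swap_last r) = rcons (b :: w) (qn_mon 1).
  by rewrite /= map_decrK decrK subrr.
split=> //; case/and4P: reg; rewrite size_rcons => sz okr tr ur.
have szw : (size w).+2 = n.+1 by case/eqP: sz => <-.
have okw : entries_ok (map decr w).
  by case/andP: okr => _ /entries_ok_decr.
apply/and4P; split => //; first by rewrite /= size_map szw.
- rewrite /= okw size_map; have [->] := szw; rewrite andbT.
  have okq : entry_ok n (qn_mon nZ) by rewrite /entry_ok /is_fin /= lexx.
  rewrite okq andbT.
  have : entry_ok n.+1 b by case/andP: okr; rewrite size_rcons szw.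
  have : is_fin b -> b.1 != n.+1%:Z.
    move: ur; rewrite /residues rcons_cons fin_entries_cons fin_entries_rcons => + fb.
    rewrite fb /= map_rcons mem_rcons inE negb_or => /andP[/andP[+ _] _].
    by apply: contra => /eqP->; rewrite intS modzDr.
  by rewrite /entry_ok /is_fin ?laurentE /=; lia.
- rewrite -(gap_total_swap r); move/eqP: tr; rewrite -turnE /r /swap_last /turn subrr.
  rewrite (@gap_total_turn (decr b :: map decr w)) addr0 => tr.
  move: (congr1 fst tr) (congr1 snd tr); rewrite /= /gap /= size_map ?laurentE /= => t1 t2.
  by case: szw => <-; apply/eqP; laurent_lia.
- move: ur; rewrite -turnE residues_turn /residues.
  by rewrite (perm_uniq (perm_map _ (fin_entries_swap r))).
Qed.

Lemma last_turnB b w : entry_ok n.+1 b -> last 0 (turn n (b :: w)) != qn_mon 1.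
Proof.
rewrite /= last_rcons => okbb; apply/eqP => E.
move: (congr1 fst E) (congr1 snd E) okbb.
by rewrite /entry_ok /is_fin ?laurentE /= => t1 t2; lia.
Qed.

(** The first gap is trivial just after a letter A: the letter B leaves there
the last gap increased by one. *)
Lemma goodb_letter c M : goodb (c :: M) ->
  (last 0 (gaps (c :: M)) == qn_mon 1) = (c == LA).
Proof.
case: c => gM.
  by have [b [w [_ ->]]] := gapsA gM; rewrite last_rcons !eqxx.
have -> : (LB == LA) = false by [].
have /= := good_regular (gM : goodb M).
have [b [w [E _]]] := gapsB M; rewrite /= E => /and4P[sz /andP[+ _] _ _].
by case/eqP: sz => -> /last_turnB /negbTE.
Qed.

Lemma turn_inj r r' : size r = size r' -> turn n r = turn n r' -> r = r'.
Proof.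
case: r r' => [|b w] [|b' w'] // _ /eqP; rewrite /turn eqseq_rcons.
by case/andP => /eqP/(inj_map (can_inj incrK)) -> /eqP/(can_inj incrK)/addIr ->.
Qed.

Lemma swap_lastK : involutive swap_last.
Proof. by case=> [|b [|a w]]. Qed.

(** The list determines the last step, and each step is injective. *)
Lemma gaps_inj M M' : goodb M -> goodb M' -> size M = size M' ->
  gaps M = gaps M' -> M = M'.
Proof.
elim: M M' => [|c M IH] [|c' M'] // gM gM' [sz] E.
have gM1 : goodb M by case: c gM {E} => //= /andP[].
have gM1' : goodb M' by case: c' gM' {E} => //= /andP[].
have cc : c = c'.
  have := goodb_letter gM'; rewrite -E goodb_letter //.
  by case: c c' {gM gM' E} => -[].
rewrite -cc in E gM' *; congr (_ :: _); apply: IH => //.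
case: c E {cc gM gM'} => /= E.
  by apply: (can_inj swap_lastK); apply: turn_inj E; rewrite !size_swap_last !size_gaps.
by apply: turn_inj E; rewrite !size_gaps.
Qed.

Definition reached r := exists2 M, goodb M & gaps M = r.

Lemma reached_B w x : x != qn_mon 1 -> regular n (rcons w x) ->
  (regular n ((decr x + qn_mon nZ) :: map decr w) ->
   reached ((decr x + qn_mon nZ) :: map decr w)) -> reached (rcons w x).
Proof.
move=> nx reg; have [reg' E] := prevB reg nx => /(_ reg')[M gM EM].
by exists (LB :: M) => //=; rewrite EM.
Qed.

Lemma reached_A b w : regular n (rcons (b :: w) (qn_mon 1)) ->
  (regular n (decr b :: qn_mon nZ :: map decr w) ->
   reached (decr b :: qn_mon nZ :: map decr w)) -> reached (rcons (b :: w) (qn_mon 1)).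
Proof.
move=> reg; have [reg' E] := prevA reg => /(_ reg')[M gM EM].
by exists (LA :: M); rewrite /= /allows_A ?gM EM //= eqxx.
Qed.

(** The quantity that decreases in the proof of reachability: undoing a step
keeps it, unless the infinite gap passes from the first to the last place. *)
Definition fin_sum (r : seq laurent) : int := \sum_(v <- fin_entries r) v.

Lemma fin_sum_swap r : fin_sum (swap_last r) = fin_sum r.
Proof. exact/perm_big/fin_entries_swap. Qed.

Lemma size_fin_entries_regular r : regular n r -> size (fin_entries r) = n.
Proof.
by case/and4P => /eqP sz /size_fin_entries + /eqP tr _; rewrite sz tr /=; lia.
Qed.

Lemma fin_sum_incr w : fin_sum (map incr w) = fin_sum w + (size (fin_entries w))%:Z.
Proof.
rewrite /fin_sum fin_entries_incr big_map big_split /=; congr (_ + _).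
by rewrite big_const_seq count_predT iter_addr_0 -[RHS]natz.
Qed.

Lemma fin_sum_turn b w : size (fin_entries (b :: w)) = n ->
  fin_sum (turn n (b :: w)) = fin_sum (b :: w) + (if is_fin b then 0 else nZ).
Proof.
rewrite /fin_sum /= fin_entries_rcons is_fin_incr is_fin_sub !fin_entries_cons.
case: ifP => fb sz; last by rewrite -/(fin_sum _) fin_sum_incr sz.
rewrite -cats1 big_cat big_seq1 -/(fin_sum _) fin_sum_incr big_cons -/(fin_sum w) /=.
by move: fb sz; rewrite /is_fin /= => /eqP -> <-; lia.
Qed.

Lemma size_fin_entries_swap r : size (fin_entries (swap_last r)) = size (fin_entries r).
Proof. exact/perm_size/fin_entries_swap. Qed.

Lemma regular_fin u c v x : regular n (u ++ c :: v) -> ~~ is_fin c ->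
  x \in u ++ v -> is_fin x.
Proof.
move=> reg infc xuv; have := size_fin_entries_regular reg; case/and4P: reg => /eqP.
rewrite size_map size_filter size_cat count_cat /= (negbTE infc) addnS => -[<-] _ _ _.
rewrite add0n -count_cat -size_cat => /eqP; rewrite -all_count => /allP; exact.
Qed.

Lemma is_fin_prev x m : is_fin (decr x + qn_mon m) = is_fin x.
Proof. by rewrite /is_fin /= addr0. Qed.

Section ReachStep.
Variable s : int.
Hypothesis IHs : forall r, regular n r -> fin_sum r < s -> reached r.

(** Each inverse step moves the infinite gap one place towards [P_1]; the
step after it has come first lowers the sum of the finite entries. *)
Lemma reached_inf_inside u c v : u != [::] -> ~~ is_fin c ->
  regular n (u ++ c :: v) -> fin_sum (u ++ c :: v) = s -> reached (u ++ c :: v).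
Proof.
have [m] := ubnP (size v); elim: m u c v => // m IH u c v szv nu infc.
have infd : ~~ is_fin (decr c) by [].
case: (lastP v) szv => [|v' x] szv.
  rewrite cats1 => reg sE; have nc : c != qn_mon 1.
    by apply: contra infc => /eqP->.
  apply: reached_B => // reg'; apply: IHs => //.
  have [_ E] := prevB reg nc; move: sE; rewrite -E fin_sum_turn.
    by rewrite is_fin_prev ifN // => <-; rewrite ltrDl ltz_nat.
  exact: size_fin_entries_regular.
rewrite -rcons_cons -rcons_cat => reg sE.
have fx : is_fin x.
  apply: (@regular_fin u c (rcons v' x)) => //; first by rewrite -rcons_cons -rcons_cat.
  by rewrite mem_cat mem_rcons inE eqxx orbT.
case: (eqVneq x (qn_mon 1)) reg sE => [->|nx] reg sE.
  case: u nu reg sE => // b u' _; rewrite cat_cons => reg sE.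
  apply: reached_A => // reg'; have [_ E] := prevA reg.
  rewrite map_cat map_cons -2!cat_cons; apply: IH => //.
    by rewrite size_map; rewrite size_rcons in szv.
    by rewrite !cat_cons -map_cons -map_cat.
  rewrite !cat_cons -map_cons -map_cat -sE -fin_sum_swap -E fin_sum_turn ?addr0 //.
  by rewrite -size_fin_entries_swap; apply: size_fin_entries_regular.
apply: reached_B => // reg'; have [_ E] := prevB reg nx.
rewrite map_cat map_cons -cat_cons; apply: IH => //.
  by rewrite size_map; rewrite size_rcons in szv.
  by rewrite cat_cons -map_cons -map_cat.
rewrite cat_cons -map_cons -map_cat -sE -E fin_sum_turn; last exact: size_fin_entries_regular.
by rewrite is_fin_prev fx addr0.
Qed.

(** When the infinite gap comes last and the finite entries are not those of
the initial list, undoing letters A brings an entry that differs to the first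
place, where the inverse step moves the infinite gap inside. *)
Lemma reached_inf_last j c v : ~~ is_fin c -> (j < size v)%N ->
  nth 0 (rev v) j != qn_mon j.+1 ->
  regular n (c :: v) -> fin_sum (c :: v) = s -> reached (c :: v).
Proof.
elim: j c v => [|j IH] c v infc;
  case: (lastP v) => [//|v' x]; rewrite rev_rcons size_rcons ltnS -rcons_cons => jv.
  move=> nx reg sE; apply: reached_B => // reg'; have [_ E] := prevB reg nx.
  apply: (@reached_inf_inside [:: _]) => //=.
  rewrite -sE -E fin_sum_turn; last exact: size_fin_entries_regular.
  rewrite is_fin_prev (@regular_fin [::] c (rcons v' x)) ?addr0 //.
  by rewrite mem_rcons inE eqxx.
move=> nth_ne reg sE; case: (eqVneq x (qn_mon 1)) reg sE => [->|nx] reg sE.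
  apply: reached_A => // reg'; have [_ E] := prevA reg.
  apply: IH => //; rewrite ?size_map //=; first by rewrite ltnS size_map ltnW.
    rewrite rev_cons nth_rcons size_rev size_map jv -map_rev (nth_map 0) ?size_rev //.
    move: nth_ne => /=; apply: contra => /eqP E'.
    by apply/eqP; rewrite -[LHS]decrK {}E'; laurent_lia.
  rewrite -fin_sum_swap -sE -E fin_sum_turn ?addr0 //.
  by rewrite -size_fin_entries_swap; apply: size_fin_entries_regular.
apply: reached_B => // reg'; have [_ E] := prevB reg nx.
apply: (@reached_inf_inside [:: _]) => //=.
rewrite -sE -E fin_sum_turn; last exact: size_fin_entries_regular.
rewrite is_fin_prev (@regular_fin [::] c (rcons v' x)) ?addr0 //.
by rewrite mem_rcons inE eqxx.
Qed.

End ReachStep.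

Lemma base_rev v : (forall j, (j < size v)%N -> nth 0 (rev v) j = qn_mon j.+1) ->
  v = base_entries (size v).
Proof.
elim: v => [//|b v IH] H; rewrite /= -IH.
  by have := H (size v) (leqnn _); rewrite rev_cons nth_rcons size_rev ltnn eqxx => ->.
move=> j jv; rewrite -H ?rev_cons ?nth_rcons ?size_rev ?jv //.
exact: ltnW.
Qed.

Lemma fin_sum_ge0 r : entries_ok r -> 0 <= fin_sum r.
Proof.
elim: r => [|b w IH]; first by rewrite /fin_sum big_nil.
move=> /= /andP[+ /IH]; rewrite /entry_ok /fin_sum fin_entries_cons.
case: ifP => fb; rewrite ?big_cons -/(fin_sum w) //.
by move: fb; rewrite /is_fin /=; lia.
Qed.

(** Induction on the sum of the finite entries, by the two previous cases. If
the infinite gap is last and the other entries are [q, ..., q^n], the total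
leaves only the list of [v_oo]. *)
Lemma regular_reached r : regular n r -> reached r.
Proof.
have [m] := ubnP `|fin_sum r|%N; elim: m r => // m IH r.
rewrite ltnS => lem reg.
have IHs r' : regular n r' -> fin_sum r' < fin_sum r -> reached r'.
  move=> reg' lt; apply: IH => //; case/and4P: reg => _ /fin_sum_ge0 + _ _.
  by case/and4P: reg' => _ /fin_sum_ge0; move: lt lem; lia.
have : has (predC is_fin) r.
  have := size_fin_entries_regular reg; case/and4P: (reg) => /eqP.
  rewrite has_predC all_count -size_filter size_map => -> _ _ _ ->.
  by rewrite neq_ltn leqnn.
move/(has_nthP 0) => [i ir infc].
have := cat_take_drop i r; rewrite (drop_nth 0) //.
move: (nth 0 r i) (take i r) (drop i.+1 r) infc => c u v infc rE.
move: IHs reg; rewrite -rE => IHs reg.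
case: u IHs reg {ir rE} => [|b u] IHs reg; last first.
  exact: (reached_inf_inside IHs).
case: (pselect (forall j, (j < size v)%N -> nth 0 (rev v) j = qn_mon j.+1)).
  move/base_rev => vE; exists [::] => //; case/and4P: (reg) => /= /eqP[sz] /andP[+ _] /eqP tr _.
  move: tr; rewrite /start vE /gap size_base sz gap_total_base.
  move=> /= tr _; congr (_ :: _).
  by move: (congr1 fst tr) (congr1 snd tr); rewrite /= => t1 t2; laurent_lia.
move/existsNP => [j]; case/not_implyP => jv /eqP nj.
exact: (reached_inf_last IHs infc jv nj).
Qed.

End Words.

(** * Signs and numerators of good words *)

Section Floor.
Variable n : nat.
Hypothesis n_gt0 : (0 < n)%N.
Notation nZ := (n%:Z).

Lemma divz_opp_sum (x y : int) : (x %% nZ)%Z != (y %% nZ)%Z ->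
  ((x - y) %/ nZ)%Z = - 1 - ((y - x) %/ nZ)%Z.
Proof.
move=> ne; have n0 : nZ != 0 by rewrite eqz_nat -lt0n.
set z := y - x; have -> : x - y = - z by rewrite opprB.
have z0 : (z %% nZ)%Z != 0.
  by apply: contra ne => /eqP/dvdz_mod0P; rewrite eq_sym eqz_mod_dvd.
rewrite {1}(divz_eq z nZ); set q := (z %/ nZ)%Z; set r := (z %% nZ)%Z in z0 *.
have r0 : 0 <= r by rewrite modz_ge0.
have rn : r < nZ by rewrite ltz_pmod.
have -> : - (q * nZ + r) = (-1 - q) * nZ + (nZ - r) by ring.
rewrite divzMDl // divz_small ?addr0 //.
by apply/andP; split; lia.
Qed.

(** The list is stored last entry first, so each summand is the floor of a later
entry minus an earlier one, divided by [n]. For entries distinct modulo [n]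
its parity behaves like the sign of an affine permutation. *)
Fixpoint inversions (v : seq int) : int :=
  if v is x :: v' then \sum_(y <- v') ((x - y) %/ nZ)%Z + inversions v' else 0.

Lemma inversions_rcons v z : inversions (rcons v z) =
  inversions v + \sum_(y <- v) ((y - z) %/ nZ)%Z.
Proof.
elim: v => [|x v IH]; first by rewrite /= !big_nil.
by rewrite /= IH big_cons -cats1 big_cat big_seq1 /=; ring.
Qed.

Lemma inversions_shift v c : inversions [seq y + c | y <- v] = inversions v.
Proof.
elim: v => [//|x v IH] /=; rewrite IH big_map; congr (_ + _).
by apply: eq_bigr => y _; congr (_ %/ _)%Z; ring.
Qed.

(** Moving [x] in front of [y] as [x - n] replaces the summand [(x - y) / n],
rounded down, by its negative. *)
Lemma inversions_turn x v :
  uniq [seq (y %% nZ)%Z | y <- x :: v] -> exists k : int,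
  inversions (rcons [seq y + 1 | y <- v] (x - nZ + 1)) = inversions (x :: v) + 2 * k.
Proof.
move=> /= /andP[nx _]; exists (- \sum_(y <- v) ((x - y) %/ nZ)%Z).
rewrite inversions_rcons inversions_shift big_map /=.
have -> : \sum_(y <- v) ((y + 1 - (x - nZ + 1)) %/ nZ)%Z =
    - \sum_(y <- v) ((x - y) %/ nZ)%Z.
  rewrite -sumrN; apply: eq_big_seq => y yv.
  have -> : y + 1 - (x - nZ + 1) = 1 * nZ + (y - x) by ring.
  rewrite divzMDl ?eqz_nat -?lt0n // divz_opp_sum; first by ring.
  by apply: contra nx => /eqP <-; apply/mapP; exists y.
by ring.
Qed.

Lemma inversions_swap x y v : (x %% nZ)%Z != (y %% nZ)%Z -> exists k : int,
  inversions (y :: x :: v) = inversions (x :: y :: v) + 2 * k + 1.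
Proof.
move=> ne; exists ((y - x) %/ nZ)%Z => /=.
by rewrite !big_cons (divz_opp_sum ne); ring.
Qed.

End Floor.

Section Numerators.
Variable n : nat.
Hypothesis n_gt0 : (0 < n)%N.
Notation nZ := (n%:Z).
Notation gaps := (gaps n).
Notation goodb := (goodb n).

(** The last gap of [M v_oo], increased by one and transformed by [S]: both
operators divide by one minus this monomial or its inverse. *)
Definition next_gap (M : word) : laurent :=
  subst_mon (head 0 (gaps M) - qn_mon nZ).

Lemma next_gapE M : next_gap M = subst_mon (head 0 (gaps M) - qn_mon nZ).
Proof. by []. Qed.

(** The point [P_1]. *)
Fixpoint first_pt (M : word) : laurent :=
  match M with
  | [::] => 0
  | LA :: M' => subst_mon (first_pt M')
  | LB :: M' => subst_mon (first_pt M' - head 0 (gaps M') + qn_mon nZ)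
  end.

(** An expansion of [1 / (1 - x)] in which [x] has negative exponents is
[- x^(-1) / (1 - x^(-1))]. So [A], which divides by [1 - g^(-1)], contributes
the sign [-1] and the monomial [g] when [g] is finite, and [B], which divides
by [1 - g], contributes [-1] and [g^(-1)] when [g] is infinite. *)
Definition numer_stepA (g : laurent) : laurent := if is_fin g then g else 0.
Definition numer_stepB (g : laurent) : laurent := if is_fin g then 0 else - g.

Fixpoint numer (M : word) : laurent :=
  match M with
  | [::] => 0
  | LA :: M' => subst_mon (numer M') + numer_stepA (next_gap M')
  | LB :: M' => subst_mon (numer M') + numer_stepB (next_gap M')
  end.

Fixpoint flips (M : word) : nat :=
  match M with
  | [::] => 0%N
  | LA :: M' => (flips M' + is_fin (next_gap M'))%N
  | LB :: M' => (flips M' + ~~ is_fin (next_gap M'))%N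
  end.

Definition gap_shape (g : laurent) :=
  if is_fin g then 1 <= g.1 else (g.2 == -1) && (g.1 <= 0).

Lemma next_gap_shape M : goodb M -> gap_shape (next_gap M).
Proof.
move=> /(good_regular n_gt0); rewrite /next_gap; have := size_gaps n M.
case: (gaps M) => // b w [sz] /and4P[_ /= /andP[okbb okw] /eqP tr _].
have [le0 ge0] := entries_ok_total okw.
move: (congr1 fst tr) (congr1 snd tr) okbb.
rewrite /gap_shape /entry_ok /gap /is_fin sz ?laurentE /=; move: le0 ge0; case: ifP; lia.
Qed.

Lemma numer_ge0 M : goodb M -> (0 <= (numer M).1) && (0 <= (numer M).2).
Proof.
elim: M => [//|c M IH] gM.
have gM1 : goodb M by case: c gM => //= /andP[].
have := next_gap_shape gM1; move: (IH gM1).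
by case: c {gM} => /=; rewrite /gap_shape /numer_stepA /numer_stepB; case: ifP; rewrite /is_fin ?laurentE /=; lia.
Qed.

Lemma gaps_nseq r : gaps (nseq r LA) = start n.
Proof. by elim: r => //= r ->; apply: turn_start. Qed.

Lemma numer_nseq r : numer (nseq r LA) = 0.
Proof.
by elim: r => //= r ->; rewrite /next_gap gaps_nseq /numer_stepA /is_fin; laurent_lia.
Qed.

(** The first letter B makes the exponent of [z] positive; each later step
applies [S] and so increases the exponent of [q]. *)
Lemma numer_growth M1 r : let M := M1 ++ LB :: nseq r LA in goodb M ->
  ((size M1)%:Z <= (numer M).1) && (1 <= (numer M).2).
Proof.
elim: M1 => [|c M1 IH] /= gM.
  by rewrite numer_nseq /next_gap gaps_nseq /numer_stepB /is_fin /=; lia.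
have gM1 : goodb (M1 ++ LB :: nseq r LA) by case: c gM => //= /andP[].
have := next_gap_shape gM1; move: (IH gM1).
by case: c {gM} => /=; rewrite /gap_shape /numer_stepA /numer_stepB; case: ifP; rewrite /is_fin ?laurentE /=; lia.
Qed.

Definition square_sum (r : seq laurent) : int := \sum_(a <- r) a.1 ^+ 2.

Definition fin_or_inf (r : seq laurent) := all (fun a : laurent => is_fin a || (a.2 == -1)) r.

Lemma entries_ok_fin_or_inf r : entries_ok r -> fin_or_inf r.
Proof.
elim: r => //= b w IH /andP[+ /IH ->]; rewrite andbT.
by rewrite /entry_ok; case/orP => [->|/andP[->]]; rewrite ?orbT.
Qed.

Lemma square_sum_incr w : fin_or_inf w ->
  square_sum (map incr w) = square_sum w + 2 * fin_sum w + (size (fin_entries w))%:Z.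
Proof.
elim: w => [|b w IH] /=; first by rewrite /square_sum /fin_sum !big_nil.
case/andP => okbb /IH; rewrite /square_sum /fin_sum !big_cons fin_entries_cons => ->.
rewrite incrL1; move: okbb; case: ifP => /= [/eqP -> _|_ /eqP ->].
  by rewrite big_cons intS; ring.
by ring.
Qed.

(** [P_1] is a function of the entries that does not see their order. *)
Definition quadratic (x : laurent) (r : seq laurent) :=
  2 * nZ * x.1 = square_sum r - square_sum (start n) /\
  2 * nZ * x.2 = 2 * fin_sum r - nZ * (nZ + 1).

Lemma quadratic_turn x b w : fin_or_inf (b :: w) -> size (fin_entries (b :: w)) = n ->
  quadratic x (b :: w) ->
  quadratic (subst_mon (x - b + qn_mon nZ)) (turn n (b :: w)).
Proof.
move=> /= /andP[okbb okw] sz [q1 q2]; split; last first.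
  rewrite (fin_sum_turn n_gt0 sz); move: q2 okbb; rewrite ?laurentE.
  case: ifP => [/eqP ->|_ q2 /= /eqP ->];
   lia.
rewrite /turn /square_sum -cats1 big_cat big_seq1 /= -/(square_sum _) (square_sum_incr okw).
move: q1 q2 sz okbb; rewrite /square_sum big_cons -/(square_sum w) -/(square_sum (start n)).
rewrite fin_entries_cons /fin_sum fin_entries_cons; case: ifP => [/eqP b2|_] q1 q2 sz.
  rewrite big_cons -/(fin_sum w) in q2 => _; rewrite -/(fin_sum w).
  move: sz => /= sz; have {}sz : (size (fin_entries w))%:Z = nZ - 1 by lia.
  rewrite sz ?laurentE b2; lia.
move=> /= /eqP b2; rewrite -/(fin_sum w) in q2 *; rewrite sz ?laurentE b2.
lia.
Qed.

Lemma fin_sum_base m : 2 * fin_sum (base_entries m) = m%:Z * (m%:Z + 1).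
Proof.
elim: m => [|m IH]; first by rewrite /fin_sum big_nil.
by rewrite /fin_sum fin_entries_cons /= big_cons -/(fin_sum _) mulrDr IH intS; ring.
Qed.

Lemma good_point M : goodb M -> quadratic (first_pt M) (gaps M).
Proof.
elim: M => [|[] M IH] gM.
- split; first by rewrite subrr mulr0.
  by rewrite mulr0 /fin_sum fin_entries_cons -/(fin_sum _) /= fin_sum_base subrr.
- have gM1 : goodb M by case/andP: gM.
  have [b [w [E EA]]] := gapsA n_gt0 gM.
  have reg := good_regular n_gt0 gM1.
  have := @quadratic_turn (first_pt M) (qn_mon nZ) (b :: w).
  rewrite -[X in turn n X]/(swap_last (b :: qn_mon nZ :: w)) -E subrK; apply.
  + have : fin_or_inf (gaps M) by case/and4P: reg => _ /entries_ok_fin_or_inf.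
    by rewrite E.
  + rewrite -[X in fin_entries X]/(swap_last (b :: qn_mon nZ :: w)) -E.
    by rewrite size_fin_entries_swap; apply: size_fin_entries_regular.
  + have := IH gM1; rewrite /quadratic E -(fin_sum_swap (b :: _)) /=.
    have -> // : square_sum (b :: qn_mon nZ :: w) = square_sum (qn_mon nZ :: b :: w).
    by rewrite /square_sum !big_cons addrCA.
- have [b [w [E EB]]] := gapsB n_gt0 M.
  have reg := good_regular n_gt0 (gM : goodb M).
  have := IH gM; rewrite /= E; apply: quadratic_turn.
    by case/and4P: reg => _ /entries_ok_fin_or_inf; rewrite E.
  by rewrite -E; apply: size_fin_entries_regular.
Qed.

Definition point_total M : laurent := \sum_(y <- points_from (first_pt M) (gaps M)) y.

Lemma points_from_B M b w : gaps M = b :: w ->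
  points_from (first_pt (LB :: M)) (gaps (LB :: M)) =
  rcons [seq subst_mon y | y <- points_from (first_pt M) w] (first_pt (LB :: M)).
Proof.
by move=> E; rewrite /= E; apply: points_from_turn; rewrite -subst_monD; congr subst_mon; laurent_lia.
Qed.

Lemma points_from_A M b w : gaps M = b :: qn_mon nZ :: w ->
  points_from (first_pt (LA :: M)) (gaps (LA :: M)) =
  rcons [seq subst_mon y | y <- points_from (first_pt M) (b :: w)] (first_pt (LA :: M)).
Proof.
move=> E; have -> : gaps (LA :: M) = rcons (map incr (b :: w)) (incr 0).
  by rewrite [gaps _]/= E /swap_last /turn subrr.
by rewrite (@points_from_turn (first_pt M)) // subst_mon0 addr0.
Qed.

(** The numerator is the product of the [P_i] divided by [q^(c(c-1)/2) z^c],
where [c] is the sum of the finite gaps. *)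
Lemma good_numer M : goodb M ->
  2 * (numer M).1 = 2 * (point_total M).1 - fin_gap_total (gaps M) * (fin_gap_total (gaps M) - 1) /\
  (numer M).2 = (point_total M).2 - fin_gap_total (gaps M).
Proof.
rewrite /point_total; elim: M => [|[] M IH] gM.
- have -> : fin_gap_total (gaps [::]) = 0.
    by rewrite /= addr0; elim: (n) => //= m ->; rewrite size_base; lia.
  suff -> : \sum_(y <- points_from (first_pt [::]) (gaps [::])) y = 0 by [].
  rewrite /= gap_total_base add0r big_cons add0r; elim: (n) => [|m IHm]; first by rewrite big_nil.
  by rewrite big_cons IHm gap_total_base.
- have gM1 : goodb M by case/andP: gM.
  have [b [w [E EA]]] := gapsA n_gt0 gM.
  have ctA : fin_gap_total (gaps (LA :: M)) = fin_gap_total (b :: w).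
    by rewrite EA (_ : qn_mon 1 = incr 0) // fin_gap_total_turn addr0.
  have := good_regular n_gt0 gM1; rewrite (points_from_A E) ctA.
  rewrite -cats1 big_cat big_seq1 big_map subst_mon_sum.
  have nE : next_gap M = subst_mon (b - qn_mon nZ) by rewrite /next_gap E.
  move: (IH gM1); rewrite [numer (_ :: _)]/= [first_pt (_ :: _)]/= nE E.
  rewrite /= => {IH ctA} + /and4P[/eqP[sz] okr /eqP tr _].
  move: okr tr => /=; rewrite /gap sz => /and3P[okbb _ okw] tr.
  have [le0 ge0] := entries_ok_total okw; have ctE := entries_ok_fin_total okw.
  rewrite !big_cons; set s := \sum_(_ <- _) _; set c := fin_gap_total w in ctE *.
  move: (congr1 fst tr) (congr1 snd tr) okbb le0 ge0 ctE.
  rewrite /numer_stepA /entry_ok /is_fin ?laurentE /= -sz; move: (size w) => {sz} m.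
  by case: ifP => [/eqP b2|b2]; rewrite ?subr0 ?b2 /=; lia.
- have [b [w [E EB]]] := gapsB n_gt0 M.
  have := good_regular n_gt0 (gM : goodb M); rewrite (points_from_B E).
  rewrite -cats1 big_cat big_seq1 big_map subst_mon_sum EB.
  have nE : next_gap M = subst_mon (b - qn_mon nZ) by rewrite /next_gap E.
  move: (IH gM); rewrite [numer (_ :: _)]/= [first_pt (_ :: _)]/= nE E fin_gap_total_turn.
  rewrite /= => {IH} + /and4P[/eqP[sz] okr /eqP tr _].
  move: okr tr => /=; rewrite /gap sz => /andP[okbb okw] tr.
  have [le0 ge0] := entries_ok_total okw; have ctE := entries_ok_fin_total okw.
  rewrite !big_cons; set s := \sum_(_ <- _) _; set c := fin_gap_total w in ctE *.
  move: (congr1 fst tr) (congr1 snd tr) okbb le0 ge0 ctE.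
  rewrite /numer_stepB /entry_ok /is_fin ?laurentE /= ?subr0.
  by case: ifP => [/eqP b2|b2]; rewrite ?subr0 ?b2 /=; lia.
Qed.

Lemma inversions_base m : (m <= n)%N -> inversions n (fin_entries (base_entries m)) = 0.
Proof.
elim: m => [//|m IH] mn; rewrite fin_entries_cons /= IH 1?ltnW // addr0 big_seq big1 //.
move=> y; rewrite fin_entries_base => /mapP[j]; rewrite mem_rev mem_iota add0n => /andP[_ jm] ->.
by rewrite divz_small //; lia.
Qed.

Lemma fin_entries_turn b w : fin_entries (turn n (b :: w)) =
  if is_fin b then rcons [seq v + 1 | v <- fin_entries w] (b.1 - nZ + 1)
  else [seq v + 1 | v <- fin_entries w].
Proof.
rewrite /= fin_entries_rcons is_fin_incr is_fin_sub fin_entries_incr; case: ifP => // /eqP b2.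
by congr (rcons _ _); move: b2; rewrite ?laurentE; lia.
Qed.

Lemma good_flips M : goodb M -> exists k : int,
  (flips M)%:Z = (first_pt M).2 + inversions n (fin_entries (gaps M)) + 2 * k.
Proof.
elim: M => [|[] M IH] gM.
- by exists 0; rewrite /= fin_entries_cons /= inversions_base.
- have gM1 : goodb M by case/andP: gM.
  have [b [w [E _]]] := gapsA n_gt0 gM; have [k kE] := IH gM1.
  have fb : is_fin (next_gap M) = is_fin b by rewrite /next_gap E is_fin_subst is_fin_sub.
  have := good_regular n_gt0 gM1; rewrite E => /and4P[_ okr _].
  rewrite /residues PoszD kE -[gaps (LA :: M)]/(turn n (swap_last (gaps M))) E fb.
  rewrite /swap_last fin_entries_turn !fin_entries_cons qnL1.
  rewrite (_ : (first_pt (LA :: M)).2 = (first_pt M).2) //.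
  have -> : is_fin (qn_mon nZ) by [].
  case: ifP okr => [fb' _ | fb' okr] ur; last first.
    have [k' ->] := inversions_turn n_gt0 ur.
    by exists (k - k'); lia.
  have ur' : uniq [seq (v %% nZ)%Z | v <- nZ :: b.1 :: fin_entries w].
    by move: ur; rewrite /= !inE !negb_or eq_sym => /and3P[/andP[-> ->] -> ->].
  have ne : (b.1 %% nZ)%Z != (nZ %% nZ)%Z by move: ur => /= /andP[]; rewrite inE negb_or => /andP[].
  have [k' E1] := inversions_turn n_gt0 ur'.
  have [k'' E2] := inversions_swap n_gt0 (fin_entries w) ne.
  by rewrite E1 E2; exists (k - k' - k''); lia.
- have [b [w [E _]]] := gapsB n_gt0 M; have [k kE] := IH gM.
  have fb : is_fin (next_gap M) = is_fin b by rewrite /next_gap E is_fin_subst is_fin_sub.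
  have := good_regular n_gt0 (gM : goodb M); rewrite E => /and4P[_ /andP[okbb _] _].
  rewrite /residues PoszD kE -[gaps (LB :: M)]/(turn n (gaps M)) E fb.
  rewrite fin_entries_turn [first_pt (LB :: M)]/= E [head _ _]/= !laurentE !fin_entries_cons.
  case: ifP okbb => [fb' _ ur | fb' + _]; last first.
    rewrite /entry_ok fb' orbF inversions_shift => /eqP ->.
    by exists k; lia.
  have [k' ->] := inversions_turn n_gt0 ur.
  by exists (k - k'); rewrite (eqP fb') /=; lia.
Qed.

(** For two good words whose lists differ by an exchange of the last two
entries, the point [P_1] is the same, and one further letter A produces equal
numerators and opposite signs. *)
Lemma partner_numer M M' b a w : goodb M -> goodb M' ->
  gaps M = b :: a :: w -> gaps M' = a :: b :: w ->
  [/\ first_pt M = first_pt M',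
      subst_mon (numer M) + numer_stepA (next_gap M) =
        subst_mon (numer M') + numer_stepA (next_gap M') &
      exists k : int, (flips M + is_fin (next_gap M))%:Z =
        (flips M' + is_fin (next_gap M'))%:Z + 2 * k + 1].
Proof.
move=> gM gM' E E'.
have n0 : 2 * nZ != 0 by lia.
have px : first_pt M = first_pt M'.
  have := good_point gM; have := good_point gM'; rewrite E E' /quadratic.
  rewrite -(fin_sum_swap (a :: _)) /=.
  have -> : square_sum (a :: b :: w) = square_sum (b :: a :: w).
    by rewrite /square_sum !big_cons addrCA.
  by case=> <- <- [/(mulfI n0) p1 /(mulfI n0) p2]; apply: laurent_ext.
have nE : next_gap M = subst_mon (b - qn_mon nZ) by rewrite /next_gap E.
have nE' : next_gap M' = subst_mon (a - qn_mon nZ) by rewrite /next_gap E'.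
have /and4P[/eqP + okr /eqP tr ur] := good_regular n_gt0 gM.
rewrite E in okr tr ur *; move=> [sz].
have fE (y : laurent) : is_fin (subst_mon (y - qn_mon nZ)) = is_fin y.
  by rewrite is_fin_subst is_fin_sub.
split=> //.
- have := good_numer gM; have := good_numer gM'.
  rewrite /point_total E E' -px nE nE' /= !big_cons.
  move: okr tr => /= /and3P[okbb okba okw]; rewrite /gap /= => tr.
  have [le0 ge0] := entries_ok_total okw; have ctE := entries_ok_fin_total okw.
  set s := \sum_(_ <- _) _; set c := fin_gap_total w in ctE *.
  move: (congr1 fst tr) (congr1 snd tr) okbb okba le0 ge0 ctE.
  rewrite /entry_ok /numer_stepA !fE /is_fin !laurentE /= -sz; move: (size w) => m.
  move=> t1 t2 ob oa le0 ge0 ctE [N1' N2'] [N1 N2].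
  case: (eqVneq b.2 0) ob N1' N2' N1 N2 => [b2 ob|b2 ob]; rewrite ?b2 /=;
    case: (eqVneq a.2 0) oa => [a2 oa|a2 oa]; rewrite ?a2 /=; move=> N1' N2' N1 N2.
  + by apply: laurent_ext; rewrite ?laurentE; lia.
  + have tw : (gap_total w).2 = 0 by lia.
    rewrite -{}ctE // in N1 N2 N1' N2'.
    by apply: laurent_ext; rewrite ?laurentE; lia.
  + have tw : (gap_total w).2 = 0 by lia.
    rewrite -{}ctE // in N1 N2 N1' N2'.
    by apply: laurent_ext; rewrite ?laurentE; lia.
  + by lia.
- have [k kE] := good_flips gM; have [k' kE'] := good_flips gM'.
  rewrite !PoszD kE kE' E E' px nE nE' !fE; clear kE kE'.
  move: okr ur => /= /and3P[okbb okba okw]; rewrite /residues !fin_entries_cons.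
  case: ifP => fb; case: ifP => fa.
  + move=> ur; have ne : (b.1 %% nZ)%Z != (a.1 %% nZ)%Z.
      by move: ur; rewrite /= inE negb_or => /andP[/andP[]].
    have [k'' ->] := inversions_swap n_gt0 (fin_entries w) ne.
    by exists (k - k' - k'' - 1); lia.
  + by exists (k - k'); lia.
  + by exists (k - k' - 1); lia.
  + have /= := congr1 snd tr;
    have [le0 _] := entries_ok_total okw.
    by move: okbb okba le0; rewrite /entry_ok fa fb /gap ?laurentE; lia.
Qed.

End Numerators.

(** * Goodness, and pairs of words that cancel *)

Section GoodWords.
Variable n : nat.
Hypothesis n_gt0 : (0 < n)%N.
Notation nZ := (n%:Z).
Notation gaps := (gaps n).
Notation goodb := (goodb n).
Notation allows_A := (allows_A n).

Lemma nth_base m j : (j < m)%N -> nth 0 (base_entries m) j = qn_mon (m - j)%N.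
Proof. by elim: m j => [//|m IH] [|j] //= /IH ->; rewrite subSS. Qed.

Lemma incr_eq a (m : nat) : (incr a == qn_mon m.+1) = (a == qn_mon m).
Proof. by rewrite -[RHS](inj_eq (can_inj incrK)); congr (_ == _); laurent_lia. Qed.

(** A gap made by a letter moves one place per step without change, apart
from [S], until it comes to position [n]; only a gap made by a letter A is trivial. *)
Lemma gap_letter M i : goodb M -> (i < n)%N ->
  (nth 0 (gaps M) (n - i) == qn_mon i.+1) = (nth LA M i == LA).
Proof.
elim: M i => [|c M IH] i gM lin.
  rewrite nth_nil /= eqxx -(subnSK lin) /= nth_base; last first.
    by rewrite ltn_subLR // addSn ltnS leq_addl.
  by rewrite subKn // eqxx.
case: i lin => [|i] lin.
  by rewrite subn0 -(goodb_letter n_gt0 gM) -nth_last size_gaps.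
have lin' : (i < n)%N by apply: ltnW.
case: c gM => gM; last first.
  have [b [w [E EB]]] := gapsB n_gt0 M; rewrite -(IH i) // E EB.
  have := size_gaps n M; rewrite E => -[szw].
  rewrite nth_rcons size_map szw ltn_subrL n_gt0 andTb -(subnSK lin').
  by rewrite (nth_map 0) ?szw ?ltn_subrL ?n_gt0 // incr_eq.
have gM1 : goodb M by case/andP: gM.
have [b [w [E EA]]] := gapsA n_gt0 gM; rewrite -(IH i) // E EA.
have := size_gaps n M; rewrite E => -[szw].
have szbw : size (b :: w) = n by [].
rewrite nth_rcons size_map szbw ltn_subrL n_gt0 andTb -(subnSK lin').
rewrite (nth_map 0) ?szbw ?ltn_subrL ?n_gt0 // incr_eq.
by rewrite -(subnSK lin).
Qed.

Lemma good_goodb M : good n.+1 M <-> goodb M.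
Proof.
rewrite /good; elim: M => [//|c M IH].
have shift_params : good n.+1 (c :: M) -> good n.+1 M.
  by move=> g i; move: (g i.+1); rewrite /= addSn ltnS; apply.
case: c shift_params => shift_params; last first.
  split=> [/shift_params/IH //|/= /IH g] [|i] //=; rewrite addSn ltnS; exact: g.
have okE : goodb M -> allows_A M = (nth LA M n.-1 == LA).
  by move=> gM; rewrite -gap_letter // ?prednK // allows_AE -subn1 subKn // subn1 prednK.
have nthE : ((n.-1 < size M)%N -> nth LB M n.-1 = LA) <-> nth LA M n.-1 = LA.
  split=> [H|<- lt]; last exact: set_nth_default.
  case: (ltnP n.-1 (size M)) => [lt|le]; last by rewrite nth_default.
  by rewrite -[RHS](H lt); apply: set_nth_default.
have -> : goodb (LA :: M) = goodb M && allows_A M by [].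
split=> [g|/andP[gM okM]].
  have gM : goodb M by apply/IH/shift_params.
  rewrite gM okE //; apply/eqP/nthE => lt.
  have := g 0%N; rewrite add0n /= -(prednK n_gt0) ltnS => /(_ lt erefl).
  by [].
move: okM; rewrite okE // => /eqP/nthE okM [|i] /=.
  by rewrite add0n -(prednK n_gt0) ltnS => /okM.
by rewrite addSn ltnS; apply: (proj2 IH gM).
Qed.

Fixpoint good_words (N : nat) : seq word :=
  if N is N'.+1 then
    [seq LA :: M | M <- good_words N' & allows_A M] ++ [seq LB :: M | M <- good_words N']
  else [:: [::]].

Lemma mem_good_words N M : (M \in good_words N) = goodb M && (size M == N).
Proof.
elim: N M => [|N IH] M; first by rewrite inE /=; case: M => [//|c M]; rewrite andbF.
rewrite mem_cat; case: M => [|[] M] /=; rewrite ?eqSS.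
- by apply/negbTE/negP => /orP[] /mapP[].
- have inj : injective (cons LA) by move=> ? ? [].
  rewrite (mem_map inj) mem_filter IH andbC -andbA [_ && allows_A M]andbC -andbA.
  rewrite [X in _ || X](negbTE _) ?orbF //; last by apply/negP => /mapP[].
- have inj : injective (cons LB) by move=> ? ? [].
  rewrite (mem_map inj) IH [X in X || _](negbTE _) //; by apply/negP => /mapP[].
Qed.

Lemma uniq_good_words N : uniq (good_words N).
Proof.
elim: N => [//|N IH]; rewrite cat_uniq !map_inj_uniq; try by move=> ? ? [].
rewrite filter_uniq //= IH andbT; apply/hasPn => _ /mapP[M _ ->].
by apply/negP => /mapP[].
Qed.

(** Up to trailing letters A, a word is empty or ends with B. *)
Lemma trailing_A_cases M : (exists r, M = nseq r LA) \/
  (exists M1 r, M = M1 ++ LB :: nseq r LA).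
Proof.
elim: M => [|c M [[r ->]|[M1 [r ->]]]]; first by left; exists 0%N.
  by case: c; [left; exists r.+1|right; exists [::], r].
by right; exists (c :: M1), r.
Qed.

Lemma gaps_pad M r : gaps (M ++ nseq r LA) = gaps M.
Proof. by elim: M => [|[] M /= ->] //; apply: gaps_nseq. Qed.

Lemma allows_A_pad M r : allows_A (M ++ nseq r LA) = allows_A M.
Proof. by rewrite allows_AE gaps_pad. Qed.

Lemma allows_A_start : allows_A [::].
Proof. by rewrite allows_AE /=; case: n n_gt0 => //= m _; rewrite eqxx. Qed.

Lemma goodb_pad M r : goodb (M ++ nseq r LA) = goodb M.
Proof.
elim: M => [|[] M /= ->] //; last by rewrite allows_A_pad.
by elim: r => //= r ->; rewrite (allows_A_pad [::]) allows_A_start.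
Qed.

Section Pairing.
Variables (V : idomainType) (F : word -> V) (N : nat).
Hypothesis V2 : (2 : V) != 0.
Hypothesis F_swap : forall M M', goodb M -> goodb M' -> ~~ allows_A M ->
  gaps M' = swap_last (gaps M) -> F M' = - F M.
Hypothesis F_long : forall M1 r, goodb (M1 ++ LB :: nseq r LA) ->
  (N <= size M1)%N -> F (M1 ++ LB :: nseq r LA) = 0.

Lemma partner_exists M : goodb M -> ~~ allows_A M ->
  exists2 M', goodb M' & gaps M' = swap_last (gaps M).
Proof.
move=> gM; have [b [a [w E]]] := gapsE n_gt0 M; rewrite allows_AE E /= => na.
apply: (regular_reached n_gt0); apply: regular_swap na.
by rewrite -E; apply: good_regular.
Qed.

Let G := [seq gaps M | M <- good_words N].

Let uniqG : uniq G.
Proof.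
rewrite map_inj_in_uniq ?uniq_good_words // => M M'.
rewrite !mem_good_words => /andP[gM /eqP sM] /andP[gM' /eqP sM'].
by apply: gaps_inj => //; rewrite sM.
Qed.

(** A partner that is not among the words of length [N] up to trailing letters
A has its last B beyond place [N], so that [F] vanishes on it. *)
Let unpaired M : M \in good_words N -> ~~ allows_A M -> swap_last (gaps M) \notin G -> F M = 0.
Proof.
rewrite mem_good_words => /andP[gM /eqP sM] bM nG.
have [M' gM' E] := partner_exists gM bM.
rewrite -[F M]opprK -(F_swap gM gM' bM E).
have noN M0 r : M' = M0 ++ nseq r LA -> (size M0 <= N)%N -> False.
  move=> M'E le0; case/negP: nG; rewrite -E M'E gaps_pad -(gaps_pad M0 (N - size M0)).
  apply: map_f; rewrite mem_good_words goodb_pad size_cat size_nseq subnKC // eqxx andbT.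
  by move: gM'; rewrite M'E goodb_pad.
have [[r M'E]|[M1 [r M'E]]] := trailing_A_cases M'; first by case: (noN [::] r).
have [lt|ge] := ltnP (size M1) N; last by rewrite M'E F_long ?oppr0 // -M'E.
by case: (noN (rcons M1 LB) r); rewrite ?cat_rcons ?size_rcons.
Qed.

(** The exchange is an involution on the lists whose partner is present, and it
changes the sign of the sum over them. *)
Lemma bad_sum0 : \sum_(M <- good_words N | ~~ allows_A M) F M = 0.
Proof.
rewrite (bigID (fun M => swap_last (gaps M) \in G)) /= [X in _ + X]big_seq_cond.
rewrite [X in _ + X]big1 ?addr0; last by move=> M /and3P[Mw bM nG]; apply: unpaired.
rewrite -big_filter; set T := seq.filter _ _.
pose F' r := F (nth [::] (good_words N) (index r G)).
have F'E M : M \in good_words N -> F' (gaps M) = F M.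
  move=> Mw; congr F; have iG : (index (gaps M) G < size (good_words N))%N.
    by rewrite -(size_map gaps) index_mem map_f.
  have := nth_index [::] (map_f gaps Mw); rewrite (nth_map [::]) //.
  move: (mem_nth [::] iG) Mw; rewrite !mem_good_words => /andP[g1 /eqP s1] /andP[g2 /eqP s2].
  by apply: gaps_inj => //; rewrite s1.
have inT M : M \in T -> [/\ M \in good_words N, ~~ allows_A M & swap_last (gaps M) \in G].
  by rewrite mem_filter => /andP[/andP[-> ->] ->].
have swT M : M \in T -> exists2 M', M' \in T & gaps M' = swap_last (gaps M).
  move=> /inT[Mw bM /mapP[M' M'w E]]; exists M' => //.
  rewrite mem_filter M'w andbT -E swap_lastK map_f // andbT.
  have := Mw; rewrite mem_good_words => /andP[/(good_regular n_gt0) + _].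
  have [b [a [w EM]]] := gapsE n_gt0 M; rewrite allows_AE -E EM /=.
  case/and4P=> [/eqP[sz] /= /andP[+ _] _ _]; rewrite sz => okbb; apply/eqP => bE.
  by move: okbb; rewrite bE /entry_ok /is_fin /=; lia.
have TE : \sum_(M <- T) F M = \sum_(r <- map gaps T) F' r.
  by rewrite big_map; apply: eq_big_seq => M /inT[/F'E].
have uT : uniq (map gaps T).
  by apply: subseq_uniq uniqG; apply/map_subseq/filter_subseq.
have pT : perm_eq (map swap_last (map gaps T)) (map gaps T).
  apply: uniq_perm => //; first by rewrite (map_inj_uniq (can_inj swap_lastK)).
  have sub r : r \in map gaps T -> swap_last r \in map gaps T.
    by move=> /mapP[M /swT[M' M'T E] ->]; rewrite -E; apply: map_f.
  move=> r; apply/mapP/idP => [[r' /sub r'T ->] //|/sub rT].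
  by exists (swap_last r); rewrite ?swap_lastK.
have X2 : \sum_(M <- T) F M = - \sum_(M <- T) F M.
  rewrite {1}TE -(perm_big _ pT) !big_map -sumrN; apply: eq_big_seq => M MT.
  have [M' M'T E] := swT M MT; have [Mw bM _] := inT M MT; have [M'w _ _] := inT M' M'T.
  rewrite -E F'E //; apply: F_swap => //.
    by move: Mw; rewrite mem_good_words => /andP[].
  by move: M'w; rewrite mem_good_words => /andP[].
apply: (mulfI V2); rewrite mulr0 mulr_natl mulr2n.
by rewrite {1}X2 addNr.
Qed.

End Pairing.

End GoodWords.

(** * Denominators of good words *)

Section PowerSeries.
Variable F : fieldType.
Implicit Types (f u : psqz F) (x y g : laurent).
Notation mon := (mon F).

Lemma nneg_monE x : nneg_mon x -> exists a b : nat, x = (a%:Z, b%:Z).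
Proof. by case: x => -[a|//] [b|//] _; exists a, b. Qed.

Lemma mon_nat (a b : nat) : mon (a%:Z, b%:Z) = psq ^+ a * psz ^+ b.
Proof. by []. Qed.

Lemma nneg_monD x y : nneg_mon x -> nneg_mon y -> nneg_mon (x + y).
Proof. rewrite /nneg_mon ?laurentE; lia. Qed.

Lemma nneg_subst x : nneg_mon x -> nneg_mon (subst_mon x).
Proof. rewrite /nneg_mon ?laurentE; lia. Qed.

Lemma monD x y : nneg_mon x -> nneg_mon y -> mon (x + y) = mon x * mon y.
Proof.
move=> /nneg_monE[a [b ->]] /nneg_monE[c [d ->]].
by rewrite -[(_, _) + _]/((a + c)%N%:Z, (b + d)%N%:Z) !mon_nat !exprD mulrACA.
Qed.

Lemma mon0 : mon 0 = 1. Proof. by rewrite mon_nat !expr0 mulr1. Qed.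

Lemma subst_mul_qn a f : subst_qz (psq ^+ a * f) = psq ^+ a * subst_qz f.
Proof. by rewrite subst_qzM subst_qzX subst_qzC. Qed.

Lemma subst_qz_mon x : nneg_mon x -> subst_qz (mon x) = mon (subst_mon x).
Proof.
move=> /nneg_monE[a [b ->]]; rewrite mon_nat subst_mul_qn subst_qzX subst_qz_z.
by rewrite /subst_mon /= -PoszD mon_nat exprD exprMn mulrA.
Qed.

Lemma ps_unit f : coefqz f 0 0 != 0 -> f \is a GRing.unit.
Proof. by move=> f0; rewrite !fps_unitE unitfE. Qed.

Lemma coefqz_mon00 x : nneg_mon x -> coefqz (mon x) 0 0 = (x == 0)%:R.
Proof. by case/nneg_monE => -[|a] [[|b] ->]; rewrite mon_nat coefqz_qn_zn. Qed.

Lemma one_minus_unit x : nneg_mon x -> x != 0 -> 1 - mon x \is a GRing.unit.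
Proof.
move=> nx x0; apply: ps_unit; rewrite /coefqz !coefsB.
have := coefqz_mon00 nx; rewrite /coefqz (negbTE x0) => ->.
by rewrite subr0 !coefs1 oner_eq0.
Qed.

Lemma subst_qzV f : f \is a GRing.unit -> subst_qz f^-1 = (subst_qz f)^-1.
Proof.
move=> uf; have E : subst_qz f^-1 * subst_qz f = 1.
  by rewrite -subst_qzM mulVr // subst_qzC.
have uS : subst_qz f \is a GRing.unit by apply/unitrPr; exists (subst_qz f^-1); rewrite mulrC.
by apply: (mulIr uS); rewrite E mulVr.
Qed.

Lemma qpoch_infS u : qpoch_inf u = (1 - u) * qpoch_inf (psq * u).
Proof.
apply: eq_mod_qP => m i j lt_im.
rewrite (@qpoch_infE _ _ m.+1) // 1?ltnW //.
have -> : qpoch u m.+1 = (1 - u) * qpoch (psq * u) m.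
  rewrite /qpoch big_ord_recl expr0 mul1r; congr (_ * _).
  by apply: eq_bigr => a _; rewrite mulrA -exprSr.
by apply: (@eq_mod_qM _ m) => // i' j' lt; rewrite (@qpoch_infE _ _ m).
Qed.

Lemma subst_qpoch_inf u : subst_qz (qpoch_inf u) = qpoch_inf (subst_qz u).
Proof.
apply: eq_mod_qP => m i j lt_im; rewrite (@qpoch_infE _ _ m) //.
have <- : subst_qz (qpoch u m) = qpoch (subst_qz u) m.
  rewrite /qpoch; elim: m {lt_im} => [|m IH]; first by rewrite !big_ord0 subst_qzC.
  by rewrite !big_ord_recr /= subst_qzM IH subst_qzB subst_qzC subst_mul_qn.
by apply: (@eq_mod_q_subst _ m) => // i' j' lt; rewrite (@qpoch_infE _ _ m).
Qed.

(** The factor of the denominator carried by a gap [g]: [(q)_t] when [g] is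
[q^t] and [(q^c z)_oo] when [g] is [q^(-c) z^(-1)]. *)
Definition gap_factor g : psqz F :=
  if is_fin g then qpoch psq `|g.1|%N else qpoch_inf (psq ^+ `|g.1|%N * psz).

Lemma gap_factor_unit g : gap_factor g \is a GRing.unit.
Proof.
rewrite /gap_factor; case: ifP => _.
  rewrite /qpoch; elim: `|g.1|%N => [|m IH]; first by rewrite big_ord0 unitr1.
  rewrite big_ord_recr /= unitrM IH -exprSr -[psq ^+ _]mulr1.
  by rewrite -(expr0 psz) -mon_nat one_minus_unit.
apply: ps_unit; rewrite (@qpoch_infE _ _ 1) // /qpoch big_ord1 expr0 mul1r.
rewrite -[psz]expr1 -mon_nat /coefqz !coefsB.
have := @coefqz_mon00 (`|g.1|%N%:Z, 1%:Z) isT; rewrite /coefqz => ->.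
by rewrite !coefs1 -pair_eqE /= /pair_eq /= andbF subr0 oner_eq0.
Qed.

Definition gap_ok g := if is_fin g then 0 <= g.1 else (g.2 == -1) && (g.1 <= 0).

Lemma subst_gap_factor g : gap_ok g -> subst_qz (gap_factor g) = gap_factor (subst_mon g).
Proof.
rewrite /gap_ok /gap_factor is_fin_subst; case: ifP => [/eqP g2 _|_ /andP[/eqP g2 g1]].
  rewrite /subst_mon g2 addr0 /= /qpoch; elim: `|g.1|%N => [|m IH].
    by rewrite !big_ord0 subst_qzC.
  by rewrite !big_ord_recr /= subst_qzM IH -exprSr subst_qzB subst_qzX !subst_qzC.
rewrite subst_qpoch_inf subst_mul_qn subst_qz_z mulrA -exprSr /subst_mon g2 /=.
by have -> : `|(g.1 + -1)%R|%N = `|g.1|%N.+1 by lia.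
Qed.

Definition gap_abs g : laurent := if is_fin g then g else - g.

Lemma gap_abs_nneg g : gap_shape g -> nneg_mon (gap_abs g) /\ gap_abs g != 0.
Proof.
rewrite /gap_shape /gap_abs; case: ifP => [/eqP g2 g1|_ /andP[/eqP g2 g1]].
  split; first by rewrite /nneg_mon g2; lia.
  by apply/eqP => E; move: g1; rewrite E.
split; first by rewrite /nneg_mon ?laurentE g2; lia.
by apply/eqP => /(congr1 snd); rewrite ?laurentE g2.
Qed.

(** Increasing a gap by one multiplies its factor by one minus a monomial, for
[(q)_t] as well as for [(q^c z)_oo], where [c] decreases. *)
Lemma gap_factorS g : gap_shape g ->
  gap_factor g = gap_factor (g - qn_mon 1) * (1 - mon (gap_abs g)).
Proof.
rewrite /gap_shape /gap_factor is_fin_sub /gap_abs; case: ifP => [/eqP g2 g1|_ /andP[/eqP g2 g1]].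
  set m := `|(g - qn_mon 1)%R.1|%N.
  have gE : g = (m.+1%:Z, 0%:Z) by apply: laurent_ext; rewrite // /m ?laurentE; lia.
  by rewrite {2}gE mon_nat mulr1 gE /= /qpoch big_ord_recr /= exprSr.
have -> : - g = (`|g.1|%N%:Z, 1%:Z) by apply: laurent_ext; rewrite ?laurentE ?g2 //=; lia.
rewrite qpoch_infS mulrA -exprS mulrC mon_nat expr1.
by have -> : `|(g - qn_mon 1)%R.1|%N = `|g.1|%N.+1 by rewrite ?laurentE; lia.
Qed.

Lemma inv_one_minusA g : gap_shape g ->
  inv_one_minus F (- g) * gap_factor g =
  (-1) ^+ is_fin g * mon (numer_stepA g) * gap_factor (g - qn_mon 1).
Proof.
move=> shg; rewrite (gap_factorS shg) mulrCA mulrA [RHS]mulrC -mulrA; congr (_ * _).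
have [nn nz] := gap_abs_nneg shg; have U := one_minus_unit nn nz.
move: shg nn U; rewrite /gap_shape /gap_abs /numer_stepA /inv_one_minus; case: ifP.
  move=> /eqP g2 g1 nn U; rewrite ifF; last by rewrite ?laurentE g2; lia.
  by rewrite opprK expr1 mulN1r mulrVK.
move=> _ /andP[/eqP g2 g1] nn U; rewrite ifT; last by rewrite ?laurentE g2; lia.
by rewrite mulVr // mon0 expr0 mulr1.
Qed.

Lemma inv_one_minusB g : gap_shape g ->
  inv_one_minus F g * gap_factor g =
  (-1) ^+ (~~ is_fin g) * mon (numer_stepB g) * gap_factor (g - qn_mon 1).
Proof.
move=> shg; rewrite (gap_factorS shg) mulrCA mulrA [RHS]mulrC -mulrA; congr (_ * _).
have [nn nz] := gap_abs_nneg shg; have U := one_minus_unit nn nz.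
move: shg nn U; rewrite /gap_shape /gap_abs /numer_stepB /inv_one_minus; case: ifP.
  move=> /eqP g2 g1 nn U; rewrite ifT; last by rewrite ?laurentE g2; lia.
  by rewrite mulVr // mon0 expr0 mulr1.
move=> _ /andP[/eqP g2 g1] nn U; rewrite ifF; last by rewrite ?laurentE g2; lia.
by rewrite expr1 mulN1r mulrVK.
Qed.

Fixpoint gap_den (r : seq laurent) : psqz F :=
  if r is b :: w then gap_factor (gap b w) * gap_den w else 1.

Fixpoint gap_den_subst (r : seq laurent) : psqz F :=
  if r is b :: w then gap_factor (subst_mon (gap b w)) * gap_den_subst w else 1.

Lemma gap_den_cons b w : gap_den (b :: w) = gap_factor (gap b w) * gap_den w.
Proof. by []. Qed.

Lemma gap_den_subst_cons b w :
  gap_den_subst (b :: w) = gap_factor (subst_mon (gap b w)) * gap_den_subst w.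
Proof. by []. Qed.

Lemma gap_den_unit r : gap_den r \is a GRing.unit.
Proof. by elim: r => [|b w IH] /=; rewrite ?unitr1 // unitrM gap_factor_unit. Qed.
Lemma gap_den_subst_unit r : gap_den_subst r \is a GRing.unit.
Proof. by elim: r => [|b w IH] /=; rewrite ?unitr1 // unitrM gap_factor_unit. Qed.

Lemma gap_den_turn w c :
  gap_den (rcons (map incr w) (incr c)) = gap_factor (subst_mon c) * gap_den_subst w.
Proof.
elim: w => [|b w IH] /=.
  by have -> : gap (incr c) [::] = subst_mon c by rewrite /gap; laurent_lia.
have -> : gap (incr b) (rcons (map incr w) (incr c)) = subst_mon (gap b w).
  by rewrite /gap size_rcons size_map; laurent_lia.
by rewrite IH; exact: mulrCA.
Qed.

Fixpoint gaps_ok (r : seq laurent) : bool :=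
  if r is b :: w then gap_ok (gap b w) && gaps_ok w else true.

Lemma subst_gap_den r : gaps_ok r -> subst_qz (gap_den r) = gap_den_subst r.
Proof.
elim: r => [|b w IH] /=; first by rewrite subst_qzC.
by case/andP => /subst_gap_factor E /IH E'; rewrite subst_qzM E E'.
Qed.

Lemma entries_ok_gaps_ok0 w : entries_ok w -> (gap_total w).2 = 0 -> gaps_ok w.
Proof.
elim: w => [//|b w IH] /= /andP[okbb okw] E; have [le0 _] := entries_ok_total okw.
rewrite IH ?andbT //; move: okbb E; rewrite /entry_ok /gap_ok /gap /is_fin ?laurentE;
  last by lia.
by case: ifP; lia.
Qed.

Lemma entries_ok_gaps_ok w : entries_ok w -> (gap_total w).2 = -1 ->
  (gap_total w).1 <= 0 -> gaps_ok w.
Proof.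
elim: w => [//|b w IH] /= /andP[okbb okw] E1 E2; have [le0 ge0] := entries_ok_total okw.
move: okbb E1 E2; rewrite /entry_ok /gap_ok /gap is_fin_sub ?laurentE.
case: ifP => [/eqP b2|_]; rewrite ?b2 => ob E1 E2.
  by rewrite IH ?andbT; lia.
by rewrite entries_ok_gaps_ok0 ?andbT //; lia.
Qed.

(** As the total is [z^(-1)], the infinite gap is [q^(-c) z^(-1)] with [c] the
sum of the other gaps, hence nonnegative. *)
Lemma regular_gaps_ok n r : regular n r -> gaps_ok r.
Proof. by case/and4P => _ okr /eqP tr _; apply: entries_ok_gaps_ok; rewrite ?tr. Qed.

End PowerSeries.

(** * The operators on good words *)

Lemma frac_step (R : comUnitRingType) (s m d e i s' m' d' : R) :
  d \is a GRing.unit -> e \is a GRing.unit -> d' \is a GRing.unit ->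
  i * d' = s' * m' * d ->
  s * m / (d * e) * i = s * s' * (m * m') / (d' * e).
Proof.
move=> ud ue ud' E; have ude : d * e \is a GRing.unit by rewrite unitrM ud.
have ud'e : d' * e \is a GRing.unit by rewrite unitrM ud'.
apply: (mulIr ud'e); rewrite mulrVK //.
have V : (d * e)^-1 * (d * e) = 1 by rewrite mulVr.
transitivity (s * m * (d * e)^-1 * (i * d') * e); first by ring.
rewrite E; transitivity (s * m * s' * m' * ((d * e)^-1 * (d * e))); first by ring.
by rewrite V; ring.
Qed.

Section Operators.
Variables (F : fieldType) (n : nat).
Hypothesis n_gt0 : (0 < n)%N.
Notation nZ := (n%:Z).
Notation gaps := (gaps n).
Notation goodb := (goodb n).
Notation allows_A := (allows_A n).
Notation first_pt := (first_pt n).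
Notation numer := (numer n).
Notation flips := (flips n).
Notation next_gap := (next_gap n).
Notation mon := (mon F).

Definition numer_over_den (M : word) : psqz F :=
  (-1) ^+ flips M * mon (numer M) / gap_den F (gaps M).

Definition points (M : word) : seq laurent := rev (points_from (first_pt M) (gaps M)).

(** The coefficient and the points of [A M v_oo] for a good word [M], whether or
not [A M] is good. *)
Definition numer_over_denA (M : word) : psqz F :=
  (-1) ^+ (flips M + is_fin (next_gap M)) *
  mon (subst_mon (numer M) + numer_stepA (next_gap M)) /
  (gap_factor F (next_gap M) * gap_den_subst F (behead (gaps M))).

Definition pointsA (M : word) : seq laurent :=
  rev (rcons [seq subst_mon y | y <- points_from (first_pt M) (behead (gaps M))]
    (subst_mon (first_pt M))).

Lemma subst_qz_sign k : subst_qz ((-1) ^+ k : psqz F) = (-1) ^+ k.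
Proof.
rewrite subst_qzX; congr (_ ^+ _).
by rewrite -[X in subst_qz X]sub0r subst_qzB subst_qz0 subst_qzC sub0r.
Qed.

Lemma subst_numer_over_den M : goodb M ->
  subst_qz (numer_over_den M) = (-1) ^+ flips M * mon (subst_mon (numer M)) /
    (gap_factor F (next_gap M - qn_mon 1) * gap_den_subst F (behead (gaps M))).
Proof.
move=> gM; rewrite /numer_over_den !subst_qzM subst_qz_sign subst_qz_mon; last exact: numer_ge0.
rewrite (subst_qzV (gap_den_unit F _)) subst_gap_den; last first.
  by apply: regular_gaps_ok; apply: good_regular gM.
have [b [a [w E]]] := gapsE n_gt0 M.
have := size_gaps n M; rewrite next_gapE E => -[sz].
have -> : subst_mon (head 0 [:: b, a & w] - qn_mon nZ) - qn_mon 1 =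
    subst_mon (gap b (a :: w)) by rewrite /gap /= -sz; laurent_lia.
by [].
Qed.

Lemma numer_stepA_correct M : goodb M ->
  subst_qz (numer_over_den M) * inv_one_minus F (- next_gap M) = numer_over_denA M.
Proof.
move=> gM; have shg := next_gap_shape n_gt0 gM.
rewrite (subst_numer_over_den gM) /numer_over_denA exprD monD.
- apply: frac_step (gap_factor_unit F _) (gap_den_subst_unit F _) (gap_factor_unit F _) _.
  exact: inv_one_minusA.
- exact/nneg_subst/numer_ge0.
- move: shg; rewrite /gap_shape /numer_stepA; case: ifP => // /eqP g2 g1.
  by rewrite /nneg_mon g2; lia.
Qed.

Lemma numer_stepB_correct M : goodb M ->
  subst_qz (numer_over_den M) * inv_one_minus F (next_gap M) = numer_over_den (LB :: M).
Proof.
move=> gM; have shg := next_gap_shape n_gt0 gM.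
have [b [w [E EB]]] := gapsB n_gt0 M.
have -> : numer_over_den (LB :: M) = (-1) ^+ (flips M + ~~ is_fin (next_gap M)) *
    mon (subst_mon (numer M) + numer_stepB (next_gap M)) /
    (gap_factor F (next_gap M) * gap_den_subst F (behead (gaps M))).
  have <- : subst_mon (b - qn_mon nZ) = next_gap M by rewrite next_gapE E.
  rewrite /numer_over_den EB gap_den_turn [X in behead X]E.
  by have -> : subst_mon (b - qn_mon nZ) = next_gap M by rewrite next_gapE E.
rewrite (subst_numer_over_den gM) exprD monD.
- apply: frac_step (gap_factor_unit F _) (gap_den_subst_unit F _) (gap_factor_unit F _) _.
  exact: inv_one_minusB.
- exact/nneg_subst/numer_ge0.
- move: shg; rewrite /gap_shape /numer_stepB; case: ifP => // _ /andP[/eqP g2 g1].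
  by rewrite /nneg_mon oppL1 oppL2 g2; lia.
Qed.

Lemma gap_factor0 : gap_factor F 0 = 1.
Proof. by rewrite /gap_factor /= /qpoch big_ord0. Qed.

(** When [A M] is good, the gap at position [n] is trivial and contributes no
factor, so that the increased last gap simply takes its place. *)
Lemma numer_over_denA_good M : goodb (LA :: M) -> numer_over_denA M = numer_over_den (LA :: M).
Proof.
move=> gM; have [b [w [E EA]]] := gapsA n_gt0 gM.
have := size_gaps n M; rewrite E => -[sz].
have nE : subst_mon (gap b w) = next_gap M.
  by rewrite next_gapE E /gap -sz.
have aE : subst_mon (gap (qn_mon nZ) w) = 0 by rewrite /gap -sz; laurent_lia.
rewrite /numer_over_den.
have -> : gap_den F (gaps (LA :: M)) =
    gap_factor F (next_gap M) * gap_den_subst F (behead (gaps M)).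
  rewrite EA (_ : qn_mon 1 = incr 0) // gap_den_turn subst_mon0 gap_factor0 mul1r.
  by rewrite [X in behead X]E -nE !gap_den_subst_cons aE gap_factor0 mul1r.
by [].
Qed.

Lemma pointsE M b w : gaps M = b :: w ->
  points M = rcons (rev (points_from (first_pt M) w)) (first_pt M + gap_total w).
Proof. by move=> E; rewrite /points E /= rev_cons. Qed.

Lemma P_points M b w : goodb M -> gaps M = b :: w ->
  [/\ P_ (points M) 1 = first_pt M, P_ (points M) n.+1 = first_pt M + gap_total w &
      take n (points M) = rev (points_from (first_pt M) w)].
Proof.
move=> gM E; have szp : size (points M) = n.+1.
  by rewrite size_rev size_points_from size_gaps.
have [-> ->] := take_shape (pointsE E) szp; split => //.
rewrite /P_ /= nth_rev; last by rewrite size_points_from size_gaps.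
by rewrite subn1 nth_last last_points_from // E.
Qed.

Lemma gap_total_behead M b w : goodb M -> gaps M = b :: w ->
  gap_total w = zn_mon (-1) - b + qn_mon n.+1.
Proof.
move=> gM E; have := good_regular n_gt0 gM; rewrite E.
case/and4P => /eqP[sz] _ /eqP <- _ /=; rewrite /gap sz; laurent_lia.
Qed.

Lemma points_B M b w : goodb M -> gaps M = b :: w ->
  [seq subst_mon x |
    x <- qn_mon (-1) + zn_mon 1 + (first_pt M + gap_total w) :: rev (points_from (first_pt M) w)] =
  points (LB :: M).
Proof.
move=> gM E; rewrite /points (points_from_B n_gt0 E) rev_rcons map_cons map_rev; congr (_ :: _).
by rewrite [first_pt (_ :: _)]/= E (gap_total_behead gM E) [head _ _]/=; laurent_lia.
Qed.

Variables (A B : vfun F n.+1 -> vfun F n.+1).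
Hypotheses (hA : is_opA A) (hB : is_opB B).

Lemma opA_good M : goodb M -> admissible n.+1 (points M) ->
  A (term (numer_over_den M) (points M)) = term (numer_over_denA M) (pointsA M).
Proof.
move=> gM adm; have [b [a [w E]]] := gapsE n_gt0 M.
rewrite (proj2 hA _ _ adm) -(numer_stepA_correct gM).
have [P1 Pl Pt] := P_points gM E; rewrite P1 Pl [take _ _]Pt.
have -> : subst_mon (qn_mon (-1) + zn_mon 1 + (first_pt M + gap_total (a :: w)) - first_pt M) =
    - next_gap M.
  by rewrite (gap_total_behead gM E) next_gapE E [head _ _]/=; laurent_lia.
have -> // : [seq subst_mon x | x <- first_pt M :: rev (points_from (first_pt M) (a :: w))] =
  pointsA M.
by rewrite /pointsA rev_rcons E [behead _]/= map_cons map_rev.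
Qed.

Lemma opB_good M : goodb M -> admissible n.+1 (points M) ->
  B (term (numer_over_den M) (points M)) = term (numer_over_den (LB :: M)) (points (LB :: M)).
Proof.
move=> gM adm; have [b [w [E EB]]] := gapsB n_gt0 M.
rewrite (proj2 hB _ _ adm) -(numer_stepB_correct gM).
have [P1 Pl Pt] := P_points gM E; rewrite P1 Pl [take _ _]Pt.
have -> : subst_mon (qn_mon 1 + zn_mon (-1) + first_pt M - (first_pt M + gap_total w)) =
    next_gap M.
  by rewrite (gap_total_behead gM E) next_gapE E [head _ _]/=; laurent_lia.
by rewrite (points_B gM E).
Qed.

(** The recursive description of a good word computes [M v_oo]. *)
Lemma act_good M : goodb M ->
  act A B M (@v_inf F n.+1) = term (numer_over_den M) (points M) /\
  admissible n.+1 (points M).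
Proof.
elim: M => [|c M IH] gM.
  have DB m : gap_den F (base_entries m) = 1.
    by elim: m => //= m ->; rewrite /gap size_base subrr gap_factor0 mulr1.
  have PB m : points_from 0 (base_entries m) = nseq m 0.
    by elim: m => //= m ->; rewrite gap_total_base addr0.
  have PE : points [::] = nseq n.+1 0.
    by rewrite /points [points_from _ _]/= PB gap_total_base addr0 -[0 :: _]/(nseq n.+1 0) rev_nseq.
  rewrite PE; split; last exact: admissible0.
  have -> : numer_over_den [::] = (qpoch_inf psz)^-1.
    rewrite /numer_over_den expr0 mul1r [mon _]mon0 mul1r.
    rewrite -[gaps [::]]/(start n) /start gap_den_cons DB mulr1.
    have -> : gap (n.+1%:Z, -1) (base_entries n) = (0, -1).
      by rewrite /gap size_base; laurent_lia.
    by rewrite /gap_factor /= expr0 mul1r.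
  by [].
have gM1 : goodb M by case: c gM => //= /andP[].
have [E adm] := IH gM1.
have -> : act A B (c :: M) (@v_inf F n.+1) =
    (if c is LA then A else B) (act A B M (@v_inf F n.+1)) by case: (c).
rewrite E; case: c gM => gM.
  have PA : points (LA :: M) = pointsA M.
    have [b [w [EM _]]] := gapsA n_gt0 gM.
    by rewrite /points (points_from_A EM) /pointsA EM.
  rewrite (opA_good gM1 adm) -(numer_over_denA_good gM) PA; split; first exact: erefl.
  have [b [a [w EM]]] := gapsE n_gt0 M.
  have := opA_admissible (ltn0Sn n) adm; have [-> _ Pt] := P_points gM1 EM.
  by rewrite [take _ _]Pt /pointsA EM rev_rcons map_cons map_rev.
rewrite (opB_good gM1 adm); split; first exact: erefl.
have [b [w [EM EB]]] := gapsB n_gt0 M.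
have := opB_admissible (ltn0Sn n) adm; have [_ -> Pt] := P_points gM1 EM.
have <- // : [seq subst_mon x |
    x <- qn_mon (-1) + zn_mon 1 + (first_pt M + gap_total w) :: take n.+1.-1 (points M)] =
  points (LB :: M).
by rewrite [take _ _]Pt (points_B gM1 EM).
Qed.

Lemma termE f P p : @term F n.+1 f P p = f * bracket F P p.
Proof. by []. Qed.

Lemma act_A M : goodb M ->
  act A B (LA :: M) (@v_inf F n.+1) = term (numer_over_denA M) (pointsA M).
Proof.
move=> gM; have [E adm] := act_good gM.
have -> : act A B (LA :: M) (@v_inf F n.+1) = A (act A B M (@v_inf F n.+1)) by [].
rewrite E; exact: opA_good gM adm.
Qed.

(** The denominator of [A M v_oo] contains the factors of the gap at position
[n] and of the increased last gap, and the exchange interchanges these. *)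
Lemma act_swap M M' p : goodb M -> goodb M' -> gaps M' = swap_last (gaps M) ->
  act A B (LA :: M') (@v_inf F n.+1) p = - act A B (LA :: M) (@v_inf F n.+1) p.
Proof.
move=> gM gM' E'; have [b [a [w E]]] := gapsE n_gt0 M; rewrite E /= in E'.
rewrite (act_A gM) (act_A gM').
have [px nE [k kE]] := partner_numer n_gt0 gM gM' E E'.
have szw := size_gaps n M; rewrite E /= in szw; case: szw => szw.
have gM1 : next_gap M = subst_mon (gap b w) by rewrite next_gapE E /gap szw.
have gM1' : next_gap M' = subst_mon (gap a w) by rewrite next_gapE E' /gap szw.
have -> : pointsA M' = pointsA M by rewrite /pointsA px E E'.
have D1 : gap_den_subst F (behead (gaps M)) = gap_factor F (next_gap M') * gap_den_subst F w.
  rewrite E gM1'; exact: gap_den_subst_cons.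
have D2 : gap_den_subst F (behead (gaps M')) = gap_factor F (next_gap M) * gap_den_subst F w.
  rewrite E' gM1; exact: gap_den_subst_cons.
have sE : (-1) ^+ (flips M' + is_fin (next_gap M')) =
    - (-1) ^+ (flips M + is_fin (next_gap M)) :> psqz F.
  rewrite -signr_odd -[in RHS]signr_odd.
  have -> : odd (flips M + is_fin (next_gap M)) = ~~ odd (flips M' + is_fin (next_gap M')).
    by move: kE; lia.
  by case: odd; rewrite ?expr0 ?expr1 ?opprK.
suff -> : numer_over_denA M' = - numer_over_denA M by rewrite !termE mulNr.
rewrite /numer_over_denA nE D1 D2 sE -!mulNr [X in _ = _ / X]mulrCA; exact: erefl.
Qed.

Lemma coefqz_mon (s d h : psqz F) (x : laurent) i j : nneg_mon x ->
  (i%:Z < x.1) || (j%:Z < x.2) -> coefqz (s * mon x / d * h) i j = 0.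
Proof.
case/nneg_monE => a [c ->] ij; have {}ij : (i < a)%N || (j < c)%N by move: ij => /=; lia.
rewrite mon_nat [s * _]mulrC -!mulrA coefqz_qnM.
by case: ltnP => // le; rewrite coefqz_znM ifT //; move: ij; lia.
Qed.

Lemma act_order M1 r p i j : let M := M1 ++ LB :: nseq r LA in
  goodb M -> (i < size M1)%N || (j == 0%N) ->
  coefqz (act A B M (@v_inf F n.+1) p) i j = 0.
Proof.
move=> M gM ij; have [-> _] := act_good gM.
have /andP[g1 g2] := numer_growth n_gt0 gM.
rewrite termE; apply: coefqz_mon; first exact: (numer_ge0 n_gt0 gM).
by move: g1 g2 ij; rewrite -/M; lia.
Qed.

Lemma actA_order M1 r p i j : let M := M1 ++ LB :: nseq r LA in
  goodb M -> (i < size M1)%N ->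
  coefqz (act A B (LA :: M) (@v_inf F n.+1) p) i j = 0.
Proof.
move=> M gM ij; rewrite (act_A gM).
have /andP[g1 g2] := numer_growth n_gt0 gM.
have shg := next_gap_shape n_gt0 gM.
have [k1 k2] : 0 <= (numer_stepA (next_gap M)).1 /\ 0 <= (numer_stepA (next_gap M)).2.
  by move: shg; rewrite /gap_shape /numer_stepA /is_fin; case: ifP => // /eqP -> ; lia.
rewrite termE; apply: coefqz_mon.
  by rewrite /nneg_mon !laurentE -/M; move: g1 g2 k1 k2; rewrite -/M; lia.
by rewrite !laurentE; move: g1 g2 k1 k2 ij; rewrite -/M; lia.
Qed.

Lemma gap_den_form w : gaps_ok w -> exists ts cs : seq nat,
  [/\ (size ts + size cs)%N = size w,
      gap_den F w = (\prod_(t <- ts) qpoch psq t) *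
                \prod_(c <- cs) qpoch_inf (psq ^+ c * psz),
      (gap_total w).1 = (\sum_(t <- ts) t)%N%:Z - (\sum_(c <- cs) c)%N%:Z &
      (gap_total w).2 = - (size cs)%:Z].
Proof.
elim: w => [_|b w IH]; first by exists [::], [::]; rewrite /= !big_nil mulr1.
move=> /andP[okg /IH[ts [cs [sz DE t1 t2]]]] {IH}.
rewrite gap_den_cons DE.
move: okg; rewrite /gap_ok /gap_factor; case: ifP => [/eqP g2 g1|_ /andP[/eqP g2 g1]].
  exists (`|(gap b w).1|%N :: ts), cs; split.
  - by rewrite /= addSn sz.
  - rewrite big_cons; exact: mulrA.
  - rewrite big_cons addL1 t1; move: g1; lia.
  - by rewrite addL2 t2 g2 addr0.
exists ts, (`|(gap b w).1|%N :: cs); split.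
- by rewrite /= addnS sz.
- rewrite big_cons; exact: mulrCA.
- rewrite big_cons addL1 t1; move: g1; lia.
- by rewrite addL2 t2 g2 /=; lia.
Qed.

Lemma bracket_mon P (p : params n.+1) : (forall i, nneg_mon (P_ P i)) ->
  exists c d : nat, bracket F P p = psq ^+ c * psz ^+ d.
Proof.
move=> nP; rewrite /bracket; elim/big_ind: _ => [|u v [c [d ->]] [c' [d' ->]]|i _].
- by exists 0%N, 0%N; rewrite !expr0 mulr1.
- by exists (c + c')%N, (d + d')%N; rewrite !exprD mulrACA.
have [c [d ->]] := nneg_monE (nP i.+1); rewrite mon_nat exprMn -!exprM.
by exists (c * expo p i)%N, (d * expo p i)%N.
Qed.

(** The finite gaps are the [t_i]; the infinite one is [q^(-c) z^(-1)] with [c]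
their sum, because the total of all gaps is [z^(-1)]. *)
Lemma act_form M p : goodb M -> exists (alpha beta gamma : nat) (t : n.-tuple nat),
  act A B M (@v_inf F n.+1) p =
  (-1) ^+ alpha * psq ^+ beta * psz ^+ gamma /
  (\prod_(i < n) qpoch psq (tnth t i) *
   qpoch_inf (psq ^+ (\sum_(i < n) tnth t i)%N * psz)).
Proof.
move=> gM; have [-> adm] := act_good gM.
have reg := good_regular n_gt0 gM.
have [ts [cs [sz DE t1 t2]]] := gap_den_form (regular_gaps_ok reg).
have /and4P[/eqP szg _ /eqP tr _] := reg.
case: cs => [|c [|c' cs]] in sz DE t1 t2; [by rewrite tr in t2| |by rewrite tr in t2].
have szt : size ts == n by move: sz; rewrite szg /= addn1 => -[->].
have [e [d bE]] := bracket_mon p (fun i => admissible_nneg i adm).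
have [a [a' nE]] := nneg_monE (numer_ge0 n_gt0 gM).
exists (flips M), (a + e)%N, (a' + d)%N, (Tuple szt).
have -> : \prod_(i < n) qpoch psq (tnth (Tuple szt) i) = \prod_(t <- ts) qpoch psq t :> psqz F.
  by rewrite [RHS](big_tuple _ _ (Tuple szt)).
have -> : (\sum_(i < n) tnth (Tuple szt) i = \sum_(t <- ts) t)%N.
  by rewrite [RHS](big_tuple _ _ (Tuple szt)).
rewrite termE bE /numer_over_den nE mon_nat DE big_seq1.
have -> : c = (\sum_(t <- ts) t)%N by move: t1; rewrite tr big_seq1 /=; lia.
set D := _^-1; rewrite !exprD; ring.
Qed.

End Operators.

(** * The recursion on the first entry *)

(** A geometric sum split into its two boundary terms. *)
Lemma geometric_split (R : idomainType) (x y i i' : R) e : x - y != 0 ->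
  i * (x - y) = x -> i' * (x - y) = - y ->
  i * x ^+ e + i' * y ^+ e = \sum_(a < e.+1) x ^+ (e - a) * y ^+ a.
Proof.
move=> nxy E E'; apply: (mulIf nxy); rewrite [RHS]mulrC -[RHS]/((x - y) * _).
transitivity (x ^+ e.+1 - y ^+ e.+1); last exact: subrXX.
transitivity (i * (x - y) * x ^+ e + i' * (x - y) * y ^+ e); first by ring.
by rewrite E E' !exprS mulNr.
Qed.

Lemma geometric_factor (R : comPzRingType) (i i' x h : R) :
  i * (1 - h) = 1 -> i' * (1 - h) = - h ->
  i * (x - x * h) = x /\ i' * (x - x * h) = - (x * h).
Proof.
move=> E E'; split.
  by transitivity (x * (i * (1 - h))); [ring|rewrite E mulr1].
by transitivity (x * (i' * (1 - h))); [ring|rewrite E' mulrN].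
Qed.

Lemma prod_ord_first2 (R : comPzRingType) (G : nat -> R) m :
  \prod_(j < m.+2) G j = G 0%N * (G 1%N * \prod_(j < m) G j.+2).
Proof. by rewrite !big_ord_recl. Qed.

Lemma prod_ord_ends (R : comPzRingType) (G : nat -> R) m :
  \prod_(j < m.+2) G j = G 0%N * \prod_(j < m) G j.+1 * G m.+1.
Proof. by rewrite big_ord_recl big_ord_recr mulrA. Qed.

Section Recursion.
Variables (F : fieldType) (m : nat).
Notation n := m.+1.
Notation l := m.+2.
Notation mon := (mon F).

Definition bound (p : params l) (j : nat) : nat := nth 0%N (rcons (par_b p) (par_k p)) j.

Lemma size_bounds (p : params l) : size (rcons (par_b p) (par_k p)) = l.
Proof. by rewrite size_rcons size_tuple. Qed.

Lemma bound_last p : bound p n = par_k p.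
Proof. by rewrite /bound nth_rcons size_tuple ltnn eqxx. Qed.

Lemma bound_mono p i j : (i <= j)%N -> (j <= n)%N -> (bound p i <= bound p j)%N.
Proof.
move=> ij jn; apply: (sorted_leq_nth leq_trans leqnn 0%N (par_sorted p)) => //;
  by rewrite inE size_bounds ltnS //; apply: leq_trans jn.
Qed.

Definition shift_bounds (p : params l) (i : nat) : l.-1.-tuple nat :=
  [tuple (bound p j.+1 - i)%N | j < l.-1].

Lemma shift_sorted p i : sorted leq (rcons (shift_bounds p i) (par_k p)).
Proof.
apply/(sortedP 0%N) => j; rewrite size_rcons size_tuple => jn1.
have jn : (j < l.-1)%N by rewrite -ltnS.
have nthE a : (a < l.-1)%N ->
    nth 0%N (rcons (shift_bounds p i) (par_k p)) a = (bound p a.+1 - i)%N.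
  move=> an; rewrite nth_rcons size_tuple an.
  by rewrite -[a]/(val (Ordinal an)) -tnth_nth tnth_mktuple.
rewrite nthE //; case: (ltnP j.+1 l.-1) => [jn'|nj].
  by rewrite nthE //; apply/leq_sub2r/bound_mono.
have -> : j.+1 = l.-1 by apply/eqP; rewrite eqn_leq nj jn.
by rewrite nth_rcons size_tuple ltnn eqxx bound_last leq_subr.
Qed.

(** The parameters of the configurations that remain after [x_0 = i]. *)
Definition shift_params (p : params l) (i : nat) : params l :=
  Params (par_k_gt0 p) (shift_sorted p i).

Lemma bound_shift p i j : (j < n)%N -> bound (shift_params p i) j = (bound p j.+1 - i)%N.
Proof.
move=> jn; rewrite {1}/bound nth_rcons size_tuple jn.
by rewrite -[j]/(val (Ordinal (jn : (j < l.-1)%N))) -tnth_nth tnth_mktuple.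
Qed.

Lemma expoE p j : expo p j.+1 = (bound p j.+1 - bound p j)%N.
Proof. by []. Qed.

Lemma expo0 p : expo p 0 = bound p 0.
Proof. by rewrite /expo /bound /= subn0. Qed.

Lemma expo_shift0 p i : (i <= bound p 0)%N ->
  expo (shift_params p i) 0 = (expo p 0 - i + expo p 1)%N.
Proof.
move=> ib; rewrite !expo0 bound_shift // expoE.
have := @bound_mono p 0 1 isT isT; lia.
Qed.

Lemma expo_shiftS p i j : (i <= bound p 0)%N -> (j.+1 < n)%N ->
  expo (shift_params p i) j.+1 = expo p j.+2.
Proof.
move=> ib jn; rewrite !expoE !bound_shift //; last exact: ltnW.
have := @bound_mono p 0 j.+1 isT (ltnW jn); lia.
Qed.

Lemma expo_shift_last p i : (i <= bound p 0)%N -> expo (shift_params p i) n = i.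
Proof.
move=> ib; rewrite expoE bound_last bound_shift // bound_last.
have := @bound_mono p 0 n isT (leqnn _); rewrite bound_last.
by rewrite -[par_k (shift_params p i)]/(par_k p); lia.
Qed.

Definition Phi (H : vfun F l) : vfun F l := fun p =>
  \sum_(i < (bound p 0).+1) psz ^+ i * subst_qz (H (shift_params p i)).

Lemma subst_qz_sum I (r : seq I) (G : I -> psqz F) :
  subst_qz (\sum_(i <- r) G i) = \sum_(i <- r) subst_qz (G i).
Proof. by elim: r => [|i r IH]; rewrite ?big_nil ?subst_qz0 // !big_cons subst_qzD IH. Qed.

Lemma Phi_sum I (r : seq I) (H : I -> vfun F l) p :
  Phi (fun p => \sum_(x <- r) H x p) p = \sum_(x <- r) Phi (H x) p.
Proof.
rewrite /Phi [RHS]exchange_big; apply: eq_bigr => i _ /=.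
by rewrite subst_qz_sum mulr_sumr.
Qed.

Lemma coefqz_Phi H p i j : coefqz (Phi H p) i j =
  \sum_(a < (bound p 0).+1) (if (j < a)%N || (i < j - a)%N then 0
     else coefqz (H (shift_params p a)) (i - (j - a)) (j - a)).
Proof.
rewrite /Phi /coefqz !coefs_sum; apply: eq_bigr => a _.
rewrite -/(coefqz _ i j) coefqz_znM coefqz_subst.
by case: ltnP => //= _; case: ltnP.
Qed.

Lemma inv_one_minus_nneg h : nneg_mon h -> h != 0 ->
  inv_one_minus F h * (1 - mon h) = 1 /\ inv_one_minus F (- h) * (1 - mon h) = - mon h.
Proof.
move=> nh h0; have U := one_minus_unit F nh h0; split.
  by rewrite /inv_one_minus ifT // mulVr.
rewrite /inv_one_minus ifF; last first.
  apply/negP => nnh; case/eqP: h0; move: nh nnh; rewrite /nneg_mon !laurentE => nh nnh.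
  by apply: laurent_ext; rewrite ?laurentE; lia.
by rewrite opprK mulrVK.
Qed.

Lemma geometric x y e : nneg_mon x -> nneg_mon y -> gap_shape (x - y) ->
  inv_one_minus F (y - x) * mon x ^+ e + inv_one_minus F (x - y) * mon y ^+ e =
  \sum_(i < e.+1) mon x ^+ (e - i) * mon y ^+ i.
Proof.
move=> nx ny sh; have [nn nz] := gap_abs_nneg sh.
have [E1 E2] := inv_one_minus_nneg nn nz.
have nxy : mon x - mon y != 0.
  rewrite subr_eq0; apply/eqP => /(mon_inj nx ny) E; case/eqP: nz.
  by rewrite E subrr /gap_abs /is_fin eqxx.
suff [H1 H2] : inv_one_minus F (y - x) * (mon x - mon y) = mon x /\
               inv_one_minus F (x - y) * (mon x - mon y) = - mon y.
  exact: geometric_split.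
clear nz nxy; move: sh nn E1 E2; rewrite /gap_shape /gap_abs; case: ifP => _ _ nn E1 E2.
  have xE : mon x = mon y * mon (x - y) by rewrite -monD // addrC subrK.
  rewrite opprB in E2; have [H1 H2] := geometric_factor (mon y) E1 E2.
  rewrite -xE in H1 H2; split.
    by rewrite -[mon x - mon y]opprB mulrN H2 opprK.
  by rewrite -[mon x - mon y]opprB mulrN H1.
rewrite opprB in nn E1 E2 *; rewrite opprB in E2.
have xE : mon y = mon x * mon (y - x) by rewrite -monD // addrC subrK.
by have := geometric_factor (mon x) E1 E2; rewrite -xE.
Qed.

Section Step.
Variables (A B : vfun F l -> vfun F l) (hA : is_opA A) (hB : is_opB B).

(** The hypothesis says that the ratio [q^(-1) z P_l / P_1], after [S], is one
of the monomials for which the expansions of the two operators are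
consistent. *)
Lemma Phi_term f P p : admissible l P ->
  gap_shape (subst_mon (qn_mon 1 + zn_mon (-1) + P_ P 1 - P_ P l)) ->
  A (term f P) p + B (term f P) p = Phi (term f P) p.
Proof.
move=> adm sh; rewrite (proj2 hA _ _ adm) (proj2 hB _ _ adm).
have szP := admissible_size (ltn0Sn m.+1) adm.
have nP i : nneg_mon (P_ P i) by apply: admissible_nneg adm.
pose x := subst_mon (P_ P 1); pose y := subst_mon (qn_mon (-1) + zn_mon 1 + P_ P l).
have nx : nneg_mon x by apply/nneg_subst/nP.
have yE : y = zn_mon 1 + subst_mon (P_ P l) by rewrite /y; laurent_lia.
have ny : nneg_mon y by rewrite yE; apply: nneg_monD => //; apply/nneg_subst/nP.
have xyE : subst_mon (qn_mon 1 + zn_mon (-1) + P_ P 1 - P_ P l) = x - y.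
  by rewrite /x /y; laurent_lia.
have yxE : subst_mon (qn_mon (-1) + zn_mon 1 + P_ P l - P_ P 1) = y - x.
  by rewrite /x /y; laurent_lia.
rewrite xyE in sh *; rewrite yxE.
pose C := \prod_(j < m) mon (subst_mon (P_ P j.+2)) ^+ expo p j.+2.
have brE u : bracket F [seq subst_mon v | v <- u :: take l.-1 P] p =
    mon (subst_mon u) ^+ expo p 0 * (mon x ^+ expo p 1 * C).
  have PS j : (j < n)%N ->
      P_ [seq subst_mon v | v <- u :: take l.-1 P] j.+2 = subst_mon (P_ P j.+1).
    by move=> jn; rewrite /P_ /= (nth_map 0) ?nth_take // size_take szP ltnSn.
  pose G j := mon (P_ [seq subst_mon v | v <- u :: take l.-1 P] j.+1) ^+ expo p j.
  have G1 : G 1%N = mon x ^+ expo p 1.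
    exact: (congr1 (fun v => mon v ^+ expo p 1) (PS 0%N isT)).
  have GS (j : 'I_m) : true -> G j.+2 = mon (subst_mon (P_ P j.+2)) ^+ expo p j.+2.
    have jn : (j.+1 < n)%N by rewrite ltnS.
    by move=> _; exact: (congr1 (fun v => mon v ^+ expo p j.+2) (PS _ jn)).
  have -> : mon (subst_mon u) ^+ expo p 0 = G 0%N by [].
  rewrite -G1 /C -(eq_bigr _ GS); exact: (prod_ord_first2 G).
have shE i : (i <= bound p 0)%N -> subst_qz (bracket F P (shift_params p i)) =
    mon x ^+ (expo p 0 - i) * mon x ^+ expo p 1 * C * mon (subst_mon (P_ P l)) ^+ i.
  move=> ib; rewrite /bracket.
  have -> : subst_qz (\prod_(j < l) mon (P_ P j.+1) ^+ expo (shift_params p i) j) =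
      \prod_(j < l) mon (subst_mon (P_ P j.+1)) ^+ expo (shift_params p i) j.
    have S1 : subst_qz (1 : psqz F) = 1 by apply: subst_qzC.
    rewrite (big_morph _ (@subst_qzM F) S1); apply: eq_bigr => j _.
    by rewrite subst_qzX (subst_qz_mon _ (nP _)).
  pose G j := mon (subst_mon (P_ P j.+1)) ^+ expo (shift_params p i) j.
  have GS (j : 'I_m) : true -> G j.+1 = mon (subst_mon (P_ P j.+2)) ^+ expo p j.+2.
    have jn : (j.+1 < n)%N by rewrite ltnS.
    by move=> _; exact: (congr1 (fun e => mon (subst_mon (P_ P j.+2)) ^+ e) (expo_shiftS ib jn)).
  transitivity (G 0%N * \prod_(j < m) G j.+1 * G n); first exact: prod_ord_ends.
  rewrite (eq_bigr _ GS) -/C /G (expo_shift_last ib) (expo_shift0 ib) exprD.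
  exact: erefl.
rewrite !termE !brE.
transitivity (subst_qz f * (mon x ^+ expo p 1 * C) *
   (inv_one_minus F (y - x) * mon x ^+ expo p 0 +
    inv_one_minus F (x - y) * mon y ^+ expo p 0)); first by rewrite -/x -/y; ring.
rewrite geometric // mulr_sumr /Phi expo0; apply: eq_bigr => i _.
have ib : (i <= bound p 0)%N by rewrite -ltnS.
rewrite termE subst_qzM (shE _ ib) expo0.
have -> : mon y = psz * mon (subst_mon (P_ P l)).
  by rewrite yE monD //; [rewrite mon_nat expr0 mul1r expr1|apply/nneg_subst/nP].
by rewrite exprMn; ring.
Qed.

Lemma Phi_act M p : goodb n M ->
  act A B (LA :: M) (@v_inf F l) p + act A B (LB :: M) (@v_inf F l) p =
  Phi (act A B M (@v_inf F l)) p.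
Proof.
move=> gM; have [E adm] := act_good (ltn0Sn m) hA hB gM.
rewrite -[act A B (LA :: M) _]/(A (act A B M (@v_inf F l))).
rewrite -[act A B (LB :: M) _]/(B (act A B M (@v_inf F l))).
rewrite E; apply: Phi_term => //.
have [b [a [w EM]]] := gapsE (ltn0Sn m) M.
have [-> Pl _] := P_points gM EM; rewrite [P_ _ l]Pl.
have -> : subst_mon (qn_mon 1 + zn_mon (-1) + first_pt n M - (first_pt n M + gap_total (a :: w))) =
    next_gap n M.
  by rewrite (gap_total_behead _ gM EM) // next_gapE EM [head _ _]/=; laurent_lia.
exact: next_gap_shape.
Qed.

End Step.
End Recursion.

(** * Configurations *)

Section Configurations.
Variables (F : fieldType) (m : nat).
Notation n := m.+1.
Notation l := m.+2.
Implicit Type p : params l.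

Definition fcons (i : nat) (y : nat -> nat) : nat -> nat :=
  fun j => if j is j'.+1 then y j' else i.

Lemma fcons_eta x : x = fcons (x 0%N) (fun j => x j.+1).
Proof. by apply: funext => -[]. Qed.

Lemma fcons_inj i i' y y' : fcons i y = fcons i' y' -> i = i' /\ y = y'.
Proof.
move=> E; split; first exact: (congr1 (fun f => f 0%N) E).
by apply: funext => j; exact: (congr1 (fun f => f j.+1) E).
Qed.

Lemma sum_fcons i y a : (\sum_(0 <= j < a.+1) fcons i y j = i + \sum_(0 <= j < a) y j)%N.
Proof. by rewrite big_nat_recl. Qed.

Lemma sum_fconsS i y a b :
  (\sum_(a.+1 <= j < b.+1) fcons i y j = \sum_(a <= j < b) y j)%N.
Proof. by rewrite big_add1. Qed.

Lemma configsE p N x : configs (par_k p) (par_b p) N x <->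
  [/\ forall i, (N <= i)%N -> x i = 0%N,
      forall j, (\sum_(j <= i < j + l) x i <= par_k p)%N &
      forall i, (i < n)%N -> (\sum_(0 <= j < i.+1) x j <= bound p i)%N].
Proof.
have bE (i : 'I_l.-1) : tnth (par_b p) i = bound p i.
  by rewrite /bound nth_rcons size_tuple ltn_ord (tnth_nth 0%N).
split=> [[[_ xw] [L [xL _] LN] xb]|[xN xw xb]].
  split=> // [i Ni|i li]; first by apply: xL; apply: leq_trans Ni.
  by have := xb (Ordinal (li : (i < l.-1)%N)); rewrite bE.
split; first by split=> //; exists N.
- have ex : exists L, `[< forall i, (L <= i)%N -> x i = 0%N >].
    by exists N; apply/asboolP.
  case: (ex_minnP ex) => L /asboolP xL minL; exists L.
    by split=> // N' /asboolP/minL.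
  by apply: minL; apply/asboolP.
- by move=> i; rewrite bE; apply: xb; apply: ltn_ord.
Qed.

Lemma configs_cons p N i y : configs (par_k p) (par_b p) N.+1 (fcons i y) <->
  (i <= bound p 0)%N /\
  configs (par_k (shift_params p i)) (par_b (shift_params p i)) N y.
Proof.
rewrite !configsE; split.
- move=> [xN xw xb]; have ib : (i <= bound p 0)%N.
    by have := xb 0%N isT; rewrite big_nat1.
  split=> //; split=> [j Nj|j|j jn].
  + by have := xN j.+1 Nj.
  + by have := xw j.+1; rewrite addSn sum_fconsS.
  + rewrite bound_shift // leq_subRL; last by apply: leq_trans ib _; apply: bound_mono.
    rewrite -sum_fcons; case: (ltnP j.+1 n) => [jn'|nj]; first exact: xb.
    have -> : j.+1 = n by apply/eqP; rewrite eqn_leq jn.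
    by rewrite bound_last; exact: (xw 0%N).
- move=> [ib [yN yw yb]].
  have bnd j : (j <= n)%N -> (\sum_(0 <= a < j.+1) fcons i y a <= bound p j)%N.
    rewrite sum_fcons; case: j => [|j] jn; first by rewrite big_geq // addn0.
    have := yb j jn; rewrite bound_shift // leq_subRL //.
    by apply: leq_trans ib _; apply: bound_mono.
  split=> [[|j] //|[|j]|j jn].
  + by rewrite ltnS => /yN.
  + by have := bnd n (leqnn _); rewrite bound_last.
  + by rewrite addSn sum_fconsS; apply: yw.
  + exact/bnd/ltnW.
Qed.

(** The configurations for [p], listed by their first entry. *)
Fixpoint config_seq (N : nat) p : seq (nat -> nat) :=
  if N is N'.+1 then
    [seq fcons i y | i <- iota 0 (bound p 0).+1, y <- config_seq N' (shift_params p i)]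
  else [:: fun=> 0%N].

Lemma config_seqP N p x : configs (par_k p) (par_b p) N x <-> x \in config_seq N p.
Proof.
elim: N p x => [|N IH] p x.
  rewrite configsE inE; split=> [[x0 _ _]|/eqP->].
    by apply/eqP/funext => i; apply: x0.
  by split=> // *; rewrite big1.
rewrite [x]fcons_eta configs_cons; split.
  move=> [ib /IH yc]; apply/allpairsPdep; exists (x 0%N), (fun j => x j.+1); split=> //.
  by rewrite mem_iota add0n ltnS.
case/allpairsPdep => i [y [ii yc /fcons_inj[-> ->]]]; split; last exact/IH.
by move: ii; rewrite mem_iota add0n ltnS.
Qed.

Lemma uniq_config_seq N p : uniq (config_seq N p).
Proof.
elim: N p => [//|N IH] p; apply: allpairs_uniq_dep => [|i _|]; first exact: iota_uniq.
  exact: IH.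
by move=> [i y] [i' y'] _ _ /= /fcons_inj[-> ->].
Qed.

Definition weight N (x : nat -> nat) : psqz F :=
  psq ^+ (\sum_(j < N) j * x j)%N * psz ^+ (\sum_(j < N) x j)%N.

Lemma chiE N p : chi F (par_k p) (par_b p) N = \sum_(x <- config_seq N p) weight N x.
Proof.
rewrite (fsbig_seq _ _ (uniq_config_seq N p)) /chi.
have -> : configs (par_k p) (par_b p) N = [set` config_seq N p]; last by [].
by apply/seteqP; split=> x /config_seqP.
Qed.

Lemma subst_weight N i y : weight N.+1 (fcons i y) = psz ^+ i * subst_qz (weight N y).
Proof.
rewrite /weight !big_ord_recl /= mul0n add0n subst_mul_qn subst_qzX subst_qz_z.
have -> : (\sum_(j < N) bump 0 j * y j = \sum_(j < N) j * y j + \sum_(j < N) y j)%N.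
  by rewrite -big_split /=; apply: eq_bigr => j _; rewrite /bump mulnDl mul1n addnC.
by rewrite !exprD exprMn; ring.
Qed.

Definition chiV N : vfun F l := fun p => chi F (par_k p) (par_b p) N.

Lemma chi_rec N p : chiV N.+1 p = Phi (chiV N) p.
Proof.
rewrite /chiV chiE big_allpairs_dep.
have -> : iota 0 (bound p 0).+1 = index_iota 0 (bound p 0).+1 by rewrite /index_iota subn0.
rewrite big_mkord /Phi; apply: eq_bigr => i _.
rewrite (chiE N (shift_params p i)) subst_qz_sum mulr_sumr.
by apply: eq_bigr => y _; rewrite subst_weight.
Qed.

Lemma chi0 p : chiV 0 p = 1.
Proof. by rewrite /chiV chiE big_seq1 /weight !big_ord0 !expr0 mulr1. Qed.

Lemma coefqz_chi_z0 N p i : coefqz (chiV N p) i 0 = (i == 0%N)%:R.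
Proof.
elim: N p i => [|N IH] p i; first by rewrite chi0 coefqz1 andbT.
rewrite chi_rec coefqz_Phi big_ord_recl big1 => [|a _] /=; last by [].
by rewrite !subn0 IH addr0.
Qed.

End Configurations.

(** * The sum over good words *)

Section Summation.
Variables (F : fieldType) (m : nat).
Notation n := m.+1.
Notation l := m.+2.
Hypothesis F2 : (2 : F) != 0.

(** The recursion expresses the coefficient of [q^i z^j], for [j > 0], through
coefficients of total degree [i]; so a family that satisfies it to growing
order in [q] is determined by its terms without [z]. *)
Lemma Phi_unique (H H' : nat -> vfun F l) :
  (forall N p i, coefqz (H N p) i 0 = coefqz (H' N p) i 0) ->
  (forall N p i, coefqz (H' N p) i 0 = coefqz (H' 0%N p) i 0) ->
  (forall N p i j, (i < N)%N ->
     coefqz (H N.+1 p) i j = coefqz (Phi (H N) p) i j) ->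
  (forall N p i j, (i < N)%N ->
     coefqz (H' N.+1 p) i j = coefqz (Phi (H' N) p) i j) ->
  forall N N' p i j, (i + j < N)%N -> (i + j < N')%N ->
    coefqz (H N p) i j = coefqz (H' N' p) i j.
Proof.
move=> H0 H0' HS HS' N N' p i j.
have [t] := ubnP (i + j)%N; elim: t N N' p i j => // t IH N N' p i j.
rewrite ltnS => ijt ijN ijN'.
case: (posnP j) => [->|j0]; first by rewrite H0 H0' -(H0' N').
case: N N' ijN ijN' => [//|N] [//|N'] ijN ijN'.
rewrite HS ?HS'; try lia.
rewrite !coefqz_Phi; apply: eq_bigr => a _; case: ifP => // /negbT.
by rewrite negb_or -!leqNgt => /andP[aj ji]; apply: IH; lia.
Qed.

Section Sums.
Variables (A B : vfun F l -> vfun F l) (hA : is_opA A) (hB : is_opB B).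
Notation v := (@v_inf F l).

Definition word_sum (N : nat) : vfun F l := fun p =>
  \sum_(M <- good_words n N) act A B M v p.

Lemma coefqz_sum I (r : seq I) (P : pred I) (f : I -> psqz F) i j :
  coefqz (\sum_(x <- r | P x) f x) i j = \sum_(x <- r | P x) coefqz (f x) i j.
Proof. by rewrite /coefqz !coefs_sum. Qed.

Lemma coefqzD (f g : psqz F) i j : coefqz (f + g) i j = coefqz f i j + coefqz g i j.
Proof. by []. Qed.

(** The recursion fails by the terms [A M v_oo] with [A M] not good. They cancel
in pairs or have order at least [N] in [q]. *)
Lemma word_sum_rec N p i j : (i < N)%N ->
  coefqz (word_sum N.+1 p) i j = coefqz (Phi (word_sum N) p) i j.
Proof.
move=> iN; rewrite [Phi _ _]Phi_sum /word_sum big_cat !big_map big_filter /=.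
have -> : \sum_(M <- good_words n N) Phi (act A B M v) p =
    \sum_(M <- good_words n N) (act A B (LA :: M) v p + act A B (LB :: M) v p).
  apply: eq_big_seq => M; rewrite mem_good_words => /andP[gM _].
  by rewrite (Phi_act hA hB).
rewrite big_split /= [X in _ = coefqz (X + _) _ _](bigID (allows_A n)) /=.
rewrite !coefqzD [X in _ = _ + X + _](_ : _ = 0) ?addr0 //.
rewrite coefqz_sum.
apply: (@bad_sum0 n (ltn0Sn m) F (fun M => coefqz (act A B (LA :: M) v p) i j) N F2) => [M M' gM gM' _ E|M1 r gM le].
  by rewrite (act_swap (ltn0Sn m) hA hB p gM gM' E) /coefqz !coefsN.
by apply: (actA_order (ltn0Sn m) hA hB) => //; apply: leq_trans le.
Qed.

Lemma coefqz_z0M (f g : psqz F) i : (forall i', coefqz g i' 0 = (i' == 0%N)%:R) ->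
  coefqz (f * g) i 0 = coefqz f i 0.
Proof.
move=> g1; have E : (f * g) 0%N = f 0%N * g 0%N.
  by rewrite [LHS]coefsM big_ord1.
have g01 : g 0%N = 1 by apply: fpsP => i'; rewrite coefs1; apply: g1.
by rewrite /coefqz E g01 mulr1.
Qed.

Lemma coefqz_v_inf p i : coefqz (v p) i 0 = (i == 0%N)%:R.
Proof.
rewrite /v_inf termE.
have b1 : bracket F (nseq l 0) p = 1.
  rewrite /bracket big1 // => j _.
  by rewrite /P_ nth_nseq if_same mon0 expr1n.
rewrite b1 mulr1 -(@coefqz_z0M _ (qpoch_inf psz)).
  by rewrite mulVr ?qpoch_inf_z_unit // coefqz1 andbT.
move=> i'; rewrite (@qpoch_infE _ _ i'.+1) //.
elim: i'.+1 => [|k IH]; first by rewrite /qpoch big_ord0 coefqz1 andbT.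
rewrite /qpoch big_ord_recr /= coefqz_z0M // => i''.
rewrite /coefqz !coefsB !coefs1 /=.
have := coefqz_qn_zn F k 1 i'' 0; rewrite expr1 /coefqz => ->.
by rewrite andbF subr0.
Qed.

Lemma word_sum_z0 N p i : coefqz (word_sum N p) i 0 = (i == 0%N)%:R.
Proof.
have gN : goodb n (nseq N LA) by have := goodb_pad (ltn0Sn m) [::] N.
have aN : act A B (nseq N LA) v = v.
  have := act_eqv (ltn0Sn m.+1) B (M := nseq N LA) (M' := [::]) hA; apply.
  by exists 0%N, N; rewrite cats0.
rewrite /word_sum coefqz_sum (bigD1_seq (nseq N LA)) ?uniq_good_words //=; last first.
  by rewrite mem_good_words gN size_nseq eqxx.
rewrite aN coefqz_v_inf big_seq_cond big1 ?addr0 // => M /andP[].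
rewrite mem_good_words => /andP[gM /eqP sM] nM.
have [[r E]|[M1 [r E]]] := trailing_A_cases M.
  by move: nM; rewrite -sM E size_nseq eqxx.
by rewrite E; apply: (act_order (ltn0Sn m) hA hB) => //; rewrite -?E // eqxx orbT.
Qed.

Lemma word_sum_chi N N' p i j : (i + j < N)%N -> (i + j < N')%N ->
  coefqz (word_sum N p) i j = coefqz (chiV F N' p) i j.
Proof.
apply: Phi_unique => {N N' p i j} [N p i|N p i|N p i j iN|N p i j iN].
- by rewrite word_sum_z0 coefqz_chi_z0.
- by rewrite !coefqz_chi_z0.
- exact: word_sum_rec.
- by rewrite chi_rec.
Qed.

Lemma coefqz_chi_inf N p i j : (i + j < N)%N ->
  coefqz (chi_inf F (par_k p) (par_b p)) i j = coefqz (word_sum N p) i j.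
Proof.
move=> ijN.
pose f : psqz F := Fps (fun j => Fps (fun i => coefqz (chiV F (i + j).+1 p) i j)).
have -> : chi_inf F (par_k p) (par_b p) = f.
  apply: ps_limE => i' j'; exists (i' + j').+1 => N' le.
  rewrite -[chi F _ _ N']/(chiV F N' p) -[RHS]/(coefqz (chiV F (i' + j').+1 p) i' j').
  by rewrite -(@word_sum_chi N') // (@word_sum_chi _ (i' + j').+1).
by rewrite (@word_sum_chi N (i + j).+1).
Qed.

Lemma class_eqv (M M' : word) : (\pi M : word_class)%qT = (\pi M')%qT <-> word_eqv M M'.
Proof. by split=> [/eqmodP/asboolP|e] //; apply/eqmodP/asboolP. Qed.

Lemma repr_eqv (M : word) : word_eqv (repr (\pi M : word_class)%qT) M.
Proof. by apply/class_eqv; rewrite reprK. Qed.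

Lemma eqv_same_size (M M' : word) : size M = size M' -> word_eqv M M' -> M = M'.
Proof.
move=> sz [r [r' E]]; have := congr1 (take (size M)) E.
by rewrite take_size_cat // sz take_size_cat.
Qed.

Lemma eqv_pad (M : word) r r' : word_eqv (M ++ nseq r LA) (M ++ nseq r' LA).
Proof. by exists r', r; rewrite -!catA -!nseqD addnC. Qed.

(** A class with a nonzero coefficient at [q^i z^j] has its last letter B within
the first [i + 1] places, so it contains a word of length [i + j + 1]. *)
Lemma sum_good_classes p :
  ps_sum [set c : word_class | good l (repr c)] (fun c => act A B (repr c) v p)
    (chi_inf F (par_k p) (par_b p)).
Proof.
move=> i j; pose N := (i + j).+1.
pose r : seq word_class := [seq (\pi M)%qT | M <- good_words n N].
have ur : uniq r.
  rewrite map_inj_in_uniq ?uniq_good_words // => M M'.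
  rewrite !mem_good_words => /andP[_ /eqP sM] /andP[_ /eqP sM'] /class_eqv.
  by apply: eqv_same_size; rewrite sM.
have rD : [set` r] `<=` [set c : word_class | good l (repr c)].
  move=> c /= /mapP[M]; rewrite mem_good_words => /andP[gM _] ->.
  apply: (good_eqv (M := M)); last by apply/(good_goodb (ltn0Sn m)).
  by have [a [b E]] := repr_eqv M; exists b, a.
have out (c : word_class) : good l (repr c) ->
    coefqz (act A B (repr c) v p) i j != 0 -> c \in r.
  move=> /(good_goodb (ltn0Sn m)) gM nz.
  have inr M0 a : repr c = M0 ++ nseq a LA -> (size M0 <= N)%N -> c \in r.
    move=> E le; apply/mapP; exists (M0 ++ nseq (N - size M0) LA).
      rewrite mem_good_words size_cat size_nseq subnKC // eqxx andbT.
      by rewrite (goodb_pad (ltn0Sn m)) -(goodb_pad (ltn0Sn m) _ a) -E.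
    by rewrite -[LHS]reprK E; apply/class_eqv/eqv_pad.
  have [[a E]|[M1 [a E]]] := trailing_A_cases (repr c); first exact: (inr [::] a).
  case: (ltnP i (size M1)) => [lt|le].
    by case/eqP: nz; rewrite E; apply: (act_order (ltn0Sn m) hA hB); rewrite -?E ?lt.
  apply: (inr (rcons M1 LB) a); first by rewrite E cat_rcons.
  by rewrite size_rcons ltnS (leq_trans le) // leq_addr.
split.
  by apply: (@sub_finite_set _ _ [set` r]); [move=> c [gc nz]; apply: out|exact: finite_seq].
rewrite (@coefqz_chi_inf N) // -(@fsbig_widen _ _ _ _ [set` r]) //; last first.
  move=> c [gc nc]; apply/eqP; apply: contraT => nz; case: nc; exact: out.
rewrite -fsbig_seq // big_map /word_sum coefqz_sum; apply: eq_bigr => M _.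
by rewrite (act_eqv (ltn0Sn m.+1) B hA (repr_eqv M)).
Qed.

End Sums.
End Summation.

Theorem theorem2p7 (R : realType) (k l : nat) (b : l.-1.-tuple nat)
    (hk : (1 <= k)%N) (hl : (2 <= l)%N) (hb : sorted leq (rcons b k))
    (A B : vfun R[i] l -> vfun R[i] l) (hA : is_opA A) (hB : is_opB B) :
  ps_sum [set c : word_class | good l (repr c)]
    (fun c => act A B (repr c) (@v_inf R[i] l) (Params hk hb))
    (chi_inf R[i] k b) /\
  forall M : word, good l M ->
    exists (alpha beta gamma : nat) (t : l.-1.-tuple nat),
      act A B M (@v_inf R[i] l) (Params hk hb) =
      (-1) ^+ alpha * psq ^+ beta * psz ^+ gamma /
      (\prod_(i < l.-1) qpoch psq (tnth t i) *
       qpoch_inf (psq ^+ (\sum_(i < l.-1) tnth t i)%N * psz)).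
Proof.
have R2 : (2 : R[i]) != 0 by rewrite pnatr_eq0.
case: l b hl hb A B hA hB => [|[|m]] // b hl hb A B hA hB; split.
  exact: (sum_good_classes R2 hA hB (@Params m.+2 b k hk hb)).
move=> M /(good_goodb (ltn0Sn m)) gM.
exact: (act_form (ltn0Sn m) hA hB (@Params m.+2 b k hk hb) gM).
Qed.
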